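(* Let $G$ be a polynomial semigroup generated by a compact subset $\Gamma$ of $\mathrm{Poly}_{\deg\geq2}$. Suppose that $G\in\mathcal{G}$ and $\mathrm{int}(\hat{K}(G))\neq\emptyset$. Let $b\in\mathrm{int}(\hat{K}(G))$. Moreover, let $d\in\mathbb{N}$ be any positive integer such that $d\geq2$ and such that $(d,\deg(h))\neq(2,2)$ for each $h\in\Gamma$. Then there exists a number $c>0$ such that for each $a\in\mathbb{C}$ with $0<|a|<c$, there exists a compact neighborhood $V$ of $g_a(z)=a(z-b)^d+b$ in $\mathrm{Poly}_{\deg\geq2}$ satisfying that for any non-empty subset $V'$ of $V$, the polynomial semigroup $H_{\Gamma,V'}$ generated by the family $\Gamma\cup V'$ belongs to $\mathcal{G}_{dis}$, $\hat{K}(H_{\Gamma,V'})=\hat{K}(G)$, and $(\Gamma\cup V')_{\min}\subset\Gamma$. Moreover, if, in addition to these assumptions on $G$, $\Gamma$, $b$ and $d$, $G$ is semi-hyperbolic (resp. hyperbolic), then $c$ and, for each $a\in\mathbb{C}$ with $0<|a|<c$, the compact neighborhood $V$ of $g_a$ can be chosen so that, in addition to these properties, for any non-empty subset $V'$ of $V$ the polynomial semigroup $H_{\Gamma,V'}$ generated by the family $\Gamma\cup V'$ is semi-hyperbolic (resp. hyperbolic).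
   Context: $\hat{\mathbb{C}}$ is the Riemann sphere. $\mathrm{Poly}_{\deg\geq2}$ is the set of polynomial maps $\hat{\mathbb{C}}\to\hat{\mathbb{C}}$ of degree at least two with the topology of uniform convergence on $\hat{\mathbb{C}}$ with respect to the spherical distance. A polynomial semigroup is a semigroup, under composition, generated by a non-empty family of non-constant polynomial maps. The Fatou set $F(G)$ is the set of $z\in\hat{\mathbb{C}}$ having a neighborhood on which $G$ is a normal family; the Julia set is $J(G)=\hat{\mathbb{C}}\setminus F(G)$; for a single map $g$, $J(g)=J(\langle g\rangle)$. $CV(g)$ is the set of critical values of $g:\hat{\mathbb{C}}\to\hat{\mathbb{C}}$, $P(G)=\overline{\bigcup_{g\in G}CV(g)}$ (closure in $\hat{\mathbb{C}}$), and $P^{\ast}(G)=P(G)\setminus\{\infty\}$. $\mathcal{G}$ is the set of all polynomial semigroups $G$ such that each element of $G$ has degree at least two and $P^{\ast}(G)$ is bounded in $\mathbb{C}$; $\mathcal{G}_{dis}$ is the set of $G\in\mathcal{G}$ with $J(G)$ disconnected. $\hat{K}(G)=\{z\in\mathbb{C}\mid\bigcup_{g\in G}\{g(z)\}\text{ is bounded in }\mathbb{C}\}$. $\mathrm{int}$ denotes the set of interior points. For $G\in\mathcal{G}_{dis}$ all connected components of $J(G)$ are contained in $\mathbb{C}$, and $J_{\min}(G)$ denotes the (existing, unique) minimal one with respect to the surrounding order ($K_1\leq K_2$ iff $K_1=K_2$ or $K_1$ is included in a bounded component of $\mathbb{C}\setminus K_2$). If $H\in\mathcal{G}_{dis}$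 is generated by a subset $\Lambda$ of $\mathrm{Poly}_{\deg\geq2}$, then $\Lambda_{\min}=\{h\in\Lambda\mid J(h)\subset J_{\min}(H)\}$; in particular $(\Gamma\cup V')_{\min}$ is taken with respect to $H_{\Gamma,V'}$. $G$ is hyperbolic if $P(G)\subset F(G)$. $G$ is semi-hyperbolic if there exist $\delta>0$ and $N\in\mathbb{N}$ such that for each $y\in J(G)$ and each $g\in G$, $\deg(g:V\to B(y,\delta))\leq N$ for each connected component $V$ of $g^{-1}(B(y,\delta))$, where $B(y,\delta)$ is the ball of radius $\delta$ centered at $y$ in the spherical distance and $\deg$ is the degree of a finite branched covering. *)

(* Defs.v *)
From HB Require Import structures.
From mathcomp Require Import all_boot all_order all_algebra.
From mathcomp Require Import all_classical all_reals all_analysis.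
From mathcomp Require Import complex ring lra.

Set Implicit Arguments.
Unset Strict Implicit.
Unset Printing Implicit Defensive.

Import Order.TTheory GRing.Theory Num.Theory.
Import numFieldNormedType.Exports.
Local Open Scope classical_set_scope.
Local Open Scope ring_scope.

HB.instance Definition _ (R : realType) := NormedModule.copy R[i] (R[i])^o.

(* The Riemann sphere; [None] is the point at infinity. *)
Definition sphere (R : realType) : Type := option R[i].
HB.instance Definition _ (R : realType) := Choice.on (sphere R).

Section SphericalDistance.
Context {R : realType}.

Definition dot3 (u v : R * R * R) : R :=
  u.1.1 * v.1.1 + u.1.2 * v.1.2 + u.2 * v.2.

(* Inverse stereographic projection onto the unit sphere of R^3. *)
Definition stereo (z : sphere R) : R * R * R :=
  if z is Some x then
    let s := complex.Re x ^+ 2 + complex.Im x ^+ 2 in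
    (2 * complex.Re x / (s + 1), 2 * complex.Im x / (s + 1), (s - 1) / (s + 1))
  else (0, 0, 1).

(* Length of the great circle arc between the two projected points. *)
Definition sph_dist (z w : sphere R) : R := acos (dot3 (stereo z) (stereo w)).

Lemma stereo_unit z : dot3 (stereo z) (stereo z) = 1.
Proof.
case: z => [[a b]|]; rewrite /dot3 /=; last by rewrite !mul0r !add0r mul1r.
have h : a ^+ 2 + b ^+ 2 + 1 != 0.
  by rewrite gt_eqF// ltr_wpDl// addr_ge0// sqr_ge0.
by field.
Qed.

Lemma stereo_inj : injective stereo.
Proof.
have pos (a b : R) : a ^+ 2 + b ^+ 2 + 1 != 0.
  by rewrite gt_eqF// ltr_wpDl// addr_ge0// sqr_ge0.
have inf (a b : R) : (a ^+ 2 + b ^+ 2 - 1) / (a ^+ 2 + b ^+ 2 + 1) != 1.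
  apply/eqP => /(congr1 (fun t => t * (a ^+ 2 + b ^+ 2 + 1))).
  by rewrite divfK// mul1r => ?; lra.
case=> [[a b]|] [[c d]|] //=.
- case=> e1 e2 e3; congr Some.
  have h1 := pos a b; have h2 := pos c d.
  set s := a ^+ 2 + b ^+ 2 in e1 e2 e3 h1; set t := c ^+ 2 + d ^+ 2 in e1 e2 e3 h2.
  have st : s = t.
    move/eqP: e3; rewrite eqr_div// => /eqP e3; lra.
  rewrite -st in e1 e2.
  have k : (s + 1)^-1 != 0 by rewrite invr_eq0.
  move/(mulIf k): e1 => e1; move/(mulIf k): e2 => e2.
  by congr Complex; lra.
- by case=> _ _ /eqP; rewrite (negbTE (inf _ _)).
- by case=> _ _ /esym /eqP; rewrite (negbTE (inf _ _)).
Qed.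

Lemma dot3C u v : dot3 u v = dot3 v u.
Proof. by rewrite /dot3; ring. Qed.

Lemma dot3_bound u v : dot3 u u = 1 -> dot3 v v = 1 -> -1 <= dot3 u v <= 1.
Proof.
move: u v => [[a b] c] [[d e] f]; rewrite /dot3 /= => hu hv.
have h1 := sqr_ge0 (a - d); have h2 := sqr_ge0 (b - e).
have h3 := sqr_ge0 (c - f); have h4 := sqr_ge0 (a + d).
have h5 := sqr_ge0 (b + e); have h6 := sqr_ge0 (c + f).
by apply/andP; split; lra.
Qed.

Lemma dot3_eq1 u v : dot3 u u = 1 -> dot3 v v = 1 -> dot3 u v = 1 -> u = v.
Proof.
move: u v => [[a b] c] [[d e] f]; rewrite /dot3 /= => hu hv h.
have h1 := sqr_ge0 (a - d); have h2 := sqr_ge0 (b - e).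
have h3 := sqr_ge0 (c - f).
have k1 : (a - d) ^+ 2 = 0 by lra.
have k2 : (b - e) ^+ 2 = 0 by lra.
have k3 : (c - f) ^+ 2 = 0 by lra.
by move/eqP: k1; move/eqP: k2; move/eqP: k3; rewrite !sqrf_eq0 !subr_eq0
  => /eqP -> /eqP -> /eqP ->.
Qed.

(* The Gram determinant of three vectors of R^3 is a square. *)
Lemma dot3_gram u v w : dot3 u u = 1 -> dot3 v v = 1 -> dot3 w w = 1 ->
  (dot3 u w - dot3 u v * dot3 v w) ^+ 2 <=
  (1 - dot3 u v ^+ 2) * (1 - dot3 v w ^+ 2).
Proof.
move=> hu hv hw; rewrite -subr_ge0.
have -> : (1 - dot3 u v ^+ 2) * (1 - dot3 v w ^+ 2) -
          (dot3 u w - dot3 u v * dot3 v w) ^+ 2 =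
  dot3 u u * dot3 v v * dot3 w w + 2 * dot3 u v * dot3 v w * dot3 u w
  - dot3 u u * dot3 v w ^+ 2 - dot3 v v * dot3 u w ^+ 2
  - dot3 w w * dot3 u v ^+ 2 by rewrite hu hv hw; ring.
move: u v w {hu hv hw} => [[a b] c] [[d e] f] [[g h] i]; rewrite /dot3 /=.
have := sqr_ge0 (a * (e * i - f * h) - b * (d * i - f * g) + c * (d * h - e * g)).
by congr (_ <= _); ring.
Qed.

Lemma acos_dot3_triangle u v w :
  dot3 u u = 1 -> dot3 v v = 1 -> dot3 w w = 1 ->
  acos (dot3 u w) <= acos (dot3 u v) + acos (dot3 v w).
Proof.
move=> hu hv hw.
have b1 := dot3_bound hu hw; have b2 := dot3_bound hu hv.
have b3 := dot3_bound hv hw.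
have g := dot3_gram hu hv hw.
have [ge|lt] := leP pi (acos (dot3 u v) + acos (dot3 v w)).
  by apply: le_trans ge; exact: acos_lepi.
have s0 : 0 <= acos (dot3 u v) + acos (dot3 v w) by rewrite addr_ge0// acos_ge0.
rewrite leNgt; apply/negP => lt2.
have : cos (acos (dot3 u w)) < cos (acos (dot3 u v) + acos (dot3 v w)).
  by rewrite ltr_cos// in_itv/= ?acos_ge0 ?acos_lepi// s0 ltW.
rewrite cosD !acosK ?in_itv/= ?b1 ?b2 ?b3// !sin_acos//.
apply/negP; rewrite -leNgt lerBlDr -lerBlDl.
rewrite -sqrtrM; last by case/andP: b2 => ? ?; nra.
apply: le_trans (ler_wsqrtr g).
by rewrite sqrtr_sqr -normrN opprB ler_norm.
Qed.

Lemma sph_distxx z : sph_dist z z = 0.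
Proof. by rewrite /sph_dist stereo_unit acos1. Qed.

Lemma sph_dist_eq0 z w : sph_dist z w = 0 -> z = w.
Proof.
move=> h; apply: stereo_inj; apply: dot3_eq1; rewrite ?stereo_unit//.
have b := dot3_bound (stereo_unit z) (stereo_unit w).
by rewrite -[LHS]acosK ?in_itv//= -/(sph_dist z w) h cos0.
Qed.

Lemma sph_distC z w : sph_dist z w = sph_dist w z.
Proof. by rewrite /sph_dist dot3C. Qed.

Lemma sph_dist_triangle y x z : sph_dist x z <= sph_dist x y + sph_dist y z.
Proof. by apply: acos_dot3_triangle; exact: stereo_unit. Qed.

HB.instance Definition _ := @isMetric.Build R (sphere R) sph_dist
  sph_distxx sph_dist_eq0 sph_distC sph_dist_triangle.

End SphericalDistance.

Section PolynomialMaps.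
Context {R : realType}.
Local Notation C := R[i].
Local Notation Chat := (sphere R).

Definition pdeg (p : {poly C}) : nat := (size p).-1.

Definition polymap (p : {poly C}) : {uniform Chat -> Chat} := fun z =>
  match z with
  | Some x => Some p.[x]
  | None => if (pdeg p == 0)%N then Some p`_0 else None
  end.

(* Polynomials with the topology of uniform convergence of [polymap] on the
   sphere; as [polymap] is injective, this is the topology of a subspace of
   the space of maps. *)
Definition poly_unif : Type := initial_topology polymap.
HB.instance Definition _ := Topological.on poly_unif.

Definition poly_ge2 : set {poly C} := [set p | (2 <= pdeg p)%N].

Definition poly_compact (A : set {poly C}) : Prop := compact (A : set poly_unif).

Definition compact_nbhs_ge2 (g : {poly C}) (V : set {poly C}) : Prop :=
  [/\ V `<=` poly_ge2, poly_compact V & within poly_ge2 (nbhs (g : poly_unif)) V].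

(* Ramification index of [polymap p] at a point, for nonconstant [p]. *)
Definition local_degree (p : {poly C}) (z : Chat) : nat :=
  if z is Some x then mup x (p - p.[x]%:P) else pdeg p.

Definition critical_values (p : {poly C}) : set Chat :=
  polymap p @` [set z | (1 < local_degree p z)%N].

(* [polymap p : V -> B] is a branched covering of degree [n]: every point of
   [B] has [n] preimages in [V], counted with multiplicity. *)
Definition covering_degree (p : {poly C}) (V B : set Chat) (n : nat) : Prop :=
  forall w, B w ->
    \big[addn/0%N]_(z \in V `&` polymap p @^-1` [set w]) local_degree p z = n.

End PolynomialMaps.

Definition is_component (T : topologicalType) (A K : set T) : Prop :=
  exists2 x, A x & K = connected_component A x.

Section Semigroups.
Context {R : realType}.
Local Notation C := R[i].
Local Notation Chat := (sphere R).
Implicit Types (G L : set {poly C}) (p : {poly C}) (K : set Chat).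

Definition semigroup_gen L : set {poly C} :=
  smallest [set G | forall g h, G g -> G h -> G (g \Po h)] L.

Definition polynomial_semigroup G : Prop :=
  exists L, [/\ L !=set0, L `<=` [set p | (1 <= pdeg p)%N] & G = semigroup_gen L].

(* Normality on an open set: every sequence has a subsequence converging
   uniformly on compact subsets, for the spherical distance. *)
Definition normal_on G (U : set Chat) : Prop :=
  forall f : nat -> {poly C}, (forall n, G (f n)) ->
  exists (phi : nat -> nat) (l : Chat -> Chat),
    {homo phi : m n / (m < n)%N} /\
    {family compactly_in U, (fun n => polymap (f (phi n))) @ \oo --> l}.

Definition fatou G : set Chat :=
  [set z | exists2 U, open_nbhs z U & normal_on G U].

Definition julia G : set Chat := ~` fatou G.

Definition postcritical G : set Chat :=
  closure (\bigcup_(g in G) critical_values g).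

Definition postcritically_bounded G : Prop :=
  [/\ polynomial_semigroup G, G `<=` poly_ge2
    & bounded_set [set x : C | postcritical G (Some x)]].

Definition postcritically_bounded_dis G : Prop :=
  postcritically_bounded G /\ ~ connected (julia G).

Definition Khat G : set C := [set x : C | bounded_set [set g.[x] | g in G]].

Definition plane_part K : set C := [set x : C | K (Some x)].

Definition surrounded K1 K2 : Prop :=
  K1 = K2 \/
  exists D : set C, [/\ is_component (~` plane_part K2) D, bounded_set D
    & K1 `<=` Some @` D].

Definition minimal_component G K : Prop :=
  is_component (julia G) K /\
  forall K', is_component (julia G) K' -> surrounded K' K -> K' = K.

(* The minimal component; the default value [set0] is irrelevant for the
   semigroups to which this is applied, where it exists and is unique. *)
Definition julia_min G : set Chat := xget set0 [set K | minimal_component G K].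

Definition gen_min L : set {poly C} :=
  [set h | L h /\ julia (semigroup_gen [set h]) `<=` julia_min (semigroup_gen L)].

Definition hyperbolic G : Prop := postcritical G `<=` fatou G.

Definition semi_hyperbolic G : Prop :=
  exists (delta : R) (N : nat), 0 < delta /\
  forall y g V, julia G y -> G g ->
    is_component (polymap g @^-1` ball y delta) V ->
    exists2 n, covering_degree g V (ball y delta) n & (n <= N)%N.

End Semigroups.

(* Main.v *)
Require Import Defs.
From HB Require Import structures.
From mathcomp Require Import all_boot all_order all_algebra.
From mathcomp Require Import all_classical all_reals all_analysis.
From mathcomp Require Import complex ring lra.
From mathcomp Require cyclic cyclotomic separable.

Set Implicit Arguments.
Unset Strict Implicit.
Unset Printing Implicit Defensive.

Import Order.TTheory GRing.Theory Num.Theory.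
Import numFieldNormedType.Exports.
Local Open Scope classical_set_scope.
Local Open Scope ring_scope.
Local Open Scope complex_scope.

Local Notation fatou := Defs.fatou.

(* Write K for the filled set Khat G.  A perturbation g close to a (z - b)^d + b with
   small a maps K, and even a much larger disc D(b, s2), into a small disc around b
   inside int K; hence K is forward invariant under the big semigroup H, Khat H = K and
   the finite postcritical set of H lies in K.  The generators of G map the exterior of
   a disc D(b, s1), s1 < s2, to a region from which everything escapes, so the annulus
   s1 < |z - b| < s2 consists of points escaping under G and points sent into K under
   g: it lies in F(H) and separates J(h), h in Gamma, from the Julia sets of the
   perturbations.

   For (semi-)hyperbolicity, if the elements of G have bounded valence on components of
   preimages of small discs centred on the boundary of K, a minimum modulus argument
   keeps the G-orbit of a small disc around b uniformly inside int K.  An element of H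
   is u o v with u in G or the identity and the critical values of v, if v is not the
   identity, near b.  Components of preimages of small discs under u are small and stay
   away from b, so v is injective above them, and the valence of u o v is that of u. *)

(** * The complex plane and the Riemann sphere *)

(** The exclusion of the degrees (2, 2) makes room for the annulus. The radius beyond which the
    generators of G enter the escape region of H, and the radius up to which a perturbation
    contracts into the small disc, grow like powers of 1/|a|; the powers coincide for d = 2 and a
    quadratic generator.

    All function theory is reduced to polynomials. Normality becomes equicontinuity for the
    spherical distance, shared by maps uniformly large on a disc and maps uniformly bounded there.
    The degree of a covering is a number of roots with multiplicity; openness and minimum modulus
    come from linear factors.

    The obstacle in semi-hyperbolicity is that J(H) has points off the boundary of K. A small disc
    around such a point either misses K, hence all finite critical values, so that words are
    injective on components above it, or lies in a slightly larger disc centred on the boundary of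
    K. That boundary is contained in J(G), where the hypothesis on G applies, and no point of J(H)
    is interior to K. *)

Definition cabs {R : realType} (z : R[i]) : R := ComplexField.Normc.normc z.

Section Modulus.
Context {R : realType}.
Local Notation C := R[i].
Implicit Types (z w : C).

Lemma normr_cabs z : `|z| = (cabs z)%:C. Proof. by []. Qed.

Lemma cabsE z : (cabs z)%:C = `|z|. Proof. by []. Qed.

Lemma cabs_ge0 z : 0 <= cabs z. Proof. by rewrite -ler0c cabsE. Qed.
Hint Resolve cabs_ge0 : core.

Lemma cabs0 : cabs (0 : C) = 0. Proof. exact: ComplexField.Normc.normc0. Qed.
Lemma cabs1 : cabs (1 : C) = 1. Proof. exact: ComplexField.Normc.normc1. Qed.
Lemma cabsM z w : cabs (z * w) = cabs z * cabs w.
Proof. exact: ComplexField.Normc.normcM. Qed.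
Lemma cabsD z w : cabs (z + w) <= cabs z + cabs w.
Proof. by rewrite -lecR rmorphD /= !cabsE ler_normD. Qed.
Lemma cabsN z : cabs (- z) = cabs z.
Proof. by apply: complexI; rewrite !cabsE normrN. Qed.
Lemma cabsX z n : cabs (z ^+ n) = cabs z ^+ n.
Proof. by elim: n => [|n IH]; rewrite ?expr0 ?cabs1// !exprS cabsM IH. Qed.
Lemma cabsC z w : cabs (z - w) = cabs (w - z).
Proof. by rewrite -cabsN opprB. Qed.
Lemma cabs_eq0 z : (cabs z == 0) = (z == 0).
Proof. by rewrite -(inj_eq (@complexI R)) cabsE normr_eq0. Qed.
Lemma cabs_gt0 z : (0 < cabs z) = (z != 0).
Proof. by rewrite lt_def cabs_ge0 cabs_eq0 andbT. Qed.
Lemma cabs_real (x : R) : 0 <= x -> cabs x%:C = x.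
Proof. by move=> x0; apply: complexI; rewrite cabsE ger0_norm ?ler0c. Qed.
Lemma cabs_nat n : cabs (n%:R : C) = n%:R.
Proof. by rewrite -(@cabs_real n%:R)// rmorph_nat. Qed.
Lemma cabs_dist u z w : cabs (z - w) <= cabs (z - u) + cabs (u - w).
Proof. by rewrite (le_trans _ (cabsD _ _))// addrA subrK. Qed.
Lemma cabsB z w : cabs z - cabs w <= cabs (z - w).
Proof. by rewrite lerBlDr -{1}(subrK w z) cabsD. Qed.
Lemma cabsDl z w : cabs z - cabs w <= cabs (z + w).
Proof. by have := cabsB z (- w); rewrite opprK cabsN. Qed.
Lemma cabs_sum I (r : seq I) (P : pred I) (F : I -> C) :
  cabs (\sum_(i <- r | P i) F i) <= \sum_(i <- r | P i) cabs (F i).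
Proof.
elim/big_rec2 : _ => [|i y x _ le]; first by rewrite cabs0.
by rewrite (le_trans (cabsD _ _))// lerD2l.
Qed.
Lemma cabs_prod I (r : seq I) (P : pred I) (F : I -> C) :
  cabs (\prod_(i <- r | P i) F i) = \prod_(i <- r | P i) cabs (F i).
Proof. by elim/big_rec2 : _ => [|i y x _ le]; rewrite ?cabs1// cabsM le. Qed.
Lemma cabs_sqr z : cabs z ^+ 2 = complex.Re z ^+ 2 + complex.Im z ^+ 2.
Proof. by case: z => a b; rewrite /cabs /= sqr_sqrtr// addr_ge0// sqr_ge0. Qed.

Lemma nbhs_cabsP (x : C) (A : set C) :
  nbhs x A <-> exists2 e : R, 0 < e & forall y, cabs (y - x) < e -> A y.
Proof.
split.
  move=> /nbhs_ballP[e /= e0 eA]; have [er ei] : e = (complex.Re e)%:C /\ 0 < complex.Re e.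
    by case: e e0 {eA} => a b; rewrite ltcE /= => /andP[/eqP -> ?]; split.
  exists (complex.Re e) => // y yx; apply: eA.
  by rewrite -ball_normE /= distrC er normr_cabs ltcR.
case=> e e0 eA; apply/nbhs_ballP; exists e%:C; rewrite /= ?ltcR// => y.
by rewrite -ball_normE /= distrC normr_cabs ltcR => /eA.
Qed.

Lemma near_cabs (x : C) (e : R) : 0 < e -> \forall y \near x, cabs (y - x) < e.
Proof. by move=> e0; apply/nbhs_cabsP; exists e. Qed.

Lemma open_cabsP (A : set C) :
  open A <-> forall x, A x -> exists2 e : R, 0 < e & forall y, cabs (y - x) < e -> A y.
Proof.
rewrite openE; split => [oA x /oA /nbhs_cabsP//|H x /H Ax].
exact/nbhs_cabsP.
Qed.

Lemma closure_cabsP (A : set C) x :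
  closure A x <-> forall e : R, 0 < e -> exists2 y, A y & cabs (y - x) < e.
Proof.
split=> [cA e e0|H B /nbhs_cabsP[e e0 eB]].
  by have [y [Ay ye]] := cA _ (near_cabs x e0); exists y.
by have [y Ay /eB By] := H _ e0; exists y.
Qed.

Lemma closed_cabsP (A : set C) :
  closed A <-> forall x, (forall e : R, 0 < e -> exists2 y, A y & cabs (y - x) < e) -> A x.
Proof.
by split=> [cA x H|H x /closure_cabsP /H//]; apply: cA; exact/closure_cabsP.
Qed.

Lemma bounded_cabsP (A : set C) :
  bounded_set A <-> exists M : R, forall z, A z -> cabs z <= M.
Proof.
split=> [[M [/complex_realP[k ->] H]]|[M H]].
  exists (k + 1) => z Az; have /= := H (k + 1)%:C _ z Az.
  by rewrite ltcR ltrDl ltr01 => /(_ isT); rewrite normr_cabs lecR.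
exists M%:C; split; first by apply/complex_realP; exists M.
move=> [m mi]; rewrite ltcE /= => /andP[/eqP -> Mm] z /H zM.
by rewrite /= normr_cabs lecE /= eqxx /= (le_trans zM)// ltW.
Qed.

Lemma disc_compact (c : C) (r : R) : compact [set z : C | cabs (z - c) <= r].
Proof.
pose f (p : R * R) : C := p.1 +i* p.2.
have cf : continuous f.
  move=> [a b0] A /nbhs_cabsP[e e0 eA].
  have e20 : 0 < e / 2 by rewrite divr_gt0.
  exists (ball a (e / 2), ball b0 (e / 2)) => /=; first by split; exact: nbhsx_ballx.
  case=> x y [] /=; rewrite -!ball_normE /= => xa yb; apply: eA.
  have -> : f (x, y) - f (a, b0) = (x - a)%:C + 'i * (y - b0)%:C.
    rewrite /f /=; apply/eqP; rewrite eq_complex /=; apply/andP; split; apply/eqP; ring.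
  apply: le_lt_trans (cabsD _ _) _; rewrite cabsM.
  have nr (t : R) : cabs t%:C = `|t|.
    by rewrite /cabs /= expr0n /= addr0 sqrtr_sqr.
  have -> : cabs ('i : C) = 1 by rewrite /cabs /= expr0n /= add0r expr1n sqrtr1.
  rewrite !nr mul1r (distrC x) (distrC y); lra.
pose a := complex.Re c; pose b := complex.Im c.
have cK : compact (`[a - r, a + r]%classic `*` `[b - r, b + r]%classic).
  by apply: compact_setX; exact: segment_compact.
have -> : [set z : C | cabs (z - c) <= r] =
    f @` (`[a - r, a + r]%classic `*` `[b - r, b + r]%classic) `&` [set z | cabs (z - c) <= r].
  rewrite eqEsubset; split => [z zc|z [] //]; split => //.
  have : cabs (z - c) ^+ 2 <= r ^+ 2.
    by rewrite ler_sqr// nnegrE// (le_trans _ zc).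
  have r0 : 0 <= r by apply: le_trans zc.
  rewrite cabs_sqr; case: z {zc} => x y; rewrite /a /b; case: (c) => p q /= h.
  exists (x, y) => //=; rewrite !in_itv /=.
  have h1 := sqr_ge0 (x - p); have h2 := sqr_ge0 (y - q).
  by split; apply/andP; split; nra.
apply: compact_closedI; first by apply: continuous_compact => //; exact: continuous_subspaceT.
rewrite closed_cabsP => x H /=; rewrite leNgt; apply/negP => lt.
have e0 : 0 < cabs (x - c) - r by rewrite subr_gt0.
have [y /= yc] := H _ e0.
have := cabs_dist y x c; rewrite (cabsC x y); lra.
Qed.

Lemma closed_bounded_compact (A : set C) (c : C) (r : R) : closed A ->
  (forall z, A z -> cabs (z - c) <= r) -> compact A.
Proof.
move=> cA Ar; rewrite -(setIidr Ar) setIC.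
by rewrite setIC; apply: compact_closedI => //; exact: disc_compact.
Qed.

(** The form in which connectedness is used throughout: [P] and its complement are relatively open
    in [A], stated with radii. The unions of the witnessing discs supply the open and the closed set
    that [connected] asks for. *)
Lemma connected_clopen (A P : set C) x0 : connected A -> A x0 -> P x0 ->
  (forall z, A z -> P z ->
     exists2 e : R, 0 < e & forall w, cabs (w - z) < e -> A w -> P w) ->
  (forall z, A z -> ~ P z ->
     exists2 e : R, 0 < e & forall w, cabs (w - z) < e -> A w -> ~ P w) ->
  A `<=` P.
Proof.
move=> conA Ax0 Px0 oP oNP.
suff <- : A `&` P = A by move=> z [].
have opn (Q : set C) : open [set z | exists2 e : R, 0 < e & exists2 x,
    cabs (z - x) < e & forall w, cabs (w - x) < e -> A w -> Q w].
  rewrite open_cabsP => z [e e0 [x zx H]].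
  exists (e - cabs (z - x)) => [|w wz]; first by rewrite subr_gt0.
  exists e => //; exists x => //.
  by apply: le_lt_trans (cabs_dist z _ _) _; rewrite -ltrBrDr.
apply: conA; first by exists x0.
- exists [set z | exists2 e : R, 0 < e & exists2 x,
    cabs (z - x) < e & forall w, cabs (w - x) < e -> A w -> P w]; first exact: opn.
  rewrite eqEsubset; split => z [Az] => [Pz|].
    split=> //; have [e e0 H] := oP _ Az Pz.
    by exists e => //; exists z => //; rewrite subrr cabs0.
  by case=> e e0 [x zx H]; split=> //; exact: H.
- exists (~` [set z | exists2 e : R, 0 < e & exists2 x,
    cabs (z - x) < e & forall w, cabs (w - x) < e -> A w -> ~ P w]).
    exact: open_closedC.
  rewrite eqEsubset; split => z [Az] => [Pz|].
    by split=> //; case=> e e0 [x zx H]; exact: (H z).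
  move=> nH; split => //; apply: contrapT => nP; apply: nH.
  have [e e0 H] := oNP _ Az nP.
  by exists e => //; exists z => //; rewrite subrr cabs0.
Qed.

Definition convex_set_C (A : set C) := forall x y, A x -> A y ->
  forall t : R, 0 <= t <= 1 -> A (x + t%:C * (y - x)).

Lemma cabs_realM (t : R) z : 0 <= t -> cabs (t%:C * z) = t * cabs z.
Proof. by move=> t0; rewrite cabsM cabs_real. Qed.

Lemma csegment_connected (x y : C) :
  connected [set x + t%:C * (y - x) | t in `[0, 1]%classic].
Proof.
apply: connected_continuous_connected; first exact: segment_connected.
apply: continuous_subspaceT => t A /nbhs_cabsP[e e0 eA].
have k0 : 0 < e / (cabs (y - x) + 1) by rewrite divr_gt0// ltr_wpDl.
apply/nbhs_ballP; exists (e / (cabs (y - x) + 1)) => //= s.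
rewrite -ball_normE /= => ts; apply: eA.
rewrite opprD addrACA subrr add0r -mulrBl -rmorphB cabsM.
have -> : cabs (s - t)%:C = `|t - s|.
  by rewrite /cabs /= expr0n /= addr0 sqrtr_sqr distrC.
move: ts; rewrite ltr_pdivlMr; last by rewrite ltr_wpDl.
by have := normr_ge0 (t - s); have := cabs_ge0 (y - x); nra.
Qed.

Lemma convex_connected (A : set C) : convex_set_C A -> connected A.
Proof.
move=> cA; have [A0|/set0P[x Ax]] := eqVneq A set0; first by rewrite A0; exact: connected0.
have -> : A = \bigcup_(y in A) [set x + t%:C * (y - x) | t in `[0, 1]%classic].
  rewrite eqEsubset; split => [y Ay|z [y Ay [t]]].
    by exists y => //; exists 1; rewrite ?mul1r ?subrKC//= in_itv /= lexx ler01.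
  by rewrite /= in_itv /= => t01 <-; exact: cA.
apply: bigcup_connected; last by move=> y _; exact: csegment_connected.
by exists x => y Ay; exists 0; rewrite ?mul0r ?addr0//= in_itv /= lexx ler01.
Qed.

Lemma convex_disc c (r : R) : convex_set_C [set z | cabs (z - c) < r].
Proof.
move=> x y /= xr yr t /andP[t0 t1].
have -> : x + t%:C * (y - x) - c = (1 - t)%:C * (x - c) + t%:C * (y - c).
  by rewrite rmorphB rmorph1; ring.
apply: le_lt_trans (cabsD _ _) _; rewrite !cabs_realM// ?subr_ge0//.
have [->|tn] := eqVneq t 0; first by rewrite subr0 mul1r mul0r addr0.
have tp : 0 < t by rewrite lt_def tn.
nra.
Qed.

Lemma connected_disc c (r : R) : connected [set z : C | cabs (z - c) < r].
Proof. exact/convex_connected/convex_disc. Qed.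

Lemma component_disc (A : set C) x z (e : R) : connected_component A x z ->
  (forall w, cabs (w - z) < e -> A w) ->
  forall w, cabs (w - z) < e -> connected_component A x w.
Proof.
move=> xz zA w we; apply: connected_component_trans xz _.
apply: (@connected_component_max _ A [set v | cabs (v - z) < e]) => //.
  by rewrite /= subrr cabs0 (le_lt_trans _ we).
exact: connected_disc.
Qed.

(** A small disc around a limit point lies in the open set [A] and joins the point to the
    component. *)
Lemma component_relclosed (A : set C) x z : open A -> A z ->
  (forall e : R, 0 < e -> exists2 y, connected_component A x y & cabs (y - z) < e) ->
  connected_component A x z.
Proof.
rewrite open_cabsP => oA Az H; have [e e0 eA] := oA z Az.
have [y xy yz] := H _ e0; apply: connected_component_trans xy _.
apply: (@connected_component_max _ A [set v | cabs (v - z) < e]) => //=.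
  exact: connected_disc.
by rewrite subrr cabs0.
Qed.

Lemma component_open (A : set C) x : open A -> open (connected_component A x).
Proof.
move=> oA; apply/open_cabsP => z xz.
have Az := connected_component_sub xz.
have [e e0 eA] := (open_cabsP A).1 oA z Az.
by exists e => // w; exact: component_disc xz eA w.
Qed.

End Modulus.
#[export] Hint Extern 0 (is_true (0 <= cabs _)) => exact: cabs_ge0 : core.

(** * Neighbourhoods in the Riemann sphere and in the space of polynomial maps *)

Definition far {R : realType} (M : R) (w : sphere R) : Prop :=
  if w is Some y then M < cabs y else True.

Section SphereTopology.
Context {R : realType}.
Local Notation C := R[i].
Local Notation Chat := (sphere R).
Implicit Types (x y : C) (z w : Chat).

Lemma ball_sphE z (e : R) w : ball z e w = (sph_dist z w < e) :> Prop.
Proof. by []. Qed.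

(** Spherical balls are caps cut off by half-spaces, because [cos] decreases on [0, pi]; estimates
    on balls thus become algebraic. *)
Lemma ball_cosP z (e : R) w : 0 <= e <= pi ->
  ball z e w <-> cos e < dot3 (stereo z) (stereo w).
Proof.
move=> epi; have b := dot3_bound (stereo_unit z) (stereo_unit w).
have cK : cos (acos (dot3 (stereo z) (stereo w))) = dot3 (stereo z) (stereo w).
  by rewrite acosK.
rewrite ball_sphE /sph_dist -[X in _ <-> is_true (_ < X)]cK.
by rewrite ltr_cos// in_itv /= acos_ge0// acos_lepi.
Qed.

(* The square of the chordal distance. *)
Let chq z w : R := 2 - 2 * dot3 (stereo z) (stereo w).

Let chq_finite x y : chq (Some x) (Some y) =
  4 * cabs (x - y) ^+ 2 / ((1 + cabs x ^+ 2) * (1 + cabs y ^+ 2)).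
Proof.
rewrite /chq !cabs_sqr; case: x y => [a b] [c d]; rewrite /dot3 /=.
have pos (u v : R) : u ^+ 2 + v ^+ 2 + 1 != 0.
  by rewrite gt_eqF// ltr_wpDl// addr_ge0// sqr_ge0.
by field; rewrite !(addrC 1) !pos.
Qed.

Let chq_inf y : chq None (Some y) = 4 / (1 + cabs y ^+ 2).
Proof.
rewrite /chq !cabs_sqr; case: y => [c d]; rewrite /dot3 /=.
have pos (u v : R) : u ^+ 2 + v ^+ 2 + 1 != 0.
  by rewrite gt_eqF// ltr_wpDl// addr_ge0// sqr_ge0.
by field; rewrite (addrC 1) !pos.
Qed.

Let chq_sym z w : chq z w = chq w z.
Proof. by rewrite /chq dot3C. Qed.

Let chq_ball (e : R) : 0 < e ->
  exists2 n : R, 0 < n & forall z w, chq z w < n -> ball z e w.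
Proof.
move=> e0; have [epi|epi] := leP e pi; last first.
  exists 1 => // z w _; rewrite ball_sphE (le_lt_trans _ epi)// acos_lepi//.
  exact: dot3_bound (stereo_unit z) (stereo_unit w).
exists (2 - 2 * cos e) => [|z w h].
  have : cos e < 1 by rewrite -(@cos0 R) ltr_cos// in_itv /= ?lexx ?(ltW e0) ?pi_ge0.
  lra.
by apply/ball_cosP; [rewrite ltW//= |move: h; rewrite /chq; lra].
Qed.

Let ball_chq (n : R) : 0 < n ->
  exists2 e : R, 0 < e & forall z w, ball z e w -> chq z w < n.
Proof.
move=> n0; pose c := Num.max (1 - n / 2) (-1).
have c1 : -1 <= c < 1.
  rewrite /c le_max lexx orbT /= gt_max; apply/andP; split; lra.
have c1' : -1 <= c <= 1 by case/andP: c1 => -> /ltW ->.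
exists (acos c) => [|z w]; first exact: acos_gt0.
move/(ball_cosP z w) => /(_ _); rewrite acos_ge0// acos_lepi// => /(_ isT).
rewrite acosK//; rewrite gt_max /chq => /andP[]; lra.
Qed.

(** The radius [d] depends on the bound [M] and on [e] only: on bounded sets the chordal and the
    Euclidean distance are uniformly comparable. *)
Lemma ball_some (M e : R) : 0 < e -> exists2 d : R, 0 < d &
  forall x w, cabs x <= M -> ball (Some x : Chat) d w ->
    exists2 y, w = Some y & cabs (y - x) < e.
Proof.
move=> e0; pose a := 1 + M ^+ 2.
have a0 : 0 < a by rewrite ltr_pwDl// sqr_ge0.
(* [n * a <= 1] rules out infinity and absorbs the term in [cabs (x - y) ^+ 2];
   [n * a ^+ 2 <= e ^+ 2] then gives the bound. *)
pose n := Num.min a^-1 ((e / a) ^+ 2).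
have n0 : 0 < n by rewrite lt_min invr_gt0 a0 exprn_gt0// divr_gt0.
have n1 : n * a <= 1 by rewrite -ler_pdivlMr// mul1r ge_min lexx.
have n2 : n * a ^+ 2 <= e ^+ 2.
  rewrite -ler_pdivlMr ?exprn_gt0//; rewrite -expr_div_n ge_min lexx orbT //.
have [d d0 dn] := ball_chq n0; exists d => // x w xM /dn.
have xa : 1 + cabs x ^+ 2 <= a.
  rewrite lerD2l; apply: lerXn2r => //; rewrite nnegrE//; exact: (le_trans (cabs_ge0 x) xM).
have x0 := sqr_ge0 (cabs x).
case: w => [y|].
  rewrite chq_finite => h; exists y => //.
  have yx : cabs y ^+ 2 <= 2 * cabs x ^+ 2 + 2 * cabs (x - y) ^+ 2.
    have := cabsB y x; rewrite (cabsC y x) => h1.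
    have h2 : cabs y ^+ 2 <= (cabs x + cabs (x - y)) ^+ 2.
      by rewrite ler_sqr ?nnegrE// ?addr_ge0//; lra.
    have := sqr_ge0 (cabs x - cabs (x - y)); nra.
  have y0 := sqr_ge0 (cabs y); have t0 := sqr_ge0 (cabs (x - y)).
  move: h; rewrite ltr_pdivrMr; last by rewrite mulr_gt0// ltr_pwDl.
  move=> h; rewrite -(ltr_pXn2r (n := 2))// ?nnegrE// ?(ltW e0)// cabsC.
  move: h xa yx t0 x0; set t := cabs (x - y) ^+ 2; set X := cabs x ^+ 2.
  set Y := cabs y ^+ 2 in y0 * => h xa yx t0 x0.
  have k1 : (1 + X) * (1 + Y) <= a * (2 * a + 2 * t) by nra.
  have k2 : 4 * t < n * (a * (2 * a + 2 * t)).
    by apply: lt_le_trans h _; rewrite ler_pM2l.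
  have k3 : n * a * (2 * t) <= 2 * t by rewrite ler_piMl// mulr_ge0.
  apply: lt_le_trans n2; nra.
rewrite chq_sym chq_inf => h; exfalso; move: h; apply/negP; rewrite -leNgt.
have p1 : 0 < 1 + cabs x ^+ 2 by rewrite ltr_pwDl.
rewrite ler_pdivlMr//; nra.
Qed.

Lemma some_ball (e : R) : 0 < e -> exists2 d : R, 0 < d &
  forall x y, cabs (y - x) < d -> ball (Some x : Chat) e (Some y).
Proof.
move=> /chq_ball[n n0 nb]; exists (Num.min 1 (n / 4)).
  by rewrite lt_min ltr01 divr_gt0.
move=> x y; rewrite lt_min => /andP[h1 h2]; apply: nb; rewrite chq_finite cabsC.
have t0 := cabs_ge0 (y - x).
have h3 : 4 * cabs (y - x) ^+ 2 < n.
  have : cabs (y - x) ^+ 2 <= cabs (y - x) by rewrite expr2 ler_piMl// ltW.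
  lra.
apply: le_lt_trans h3; rewrite ler_pdivrMr; last first.
  by rewrite mulr_gt0// ltr_pwDl// sqr_ge0.
have := sqr_ge0 (cabs x); have := sqr_ge0 (cabs y).
have := sqr_ge0 (cabs (y - x)); set u := cabs x ^+ 2; set v := cabs y ^+ 2.
set t := cabs (y - x) ^+ 2 => p1 p2 p3.
by rewrite ler_peMr ?mulr_ge0//; nra.
Qed.

Lemma ball_inf (M : R) : exists2 d : R, 0 < d &
  forall w, ball (None : Chat) d w -> far M w.
Proof.
pose n := 4 / (1 + M ^+ 2).
have p : 0 < 1 + M ^+ 2 by rewrite ltr_pwDl// sqr_ge0.
have n0 : 0 < n by rewrite divr_gt0.
have [d d0 dn] := ball_chq n0; exists d => // -[y|]// /dn.
have q : 0 < 1 + cabs y ^+ 2 by rewrite ltr_pwDl// sqr_ge0.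
rewrite chq_inf /n ltr_pM2l// ltf_pV2// ltrD2l /= => h.
rewrite ltNge; apply/negP => h2; move: h; apply/negP; rewrite -leNgt.
by apply: lerXn2r => //; rewrite nnegrE//; exact: (le_trans (cabs_ge0 y) h2).
Qed.

Lemma inf_ball (e : R) : 0 < e -> exists2 M : R, 0 < M &
  forall w, far M w -> ball (None : Chat) e w.
Proof.
move=> /[dup] e0 /chq_ball[n n0 nb]; exists (1 + 4 / n).
  by rewrite addr_gt0// divr_gt0.
move=> [y|] /= h; last exact: ballxx.
apply: nb; rewrite chq_inf.
have k0 : 0 < 4 / n by rewrite divr_gt0.
rewrite ltr_pdivrMr; last by rewrite ltr_pwDl// sqr_ge0.
rewrite mulrC -ltr_pdivrMr//.
have : cabs y <= cabs y ^+ 2 by rewrite expr2 ler_peMl//; lra.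
lra.
Qed.

Lemma far_ball (e : R) : 0 < e -> exists2 M : R, 0 < M &
  forall w w', far M w -> far M w' -> ball w e w'.
Proof.
move=> e0; have [M M0 Mb] := @inf_ball (e / 2) ltac:(by rewrite divr_gt0).
exists M => // w w' /Mb h /Mb h'.
exact: (ball_splitr h h').
Qed.

Lemma nbhs_someP x (A : set Chat) :
  nbhs (Some x : Chat) A <-> exists2 e : R, 0 < e & forall y, cabs (y - x) < e -> A (Some y).
Proof.
split=> [/nbhs_ballP[e /= e0 eA]|[e e0 eA]].
  by have [d d0 H] := some_ball e0; exists d => // y /H; exact: eA.
have [d d0 H] := @ball_some (cabs x) e e0.
apply/nbhs_ballP; exists d => //= w /H [//|y -> /eA]//.
Qed.

Lemma nbhs_infP (A : set Chat) :
  nbhs (None : Chat) A <-> exists2 M : R, 0 < M & forall w, far M w -> A w.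
Proof.
split=> [/nbhs_ballP[e /= e0 eA]|[M M0 MA]].
  by have [M M0 H] := inf_ball e0; exists M => // w /H; exact: eA.
have [d d0 H] := ball_inf M.
by apply/nbhs_ballP; exists d => //= w /H /MA.
Qed.

Lemma some_continuous : continuous (Some : C -> Chat).
Proof. by move=> x A /nbhs_someP[e e0 eA]; apply/nbhs_cabsP; exists e. Qed.

Lemma open_some (A : set C) : open A -> open (Some @` A : set Chat).
Proof.
move=> /open_cabsP oA; rewrite openE => _ [x /oA[e e0 eA] <-].
by apply/nbhs_someP; exists e => // y /eA Ay; exists y.
Qed.

Lemma compact_some (A : set C) : compact A -> compact (Some @` A : set Chat).
Proof.
move=> cA; apply: continuous_compact => //; apply: continuous_subspaceT.
exact: some_continuous.
Qed.

Lemma closed_some_disc b (r : R) : closed (Some @` [set y : C | cabs (y - b) <= r] : set Chat).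
Proof.
rewrite -[X in closed X]setCK; apply: open_closedC; rewrite openE => -[y|] ny; last first.
  apply/nbhs_infP; exists (Num.max 1 (r + cabs b)); first by rewrite lt_max ltr01.
  move=> w + [v /= vr vw]; rewrite -vw /= gt_max => /andP[_].
  by have := cabsB v b; lra.
apply/nbhs_someP; exists (cabs (y - b) - r).
  by rewrite subr_gt0 ltNge; apply/negP => h; apply: ny; exists y.
by move=> z zy [v /= vr [vz]]; rewrite vz in vr; have := cabs_dist z y b; rewrite (cabsC y z); lra.
Qed.

(** An ultrafilter containing some closed disc converges in it; any other one converges to
    infinity. *)
Lemma sphere_compact : compact [set: Chat].
Proof.
rewrite compact_ultra => F FU _.
have [[M FM]|nM] := pselect (exists M : R, F (Some @` [set x : C | cabs (x - 0) <= M])).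
  have := @compact_some _ (@disc_compact R 0 M).
  rewrite compact_ultra => /(_ F FU FM)[p [_ Fp]]; exists p; split => //.
exists None; split => // A /nbhs_infP[M M0 MA].
have [FM|] := in_ultra_setVsetC (Some @` [set x : C | cabs (x - 0) <= M]) FU.
  by exfalso; apply: nM; exists M.
apply: filterS => w nw; apply: MA; case: w nw => [y|]//= nw.
by rewrite ltNge; apply/negP => h; apply: nw; exists y; rewrite //= subr0.
Qed.

Lemma nbhs_polyunifP (p : {poly C}) (A : set {poly C}) :
  nbhs (p : @poly_unif R) A <-> exists2 e : R, 0 < e &
    forall q, (forall z, ball (polymap p z) e (polymap q z)) -> A q.
Proof.
split.
  rewrite nbhsE => -[B [[D oD DB] Bp] BA].
  have : nbhs (polymap p) D by apply: open_nbhs_nbhs; split=> //; rewrite -DB in Bp.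
  move=> /uniform_nbhs[E [entE ED]].
  move: entE; rewrite -entourage_ballE => -[e /= e0 eE].
  exists e => // q H; apply: BA; rewrite -DB; apply: ED => z _.
  by apply: eE; exact: H.
case=> e e0 eA; have := @initial_continuous _ _ (@polymap R) p.
have : nbhs (polymap p) [set h | forall z, [set: Chat] z -> ball (polymap p z) e (h z)].
  apply/uniform_nbhs; exists [set uv | ball uv.1 e uv.2]; split => //.
  exact: (entourage_ball _ (PosNum e0)).
move=> nb /(_ _ nb); apply: (@filterS _ _ (nbhs_filter (p : @poly_unif R))).
by move=> q /= H; apply: eA => z; exact: H.
Qed.

End SphereTopology.

(** * Estimates for polynomials *)

(* [shiftp c p] lists the coefficients of [p] in powers of [X - c]. *)
Definition shiftp {R : realType} (c : R[i]) (p : {poly R[i]}) : {poly R[i]} :=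
  p \Po ('X + c%:P).

Definition roots_of {R : realType} (p : {poly R[i]}) : seq R[i] :=
  sval (closed_field_poly_normal p).

Section Polynomials.
Context {R : realType}.
Local Notation C := R[i].
Implicit Types (p q h : {poly C}) (z w b c : C).

Lemma roots_ofE p : p = lead_coef p *: \prod_(z <- roots_of p) ('X - z%:P).
Proof. exact: svalP (closed_field_poly_normal p). Qed.

Lemma horner_roots p w : p.[w] = lead_coef p * \prod_(z <- roots_of p) (w - z).
Proof.
rewrite [in LHS](roots_ofE p) hornerZ horner_prod; congr (_ * _).
by apply: eq_bigr => z _; rewrite hornerXsubC.
Qed.

Lemma size_roots_of p : p != 0 -> size (roots_of p) = (size p).-1.
Proof.
by move=> p0; rewrite [in RHS](roots_ofE p) size_scale ?lead_coef_eq0// size_prod_XsubC.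
Qed.

Lemma mem_roots_of p z : p != 0 -> (z \in roots_of p) = root p z.
Proof.
by move=> p0; rewrite [in RHS](roots_ofE p) rootZ ?lead_coef_eq0// root_prod_XsubC.
Qed.

Lemma horner_shift c p u : (shiftp c p).[u] = p.[u + c].
Proof. by rewrite horner_comp hornerD hornerX hornerC. Qed.

Lemma size_shift c p : size (shiftp c p) = size p.
Proof. by rewrite /shiftp size_comp_poly2// size_XaddC. Qed.

Lemma shiftpB c p q : shiftp c (p - q) = shiftp c p - shiftp c q.
Proof. by rewrite /shiftp raddfB. Qed.

Lemma horner_shiftE c p z : p.[z] = (shiftp c p).[z - c].
Proof. by rewrite horner_shift subrK. Qed.

Lemma primitive_root_exists n : (0 < n)%N -> exists w : C, n.-primitive_root w.
Proof.
move=> n0; pose P : {poly C} := 'X^n - 1.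
have sP : size P = n.+1 by rewrite size_XnsubC.
have P0 : P != 0 by rewrite -size_poly_eq0 sP.
have lP : lead_coef P = 1 by rewrite lead_coefXnsubC.
have EP := roots_ofE P; rewrite lP scale1r in EP.
have : has n.-primitive_root (roots_of P).
  apply: cyclic.has_prim_root => //; last by rewrite size_roots_of// sP.
  - by apply/allP => z; rewrite mem_roots_of// unity_rootE /root !hornerE hornerXn.
  - rewrite -separable.separable_prod_XsubC -EP.
    by apply: cyclotomic.separable_Xn_sub_1; rewrite pnatr_eq0 -lt0n.
by case/hasP => w _ ?; exists w.
Qed.

(* Cauchy's estimate, by averaging over the [N]-th roots of unity, [N > deg p]. *)
Lemma cauchy_coef p (r M : R) k : 0 <= r ->
  (forall z, cabs z = r -> cabs p.[z] <= M) -> cabs p`_k * r ^+ k <= M.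
Proof.
(* Adding [k] makes [N] exceed [k] as well, so that no other exponent below [N] is congruent to [k]
   modulo [N]. *)
move=> r0 pM; pose N := (size p + k).+1.
have [w pw] := @primitive_root_exists N isT.
have wN : w ^+ N = 1 := prim_expr_order pw.
have aw : cabs w = 1.
  apply/eqP; rewrite -(@pexpr_eq1 _ _ N)//; apply/eqP.
  by rewrite -cabsX wN cabs1.
have S : \sum_(j < N) (w ^+ j) ^+ (N - k) * p.[r%:C * w ^+ j] = (N%:R * r%:C ^+ k) * p`_k.
  under eq_bigr => j _ do rewrite (@horner_coef_wide _ N) ?mulr_sumr ?leqW ?leq_addr//.
  rewrite exchange_big /=.
  have kN : (k < N)%N by rewrite ltnS leq_addl.
  rewrite (bigD1 (Ordinal kN)) //= [X in _ + X]big1 ?addr0 => [|i ik].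
    under eq_bigr => j _.
      rewrite exprMn (mulrCA _ p`_k) (mulrCA _ (r%:C ^+ k)) -exprD subnK ?(ltnW kN)//.
      rewrite -exprM mulnC exprM wN expr1n mulr1 (mulrC p`_k).
    over.
    by rewrite sumr_const card_ord -[LHS]mulr_natl mulrA.
  (* For [i != k] the sum is geometric with ratio [v], an [N]-th root of unity other than 1, and
     vanishes. *)
  pose v := w ^+ (N - k + i).
  under eq_bigr => j _.
    rewrite exprMn (mulrCA _ p`_i) (mulrCA _ (r%:C ^+ i)) -exprD -exprM mulnC exprM -/v mulrA.
  over.
  rewrite -mulr_sumr; suff -> : \sum_(j < N) v ^+ j = 0 by rewrite mulr0.
  have v1 : v != 1.
    rewrite /v -(prim_order_dvd pw); apply/negP => dv.
    have := ltn_ord i; rewrite leq_eqVlt => iN.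
    have : (i == k :> nat) = false by apply/negbTE; move: ik; rewrite -val_eqE.
    move/negP; apply; have kN' := ltnW kN.
    have : i = k %[mod N].
      apply/eqP; rewrite -(eqn_modDl (N - k)) subnK// modnn.
      by move: dv; rewrite /dvdn => /eqP ->.
    by rewrite !modn_small// => ->.
  have v1' : v - 1 != 0 by rewrite subr_eq0.
  apply: (mulfI v1'); rewrite mulr0 -subrX1 /v -exprM mulnC exprM wN expr1n.
  by rewrite subrr.
have : cabs (N%:R * r%:C ^+ k * p`_k) <= N%:R * M.
  rewrite -S; apply: le_trans (cabs_sum _ _ _) _.
  rewrite -[leRHS](_ : \sum_(j < N) M = _); last first.
    by rewrite sumr_const card_ord mulr_natl.
  apply: ler_sum => j _; rewrite cabsM !cabsX aw !expr1n mul1r; apply: pM.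
  by rewrite cabsM cabsX aw expr1n mulr1 cabs_real.
rewrite !cabsM cabsX cabs_nat cabs_real// -mulrA ler_pM2l ?ltr0n//.
by rewrite mulrC.
Qed.

Lemma horner_upper q n (B t : R) u : (size q <= n.+1)%N ->
  (forall i, cabs q`_i <= B) -> 1 <= t -> cabs u <= t ->
  cabs q.[u] <= n.+1%:R * B * t ^+ n.
Proof.
move=> sq qB t1 ut; rewrite (@horner_coef_wide _ n.+1)//.
apply: le_trans (cabs_sum _ _ _) _.
rewrite -[leRHS](_ : \sum_(j < n.+1) (B * t ^+ n) = _); last first.
  by rewrite sumr_const card_ord -[LHS]mulr_natl mulrA.
apply: ler_sum => i _; rewrite cabsM cabsX ler_pM ?exprn_ge0//.
apply: (@le_trans _ _ (t ^+ i)); first by apply: lerXn2r; rewrite ?nnegrE// (le_trans _ t1).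
by rewrite ler_weXn2l// -ltnS.
Qed.

(** The terms of degree below [n] add up to at most n B |u|^(n-1), hence to at most half of A
    |u|^n. *)
Lemma horner_lower q n (A B : R) u : (size q <= n.+1)%N -> 0 <= A -> 0 <= B ->
  (forall i, (i < n)%N -> cabs q`_i <= B) -> A <= cabs q`_n ->
  1 <= cabs u -> 2 * n%:R * B <= A * cabs u ->
  A / 2 * cabs u ^+ n <= cabs q.[u].
Proof.
move=> sq A0 B0 qB qA u1 uB; rewrite (@horner_coef_wide _ n.+1)// big_ord_recr /= addrC.
apply: le_trans (cabsDl _ _); rewrite cabsM cabsX.
have h : cabs (\sum_(i < n) q`_i * u ^+ i) <= A / 2 * cabs u ^+ n.
  case: n sq qB qA uB => [|n] sq qB qA uB.
    by rewrite big_ord0 cabs0 expr0 mulr1 divr_ge0.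
  apply: le_trans (cabs_sum _ _ _) _.
  apply: (@le_trans _ _ (\sum_(i < n.+1) (B * cabs u ^+ n))).
    apply: ler_sum => i _; rewrite cabsM cabsX ler_pM ?exprn_ge0 ?qB//.
    by rewrite ler_weXn2l// -ltnS.
  rewrite sumr_const card_ord -[leLHS]mulr_natl mulrA exprS mulrA.
  apply: ler_pM; rewrite ?mulr_ge0 ?exprn_ge0//; lra.
have p : 0 <= cabs u ^+ n by rewrite exprn_ge0.
nra.
Qed.

(** By Cauchy's estimate the k-th Taylor term is at most M t^k with t = |z - c| / r. As t <= 1/2,
    the terms with k >= 1 sum to at most 2 M t. *)
Lemma schwarz p c (r M : R) z : 0 < r ->
  (forall w, cabs (w - c) <= r -> cabs p.[w] <= M) ->
  cabs (z - c) <= r / 2 -> cabs (p.[z] - p.[c]) <= 2 * M * cabs (z - c) / r.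
Proof.
move=> r0 pM zc; set u := z - c in zc *; pose q := shiftp c p.
have qM k : cabs q`_k * r ^+ k <= M.
  apply: cauchy_coef; first exact: ltW.
  by move=> w wr; rewrite horner_shift pM// addrK wr.
have M0 : 0 <= M by apply: (le_trans _ (qM 0%N)); rewrite expr0 mulr1.
have -> : p.[z] - p.[c] = \sum_(i < size q) q`_i.+1 * u ^+ i.+1.
  rewrite (horner_shiftE c p z) (horner_shiftE c p c) subrr -/u -/q.
  rewrite !(@horner_coef_wide _ (size q).+1)// !big_ord_recl /= !expr0 !mulr1.
  rewrite [X in _ + _ - (_ + X)]big1 ?addr0; last by move=> i _; rewrite exprS mul0r mulr0.
  by rewrite addrC addKr; apply: eq_bigr => i _; rewrite /bump /= add1n.
pose t := cabs u / r.
have t0 : 0 <= t by rewrite divr_ge0// ltW.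
have t2 : t <= 1 / 2 by rewrite ler_pdivrMr//; lra.
apply: (@le_trans _ _ (\sum_(i < size q) M * t * (2^-1) ^+ i)).
  apply: le_trans (cabs_sum _ _ _) _; apply: ler_sum => i _.
  rewrite cabsM cabsX; have -> : cabs u = t * r by rewrite divfK// gt_eqF.
  rewrite exprMn mulrCA (mulrC M) mulrAC exprS.
  apply: ler_pM (qM i.+1).
  - by rewrite -exprS exprn_ge0.
  - by rewrite mulr_ge0 ?exprn_ge0// ltW.
  - by apply: ler_wpM2l => //; apply: lerXn2r; rewrite ?nnegrE//; lra.
rewrite -mulr_sumr.
have : \sum_(i < size q) (2^-1 : R) ^+ i <= 2.
  have := subrX1 (2^-1 : R) (size q).
  have : 0 <= (2^-1 : R) ^+ size q by rewrite exprn_ge0// invr_ge0.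
  move: (\sum_(i < size q) _) (2^-1 ^+ size q) => S E E0 SE; lra.
have Mt : 0 <= M * t by rewrite mulr_ge0.
have -> : 2 * M * cabs u / r = M * t * 2 by rewrite /t; ring.
by move=> h; rewrite ler_wpM2l.
Qed.

Lemma prod_ler_mul (I : eqType) (s : seq I) (F G : I -> R) (k : R) : 0 <= k ->
  (forall i, i \in s -> 0 <= G i /\ k * G i <= F i) ->
  k ^+ size s * \prod_(i <- s) G i <= \prod_(i <- s) F i.
Proof.
move=> k0; elim: s => [|i s IH] H; first by rewrite !big_nil expr0 mul1r.
have [G0 GF] := H i (mem_head _ _).
have {}IH := IH (fun j js => H j (mem_behead (s := i :: s) js)).
rewrite !big_cons /= exprS mulrACA; apply: ler_pM => //.
  by rewrite mulr_ge0.
rewrite mulr_ge0 ?exprn_ge0//; rewrite big_seq; apply: prodr_ge0 => j js.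
by case: (H j (mem_behead (s := i :: s) js)).
Qed.

Lemma coef_bound p : exists2 B : R, 0 <= B & forall i, cabs p`_i <= B.
Proof.
exists (\sum_(i < size p) cabs p`_i) => [|i]; first exact: sumr_ge0.
have [ip|ip] := ltnP i (size p); last by rewrite nth_default// cabs0 sumr_ge0.
by rewrite (bigD1 (Ordinal ip))//= lerDl sumr_ge0.
Qed.

Lemma growth_single h b (M : R) : (2 <= size h)%N ->
  exists2 r : R, 1 <= r & forall z, r <= cabs (z - b) -> M <= cabs h.[z].
Proof.
move=> sh; pose q := shiftp b h; have sq : size q = size h := size_shift b h.
have [B B0 qB] := coef_bound q.
pose n := (size h).-1; have sn : size q = n.+1 by rewrite sq prednK// ltnW.
have n0 : (0 < n)%N by rewrite -ltnS -sn sq.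
pose A := cabs q`_n.
have A0 : 0 < A.
  by rewrite cabs_gt0 -[n]/(n.+1.-1) -sn -lead_coefE lead_coef_eq0 -size_poly_eq0 sn.
pose r := 1 + 2 * n%:R * B / A + 2 * `|M| / A.
have r1 : 0 <= 2 * n%:R * B / A by rewrite divr_ge0 ?mulr_ge0// ltW.
have r2 : 0 <= 2 * `|M| / A by rewrite divr_ge0 ?mulr_ge0// ltW.
exists r => [|z rz]; first by rewrite /r; lra.
rewrite (horner_shiftE b) -/q; set u := z - b in rz *.
have u1 : 1 <= cabs u by move: rz; rewrite /r; lra.
have : A / 2 * cabs u ^+ n <= cabs q.[u].
  apply: (horner_lower (B := B)); rewrite ?sn ?(ltW A0)//.
  by rewrite -ler_pdivrMl//; move: rz; rewrite /r; lra.
apply: le_trans; have h1 : 2 * `|M| <= A * cabs u.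
  by rewrite -ler_pdivrMl//; move: rz; rewrite /r; lra.
have h2 : cabs u <= cabs u ^+ n by rewrite -[leLHS]expr1 ler_weXn2l.
have h3 := ler_norm M.
have : A * cabs u <= A * cabs u ^+ n by rewrite ler_wpM2l// ltW.
lra.
Qed.

(* Near [h] the zeros stay in a fixed disc, and comparing the values at a nearby
   and at a far point bounds the degree. *)
Lemma polymap_near h b (e : R) : (2 <= size h)%N -> 0 < e ->
  exists2 d : R, 0 < d & forall p,
    (forall z : sphere R, ball (polymap h z) d (polymap p z)) ->
    size p = size h /\ forall i, cabs ((shiftp b p)`_i - (shiftp b h)`_i) <= e.
Proof.
move=> sh e0; pose q := shiftp b h; have sq : size q = size h := size_shift b h.
pose n := (size h).-1; have sn : size q = n.+1 by rewrite sq prednK// ltnW.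
have n0 : (0 < n)%N by rewrite -ltnS -sn sq.
have [B B0 qB] := coef_bound q.
have A0 : 0 < cabs q`_n.
  by rewrite cabs_gt0 -[n]/(n.+1.-1) -sn -lead_coefE lead_coef_eq0 -size_poly_eq0 sn.
have [r r1 hr] := @growth_single h b 2 sh.
pose D := n.+1%:R * B; have D0 : 0 <= D by rewrite mulr_ge0.
(* So large that [k ^+ n.+1 <= D * t ^+ n + 1], with [k = t / (4 * r)], is impossible; this
   inequality would follow from more than [n] roots. *)
pose t := 1 + 4 * r + (D + 1) * (4 * r) ^+ n.+1.
have r4 : 0 < (4 * r) ^+ n.+1 by rewrite exprn_gt0//; lra.
have t4 : 4 * r <= t by rewrite /t; nra.
have t1 : 1 <= t by lra.
have hD u : cabs u <= t -> cabs h.[u + b] <= D * t ^+ n.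
  by by move=> ut; rewrite -horner_shift; apply: horner_upper; rewrite // ?sn.
pose e' := Num.min e (Num.min 1 (cabs q`_n / 2)).
have e'0 : 0 < e' by rewrite !lt_min e0 ltr01 divr_gt0.
have e'e : e' <= e by rewrite ge_min lexx.
have e'1 : e' <= 1 by rewrite !ge_min lexx orbT.
have e'A : e' < cabs q`_n.
  by rewrite !gt_min (_ : cabs q`_n / 2 < cabs q`_n) ?orbT//; lra.
have [d1 d10 H1] := @ball_some R (D * t ^+ n) e' e'0.
have [d2 d20 H2] := @ball_some R 0 1 ltr01.
exists (Num.min d1 d2) => [|p pB]; first by rewrite lt_min d10.
have close z : cabs (z - b) <= t -> cabs (p.[z] - h.[z]) < e'.
  move=> zt; have : cabs h.[z] <= D * t ^+ n by rewrite -(subrK b z) hD.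
  move=> hz; have bz : ball (Some h.[z] : sphere R) d1 (Some p.[z]).
    by apply: (@le_ball _ _ _ (Num.min d1 d2)) (pB (Some z)); rewrite ge_min lexx.
  by have [y [->]] := H1 _ _ hz bz.
have rootp z : r <= cabs (z - b) -> ~~ root p z.
  move=> /hr h2; apply/negP => /eqP pz.
  have : ball (Some 0 : sphere R) d2 (Some h.[z]).
    apply: ball_sym; rewrite -pz.
    by apply: (@le_ball _ _ _ (Num.min d1 d2)) (pB (Some z)); rewrite ge_min lexx orbT.
  by move=> /H2; rewrite cabs0 lexx => /(_ isT) [y [<-]]; rewrite subr0; lra.
have cf i : cabs ((shiftp b p)`_i - q`_i) <= e'.
  rewrite -coefB /q -shiftpB.
  have : cabs (shiftp b (p - h))`_i * t ^+ i <= e'.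
    apply: cauchy_coef => [|z zt]; first by lra.
    rewrite horner_shift !hornerE ltW// close// addrK zt//.
  by apply: le_trans; rewrite ler_peMr// exprn_ege1.
split=> [|i]; last exact: le_trans (cf i) e'e.
have pn : (shiftp b p)`_n != 0.
  rewrite -cabs_gt0; have := cabsB q`_n (shiftp b p)`_n; have := cf n.
  by rewrite (cabsC (_ p)`_n); lra.
have np : (n < size p)%N.
  rewrite -(size_shift b) ltnNge; apply/negP => le; case/eqP: pn.
  by rewrite nth_default.
have p0 : p != 0 by rewrite -size_poly_eq0 -lt0n (leq_ltn_trans _ np).
pose m := size (roots_of p); have mE : m = (size p).-1 by rewrite /m size_roots_of.
suff mn : (m <= n)%N.
  rewrite -sq sn; apply/eqP; rewrite eqn_leq np andbT.
  by move: mn; rewrite mE -ltnS prednK// (leq_ltn_trans _ np).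
rewrite leqNgt; apply/negP => nm.
have rr : cabs ((r%:C + b) - b) = r by rewrite addrK cabs_real; lra.
have tt : cabs ((t%:C + b) - b) = t by rewrite addrK cabs_real; lra.
have pr : 1 <= cabs p.[r%:C + b].
  have := hr (r%:C + b); rewrite rr lexx => /(_ isT).
  have := close (r%:C + b); rewrite rr => /(_ ltac:(lra)).
  have := cabsB h.[r%:C + b] p.[r%:C + b]; rewrite cabsC; lra.
have pt : cabs p.[t%:C + b] <= D * t ^+ n + 1.
  have := close (t%:C + b); rewrite tt lexx => /(_ isT).
  have := hD t%:C; rewrite cabs_real ?lexx => [/(_ isT)|]; last by lra.
  have := cabsB p.[t%:C + b] h.[t%:C + b]; lra.
pose k := t / (4 * r); have k1 : 1 <= k by rewrite ler_pdivlMr; lra.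
have : k ^+ m <= cabs p.[t%:C + b].
  apply: (@le_trans _ _ (k ^+ m * cabs p.[r%:C + b])).
    by rewrite ler_peMr// exprn_ge0//; lra.
  rewrite !horner_roots !cabsM mulrCA ler_wpM2l// !cabs_prod.
  apply: prod_ler_mul => [|z zp]; first by lra.
  split => //; have zr : cabs (z - b) < r.
    by rewrite ltNge; apply/negP => /rootp; rewrite -mem_roots_of// zp.
  have a1 : cabs (r%:C + b - z) <= 2 * r.
    have := cabs_dist b (r%:C + b) z; rewrite rr (cabsC b); lra.
  have a2 : t / 2 <= cabs (t%:C + b - z).
    have := cabs_dist z (t%:C + b) b; rewrite tt; lra.
  apply: (le_trans _ a2); apply: (@le_trans _ _ (k * (2 * r))).
    by rewrite ler_wpM2l//; lra.
  by rewrite /k; have -> : t / (4 * r) * (2 * r) = t / 2 by field; lra.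
move=> /le_trans /(_ pt) h1.
have h2 : k ^+ n.+1 <= D * t ^+ n + 1 by apply: le_trans h1; rewrite ler_weXn2l.
have h3 : 1 <= t ^+ n by rewrite exprn_ege1.
have h4 : t ^+ n.+1 <= (D + 1) * (4 * r) ^+ n.+1 * t ^+ n.
  have : t ^+ n.+1 <= (D * t ^+ n + 1) * (4 * r) ^+ n.+1.
    by rewrite -ler_pdivrMr// -expr_div_n.
  move/le_trans; apply; rewrite [leRHS]mulrAC; apply: ler_wpM2r; first exact: ltW.
  by rewrite mulrDl mul1r lerD2l.
move: h4; rewrite exprS ler_pM2r; last exact: lt_le_trans ltr01 h3.
by apply/negP; rewrite -ltNge /t ltrDr addr_gt0// mulr_gt0// (lt_le_trans ltr01 r1).
Qed.

End Polynomials.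

(** * Uniform estimates on compact families, and compact boxes of coefficients *)

Section CompactFamilies.
Context {R : realType}.
Local Notation C := R[i].
Local Notation Chat := (sphere R).
Implicit Types (p q h : {poly C}) (b c : C) (Gam : set {poly C}).

(** Near each [h] the property holds for all large [M], and finitely many such neighbourhoods cover
    [Gam], so one threshold serves everywhere. *)
Lemma poly_compact_uniform Gam (P : R -> {poly C} -> Prop) : poly_compact Gam ->
  (forall h, Gam h -> exists2 d : R, 0 < d & exists M0 : R, forall p M,
     (forall z, ball (polymap h z) d (polymap p z)) -> M0 <= M -> P M p) ->
  exists M, 0 < M /\ forall h, Gam h -> P M h.
Proof.
move=> /compact_near_coveringP cG H.
have nP : \forall M \near +oo%R, Gam `<=` P M.
  apply: cG => h /H[d d0 [M0 HP]].
  exists ([set p | forall z, ball (polymap h z) d (polymap p z)], [set M | M0 <= M]) => /=.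
    split; first by apply/nbhs_polyunifP; exists d.
    exact: nbhs_pinfty_ge (num_real _).
  by case=> p M [/= pz MM]; exact: HP.
near (pinfty_nbhs R) => M; exists M; split.
  by near: M; exact: nbhs_pinfty_gt.
exact: (near nP M).
Unshelve. all: by end_near. Qed.

Lemma shiftpC b p c i : (shiftp b (p - c%:P))`_i = (shiftp b p)`_i - c *+ (i == 0%N).
Proof. by rewrite shiftpB coefB /shiftp comp_polyC coefC; case: i. Qed.

Lemma lead_shift_gt0 b h : (2 <= size h)%N -> 0 < cabs (shiftp b h)`_(size h).-1.
Proof.
move=> sh; rewrite cabs_gt0 -(size_shift b h) -lead_coefE lead_coef_eq0.
by rewrite -size_poly_eq0 size_shift -lt0n ltnW.
Qed.

(** [M] is at once the radius and the inverse of the constant, which leaves a single parameter for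
    [poly_compact_uniform]. Degrees above [n] are covered because |z - b| >= 1. *)
Lemma compact_growth Gam b n : poly_compact Gam -> (0 < n)%N ->
  (forall h, Gam h -> (n < size h)%N) ->
  exists M : R, 1 <= M /\ forall h, Gam h -> forall z, M <= cabs (z - b) ->
    M^-1 * cabs (z - b) ^+ n <= cabs (h.[z] - b).
Proof.
move=> cG n0 nG.
have [|M [M0 HM]] := @poly_compact_uniform Gam (fun M p => 1 <= M /\
   forall z, M <= cabs (z - b) -> M^-1 * cabs (z - b) ^+ n <= cabs (p.[z] - b)) cG; last first.
  exists (Num.max 1 M); split; first by rewrite le_max lexx.
  by move=> h /HM[M1 Mz]; rewrite (max_idPr M1).
move=> h /nG hn; have sh : (2 <= size h)%N by apply: leq_trans hn.
pose A := cabs (shiftp b h)`_(size h).-1; have A0 : 0 < A := lead_shift_gt0 b sh.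
have A20 : 0 < A / 2 by rewrite divr_gt0.
have [B B0 qB] := coef_bound (shiftp b h).
have [d d0 Hd] := polymap_near b sh A20.
pose B' := B + A / 2 + cabs b.
have B'0 : 0 <= B' by rewrite /B' !addr_ge0// ltW.
pose m := (size h).-1.
exists d => //; exists (1 + 4 / A + 4 * m%:R * B' / A) => p M /Hd[sp cp] MM.
have t1 : 0 <= 4 / A by rewrite divr_ge0// ltW.
have t2 : 0 <= 4 * m%:R * B' / A by rewrite divr_ge0 ?mulr_ge0// ltW.
have M1 : 1 <= M by lra.
split=> // z Mz; pose u := z - b; rewrite -/u in Mz *.
have u1 : 1 <= cabs u by lra.
have low : A / 2 / 2 * cabs u ^+ m <= cabs (shiftp b (p - b%:P)).[u].
  apply: (horner_lower (B := B')) => //.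
  - rewrite size_shift (leq_trans (size_polyD _ _))// geq_max sp prednK ?(ltnW sh)//.
    by rewrite leqnn size_polyN (leq_trans (size_polyC_leq1 _))// ltnW.
  - exact: ltW.
  - move=> i _; rewrite shiftpC.
    have h1 : cabs (b *+ (i == 0%N)) <= cabs b by case: (i == 0%N); rewrite ?mulr1n// mulr0n cabs0.
    have h2 := cabsD (shiftp b p)`_i (- (b *+ (i == 0%N))); rewrite cabsN in h2.
    have h3 := cabsB (shiftp b p)`_i (shiftp b h)`_i.
    have h4 := qB i; have h5 := cp i.
    apply: le_trans h2 _; rewrite /B'; apply: lerD h1.
    clear - h3 h4 h5; lra.
  - rewrite shiftpC gtn_eqF ?mulr0n ?subr0; last by rewrite /m; case: (size h) sh => [|[]].
    have h1 := cp m; have h2 := cabsB (shiftp b h)`_m (shiftp b p)`_m.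
    rewrite cabsC in h2; rewrite -/m -/A in A0 *.
    have -> : A = cabs (shiftp b h)`_m by [].
    move: h1 h2; rewrite /A -/m; clear; lra.
  - have : 4 * m%:R * B' <= A * cabs u by rewrite -ler_pdivrMl//; lra.
    lra.
have -> : p.[z] - b = (shiftp b (p - b%:P)).[u].
  by rewrite /u horner_shift subrK !hornerE.
apply: le_trans low; apply: ler_pM; rewrite ?invr_ge0 ?exprn_ge0//; first by lra.
  have a4 : 4 / A <= M by lra.
  rewrite -(ler_pM2l (lt_le_trans ltr01 M1)) divff; last by rewrite gt_eqF// (lt_le_trans ltr01).
  by move: a4; rewrite ler_pdivrMr//; clear; lra.
by rewrite ler_weXn2l// /m -ltnS prednK// ltnW.
Qed.

Lemma compact_bounded_on_disc Gam b (t : R) : poly_compact Gam ->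
  (forall h, Gam h -> (2 <= size h)%N) ->
  exists M : R, 0 < M /\ forall h, Gam h -> forall z, cabs (z - b) <= t -> cabs h.[z] <= M.
Proof.
move=> cG G2; apply: (@poly_compact_uniform _ (fun M p =>
  forall z, cabs (z - b) <= t -> cabs p.[z] <= M)) => // h /G2 sh.
have [B B0 qB] := coef_bound (shiftp b h).
have [d d0 Hd] := polymap_near b sh (@ltr01 R).
exists d => //; pose t' := Num.max 1 t; pose m := (size h).-1.
exists (m.+1%:R * (B + 1) * t' ^+ m) => p M /Hd[sp cp] MM z zt.
apply: (le_trans _ MM); rewrite (horner_shiftE b); apply: horner_upper.
- by rewrite size_shift sp prednK// ltnW.
- move=> i; have h1 := qB i; have h2 := cp i.
  have h3 := cabsB (shiftp b p)`_i (shiftp b h)`_i; clear - h1 h2 h3; lra.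
- by rewrite le_max lexx.
- by rewrite le_max zt orbT.
Qed.

(** Converse of [polymap_near]. Beyond the radius [T] both maps are close to infinity; within it the
    differences of coefficients bound the difference of values. *)
Lemma polymap_coef_continuous b q (e : R) : (2 <= size q)%N -> 0 < e ->
  exists2 d : R, 0 < d & forall p, (size p <= size q)%N ->
    (forall i, cabs ((shiftp b p)`_i - (shiftp b q)`_i) <= d) ->
    forall z, ball (polymap q z) e (polymap p z).
Proof.
move=> sq e0; pose m := (size q).-1; pose A := cabs (shiftp b q)`_m.
have A0 : 0 < A := lead_shift_gt0 b sq.
have [B B0 qB] := coef_bound (shiftp b q).
have [M M0 HM] := far_ball e0; have [d1 d10 Hd] := some_ball e0.
have m0 : (0 < m)%N by rewrite /m; case: (size q) sq => [|[]].
have sm : size q = m.+1 by rewrite /m prednK// ltnW.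
pose T := 1 + 4 * m%:R * (B + A) / A + 8 * M / A.
have t1 : 0 <= 4 * m%:R * (B + A) / A.
  apply: divr_ge0; last exact: ltW.
  by rewrite mulr_ge0 ?mulr_ge0// addr_ge0// ltW.
have t2 : 0 <= 8 * M / A by rewrite divr_ge0 ?mulr_ge0// ltW.
have T1 : 1 <= T by rewrite /T; clear - t1 t2; lra.
have Tm : 0 < T ^+ m by rewrite exprn_gt0// (lt_le_trans ltr01).
pose d := Num.min (A / 2) (d1 / (2 * (m.+1%:R * T ^+ m))).
have d0 : 0 < d.
  by rewrite lt_min divr_gt0//= divr_gt0//; do 2 apply: mulr_gt0 => //.
have large p' u : (size p' <= m.+1)%N ->
    (forall i, cabs ((shiftp b p')`_i - (shiftp b q)`_i) <= A / 2) ->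
    T < cabs u -> M < cabs (shiftp b p').[u].
  move=> sp' cp' Tu.
  have u1 : 1 <= cabs u by rewrite ltW// (le_lt_trans T1).
  have low : A / 2 / 2 * cabs u ^+ m <= cabs (shiftp b p').[u].
    apply: (horner_lower (B := B + A)); rewrite ?size_shift ?addr_ge0 ?divr_ge0 ?(ltW A0)//.
    - move=> i _; have h1 := qB i; have h2 := cp' i.
      by have h3 := cabsB (shiftp b p')`_i (shiftp b q)`_i; clear - h1 h2 h3 A0; lra.
    - have h1 := cp' m; have := cabsB (shiftp b q)`_m (shiftp b p')`_m; rewrite cabsC -/A => h2.
      by clear - h1 h2; lra.
    - have : 4 * m%:R * (B + A) <= A * cabs u.
        by rewrite -ler_pdivrMl//; move: Tu t2; rewrite /T; clear; lra.
      by clear; lra.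
  apply: lt_le_trans low.
  have h1 : 8 * M < A * cabs u.
    by rewrite -ltr_pdivrMl//; move: Tu t1; rewrite /T; clear; lra.
  have h2 : A * cabs u <= A * cabs u ^+ m.
    by rewrite ler_wpM2l ?(ltW A0)// -[leLHS]expr1 ler_weXn2l.
  by move: (cabs u ^+ m) h2 => U h2; clear - h1 h2 M0; lra.
exists d => // p sp cp z.
have cA i : cabs ((shiftp b p)`_i - (shiftp b q)`_i) <= A / 2.
  by apply: le_trans (cp i) _; rewrite ge_min lexx.
have pn : (shiftp b p)`_m != 0.
  rewrite -cabs_gt0; have h1 := cA m; have := cabsB (shiftp b q)`_m (shiftp b p)`_m.
  by rewrite cabsC -/A; clear - h1 A0; lra.
have sp2 : (1 < size p)%N.
  apply: leq_ltn_trans m0 _; rewrite ltnNge -(size_shift b); apply: contra pn => le.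
  by rewrite nth_default.
case: z => [z|]; last first.
  rewrite /= /pdeg; case: (size q) sq => [|[|?]]//; case: (size p) sp2 => [|[|?]]//= _ _.
  exact: ballxx.
have [Tz|zT] := ltP T (cabs (z - b)).
  apply: HM; rewrite /= (horner_shiftE b).
    by apply: large; rewrite ?sm// => i; rewrite subrr cabs0 divr_ge0// ltW.
  by apply: large => //; rewrite -sm.
apply: Hd; rewrite -hornerN -hornerD (horner_shiftE b).
have : cabs (shiftp b (p - q)).[z - b] <= m.+1%:R * d * T ^+ m.
  apply: horner_upper => // [|i]; last by rewrite shiftpB coefB.
  by rewrite size_shift (leq_trans (size_polyD _ _))// size_polyN geq_max -sm sp leqnn.
have k0 : 0 < m.+1%:R * T ^+ m by rewrite mulr_gt0// ltr0n.
move/le_lt_trans; apply; rewrite mulrAC -ltr_pdivlMl//.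
rewrite gt_min; apply/orP; right; rewrite [ltRHS]mulrC.
rewrite ltr_pM2l// ltf_pV2 ?posrE ?mulr_gt0//.
by rewrite ltr_pMl// ltr1n.
Qed.

(** [q] lists coefficients in powers of [X - b]: it is already shifted, whereas [p] is not. *)
Definition coef_box b n (q : {poly C}) (e : R) : set {poly C} :=
  [set p : {poly C} | (size p <= n.+1)%N /\
     forall i, (i <= n)%N -> cabs ((shiftp b p)`_i - q`_i) <= e].

(** The box is the image of a product of closed discs. The map from coefficients to polynomials is
    continuous where the coefficient of index [n] does not vanish, that is, where the degree stays
    [n]; the bound on [e] ensures this. *)
Lemma coef_box_compact b n q (e : R) : (0 < n)%N -> e < cabs q`_n ->
  poly_compact (coef_box b n q e).
Proof.
move=> n0 en.
pose row (v : 'rV[C]_n.+1) : {poly C} := \poly_(i < n.+1) v ord0 (inord i).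
pose Phi v : {poly C} := row v \Po ('X - b%:P).
have sPhi v : shiftp b (Phi v) = row v.
  rewrite /shiftp /Phi -comp_polyA comp_polyB comp_polyX comp_polyC.
  by rewrite addrK comp_polyXr.
pose K := [set v : 'rV[C]_n.+1 |
  forall i : 'I_n.+1, [set z : C | cabs (z - q`_i) <= e] (v ord0 i)].
have cK : compact K.
  apply: (@rV_compact C n.+1 (fun i : 'I_n.+1 => [set z : C | cabs (z - q`_i) <= e])) => i.
  exact: disc_compact.
have -> : coef_box b n q e = Phi @` K.
  rewrite eqEsubset; split => [p [sp cp]|_ [v Kv <-]].
    exists (\row_i (shiftp b p)`_i).
      by move=> i /=; rewrite mxE; apply: cp; rewrite -ltnS.
    have rE : row (\row_i (shiftp b p)`_i) = shiftp b p.
      apply/polyP => i; rewrite coef_poly; case: ltnP => ni.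
        by rewrite mxE inordK.
      by rewrite nth_default// size_shift (leq_trans sp).
    by rewrite /Phi rE /shiftp -comp_polyA comp_polyD comp_polyX comp_polyC subrK comp_polyXr.
  split.
    by rewrite -(size_shift b) sPhi size_poly.
  move=> i ni; rewrite sPhi coef_poly ltnS ni; have := Kv (inord i).
  by rewrite /= inordK.
apply: (@continuous_compact _ (@poly_unif R)) => //.
apply: continuous_in_subspaceT => v /set_mem Kv A /nbhs_polyunifP[e1 e10 eA].
have vn : (row v)`_n != 0.
  rewrite -cabs_gt0 coef_poly ltnSn; have := Kv (inord n); rewrite /= inordK// => h.
  by have := cabsB q`_n (v ord0 (inord n)); rewrite cabsC; lra.
have sr : size (row v) = n.+1.
  apply/eqP; rewrite eqn_leq size_poly ltnNge; apply: contra vn => le.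
  by rewrite nth_default.
have sv : size (Phi v) = n.+1 by rewrite -(size_shift b) sPhi.
have [d d0 Hd] := @polymap_coef_continuous b (Phi v) e1 ltac:(by rewrite sv) e10.
have : nbhs v [set v' : 'rV[C]_n.+1 | forall i, cabs (v' ord0 i - v ord0 i) < d].
  exists (fun i j => [set z : C | cabs (z - v i j) < d]); first by move=> i j; exact: near_cabs.
  by move=> v' /= H i; exact: H.
apply: filterS => v' /= vv; apply: eA; apply: Hd.
  by rewrite sv -(size_shift b) sPhi size_poly.
move=> i; rewrite !sPhi !coef_poly; case: ifP => _; last by rewrite subrr cabs0 ltW.
exact/ltW/vv.
Qed.

End CompactFamilies.

(** * Semigroups and normality *)

Definition word {R : realType} (s : seq {poly R[i]}) : {poly R[i]} :=
  foldr (fun p q => p \Po q) 'X s.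

Definition letters {R : realType} (L : set {poly R[i]}) (s : seq {poly R[i]}) : Prop :=
  forall p, p \in s -> L p.

Section Words.
Context {R : realType}.
Local Notation C := R[i].
Implicit Types (p q : {poly C}) (s t : seq {poly C}) (x : C) (L : set {poly C}).

Lemma word_cat s t : word (s ++ t) = word s \Po word t.
Proof. by elim: s => [|p s IH] /=; rewrite ?comp_polyX// IH comp_polyA. Qed.

Lemma horner_word_cons p s x : (word (p :: s)).[x] = p.[(word s).[x]].
Proof. exact: horner_comp. Qed.

Lemma horner_word_cat s t x : (word (s ++ t)).[x] = (word s).[(word t).[x]].
Proof. by rewrite word_cat horner_comp. Qed.

Lemma word1 p : word [:: p] = p. Proof. exact: comp_polyXr. Qed.

Lemma letters_cons L p s : letters L (p :: s) <-> L p /\ letters L s.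
Proof.
split=> [H|[Lp Ls] q]; first by split=> [|q qs]; apply: H; rewrite inE ?eqxx// qs orbT.
by rewrite inE => /orP[/eqP ->|/Ls].
Qed.

Lemma letters_cat L s t : letters L s -> letters L t -> letters L (s ++ t).
Proof. by move=> Ls Lt p; rewrite mem_cat => /orP[/Ls|/Lt]. Qed.

Lemma letters_sub L L' s : L `<=` L' -> letters L s -> letters L' s.
Proof. by move=> LL Ls p /Ls /LL. Qed.

Lemma semigroup_gen_letter L p : L p -> semigroup_gen L p.
Proof. by move=> Lp; apply: sub_gen_smallest. Qed.

Lemma semigroup_gen_comp L p q :
  semigroup_gen L p -> semigroup_gen L q -> semigroup_gen L (p \Po q).
Proof. by move=> Lp Lq G GL; apply: (GL.1) => //; [exact: Lp|exact: Lq]. Qed.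

Lemma semigroup_genP L p :
  semigroup_gen L p <-> exists s, [/\ s != [::], letters L s & p = word s].
Proof.
split=> [|[s [s0 Ls ->]]].
  apply: (@smallest_sub _ _ _
    [set q | exists s, [/\ s != [::], letters L s & q = word s]]) => [_ _ [s [s0 Ls ->]] [t [t0 Lt ->]]|q Lq].
    exists (s ++ t); split; rewrite ?word_cat//; last exact: letters_cat.
    by case: (s) s0.
  by exists [:: q]; split; rewrite ?word1// => r; rewrite inE => /eqP ->.
elim: s s0 Ls => //= q s IH _ /letters_cons[Lq Ls].
have [->|s0] := eqVneq s [::]; first by rewrite /= comp_polyXr; exact: semigroup_gen_letter.
by apply: semigroup_gen_comp; [exact: semigroup_gen_letter|exact: IH].
Qed.

Lemma semigroup_gen_word L s : s != [::] -> letters L s -> semigroup_gen L (word s).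
Proof. by move=> s0 Ls; apply/semigroup_genP; exists s. Qed.

Lemma semigroup_gen_sub L L' : L `<=` L' -> semigroup_gen L `<=` semigroup_gen L'.
Proof.
move=> LL p /semigroup_genP[s [s0 Ls ->]].
by apply: semigroup_gen_word => //; exact: letters_sub Ls.
Qed.

Lemma pdeg_comp p q : pdeg (p \Po q) = (pdeg p * pdeg q)%N.
Proof. exact: size_comp_poly. Qed.

Lemma word_ge2 L s : L `<=` poly_ge2 -> s != [::] -> letters L s -> poly_ge2 (word s).
Proof.
move=> L2; elim: s => //= p s IH _ /letters_cons[/L2 p2 Ls].
have [->|s0] := eqVneq s [::]; first by rewrite /= comp_polyXr.
rewrite /poly_ge2 /= pdeg_comp; have := IH s0 Ls; rewrite /poly_ge2 /= => h.
by apply: leq_trans p2 _; rewrite leq_pmulr// ltnW.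
Qed.

Lemma semigroup_gen_ge2 L : L `<=` poly_ge2 -> semigroup_gen L `<=` poly_ge2.
Proof. by move=> L2 p /semigroup_genP[s [s0 Ls ->]]; exact: word_ge2 Ls. Qed.

End Words.

Lemma ultra_fmap (T U : Type) (f : T -> U) (F : set_system T) :
  UltraFilter F -> UltraFilter (f @ F).
Proof.
move=> FU; have FP : ProperFilter F by exact: ultra_proper.
split; first exact: fmap_proper_filter.
move=> G GF FG; rewrite predeqE => A; split; last exact: FG.
move=> GA; have [//|FnA] := in_ultra_setVsetC (f @^-1` A) FU.
have GnA : G (~` A) by apply: FG.
by have [? []] := filter_ex (filterI GA GnA).
Qed.

(** * Equicontinuity, normality and the Fatou set *)

Section Normality.
Context {R : realType}.
Local Notation C := R[i].
Local Notation Chat := (sphere R).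
Implicit Types (p q : {poly C}) (x y b : C) (G L : set {poly C}).

Lemma horner_continuous p x (e : R) : 0 < e ->
  exists2 d : R, 0 < d & forall y, cabs (y - x) < d -> cabs (p.[y] - p.[x]) < e.
Proof.
move=> e0; have [B B0 qB] := coef_bound (shiftp x p).
pose M := (size p).+1%:R * B * 1 ^+ size p.
have M0 : 0 <= M by rewrite /M expr1n mulr1 mulr_ge0.
have pM y : cabs (y - x) <= 1 -> cabs p.[y] <= M.
  move=> yx; rewrite (horner_shiftE x); apply: horner_upper => //.
  by rewrite size_shift.
exists (Num.min (1 / 2) (e / (2 * M + 1))).
  by rewrite lt_min !divr_gt0// ltr_wpDl// mulr_ge0.
move=> y; rewrite lt_min => /andP[y1 y2].
have := @schwarz _ p x 1 M y ltr01 pM (ltW y1); rewrite divr1 => /le_lt_trans; apply.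
move: y2; rewrite ltr_pdivlMr; last by rewrite ltr_wpDl// mulr_ge0.
by have := cabs_ge0 (y - x); clear - M0; nra.
Qed.

Lemma cabs_horner_continuous p : continuous (fun x => cabs p.[x]).
Proof.
move=> x A /nbhs_ballP[e /= e0 eA]; apply/nbhs_cabsP.
have [d d0 Hd] := horner_continuous p x e0; exists d => // y /Hd pe; apply: eA.
rewrite -ball_normE /= ltr_norml; apply/andP; split.
  by have := cabsB p.[y] p.[x]; lra.
by have := cabsB p.[x] p.[y]; rewrite cabsC; lra.
Qed.

Definition equicts G (z : Chat) := forall e : R, 0 < e ->
  \forall w \near z, forall p, G p -> ball (polymap p z) e (polymap p w).

(* The limit along an ultrafilter exists pointwise; equicontinuity makes the
   convergence uniform on compact sets. *)
Lemma equicts_normal G (A U : set Chat) : compact A -> U `<=` A ->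
  (forall z, A z -> equicts G z) -> normal_on G U.
Proof.
move=> cA UA eqA f Gf; pose F n : Chat -> Chat := polymap (f n).
have [UU [UUu oU]] := @ultraFilterLemma nat \oo eventually_filter.
have [l Fl] : exists l : Chat -> Chat, forall z : Chat, F n z @[n --> UU] --> l z.
  have : forall z : Chat, exists w : Chat, F n z @[n --> UU] --> w.
    move=> z; have := @sphere_compact R; rewrite compact_ultra => cs.
    by have [w [_ Fw]] := cs _ (ultra_fmap (fun n => F n z) UUu) filterT; exists w.
  by move=> /choice[l Hl]; exists l.
have UUF : ProperFilter UU by exact: ultra_proper.
have unif (e : R) : 0 < e -> \forall n \near UU, A `<=` [set z | ball (l z) e (F n z)].
  move=> e0; have e5 : 0 < e / 5 by rewrite divr_gt0.
  move/compact_near_coveringP : cA; apply => z Az.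
  have nz := eqA z Az _ e5.
  have Fz : \forall n \near UU, ball (l z) (e / 5) (F n z).
    exact: (Fl z _ (nbhsx_ballx (l z) _ e5)).
  exists ([set w | forall p, G p -> ball (polymap p z) (e / 5) (polymap p w)],
          [set n | ball (l z) (e / 5) (F n z)]) => /=; first by split.
  case=> w n [/= zw nzn].
  have Fnw : ball (F n z) (e / 5) (F n w) := zw _ (Gf n).
  have nz1 : \forall m \near UU, ball (l z) (e / 5) (F m z).
    exact: (Fl z _ (nbhsx_ballx (l z) _ e5)).
  have nw1 : \forall m \near UU, ball (l w) (e / 5) (F m w).
    exact: (Fl w _ (nbhsx_ballx (l w) _ e5)).
  have [m [mz mw]] := filter_ex (filterI nz1 nw1).
  have h1 := ball_triangle (ball_triangle mw (ball_sym (zw _ (Gf m)))) (ball_sym mz).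
  have := ball_triangle (ball_triangle h1 nzn) Fnw.
  by have -> : e / 5 + e / 5 + e / 5 + e / 5 + e / 5 = e by field.
have step k N : exists n, (N < n)%N /\ forall z, A z -> ball (l z) k.+1%:R^-1 (F n z).
  have uk := unif k.+1%:R^-1 (ltac:(by rewrite invr_gt0 ltr0n)).
  have uN : \forall n \near UU, (N < n)%N by apply: oU; exact: nbhs_infty_gt.
  by have [n [n1 n2]] := filter_ex (filterI uN uk); exists n.
have /choice[g gP] : forall kN, exists n, (kN.2 < n)%N /\
    forall z, A z -> ball (l z) kN.1.+1%:R^-1 (F n z).
  by case=> k N; exact: step.
pose phi := fix phi k := if k is k'.+1 then g (k, phi k') else g (0%N, 0%N).
exists phi, l; split.
  by apply: homo_ltn => [|k]; [exact: ltn_trans|have [] := gP (k.+1, phi k)].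
apply/fam_cvgP => B [BU cB].
apply: (uniform_subset_cvg _ (subset_trans BU UA)) => P /uniform_nbhs[E [entE EP]].
move: entE; rewrite -entourage_ballE => -[e /= e0 eE].
have nk : \forall k \near \oo, k.+1%:R^-1 < e by exact: near_infty_natSinv_lt (PosNum e0).
apply: filterS nk => k ke; apply: EP => z Az; apply: eE; apply: le_ball (ltW ke) _ _.
by case: k {ke} => [|k] /=; apply: (gP (_, _)).2.
Qed.

Lemma fatou_finite G x (r : R) : 0 < r ->
  (forall y, cabs (y - x) <= r -> equicts G (Some y)) -> fatou G (Some x).
Proof.
move=> r0 H; exists (Some @` [set y | cabs (y - x) < r]).
  split; last by exists x; rewrite //= subrr cabs0.
  apply: open_some; apply/open_cabsP => y /= yx.
  exists (r - cabs (y - x)); first by rewrite subr_gt0.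
  by move=> z zy; have := cabs_dist y z x; lra.
apply: (@equicts_normal _ (Some @` [set y | cabs (y - x) <= r])).
- by apply: compact_some; exact: disc_compact.
- by move=> _ [y yx <-]; exists y => //; exact: ltW.
- by move=> _ [y yx <-]; exact: H.
Qed.

Lemma fatou_infinite G b (M : R) :
  (forall y, M <= cabs (y - b) -> equicts G (Some y)) -> equicts G None -> fatou G None.
Proof.
move=> H HN.
pose A : set Chat := ~` (Some @` [set y : C | cabs (y - b) < M]).
exists (~` (Some @` [set y : C | cabs (y - b) <= M])).
  by split; [exact/closed_openC/closed_some_disc|case].
apply: (@equicts_normal _ A).
- apply: (subclosed_compact _ sphere_compact) => //.
  apply: open_closedC; apply: open_some; apply/open_cabsP => y /= yx.
  exists (M - cabs (y - b)); first by rewrite subr_gt0.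
  by move=> z zy; have := cabs_dist y z b; lra.
- by move=> z nz [y /= yM yz]; apply: nz; exists y => //; exact: ltW.
- move=> [y|] //= nz; apply: H; rewrite leNgt; apply/negP => h; apply: nz.
  by exists y.
Qed.

Lemma fatou_sub G G' : G' `<=` G -> fatou G `<=` fatou G'.
Proof.
move=> GG z [U oU nU]; exists U => // f Gf.
by apply: nU => n; apply: GG.
Qed.

Lemma julia_sub G G' : G' `<=` G -> julia G' `<=` julia G.
Proof. by move=> GG z jz fz; apply: jz; exact: fatou_sub fz. Qed.

(** Maps that are large on the disc send it into a spherically small neighbourhood of infinity; the
    others are Lipschitz near [x] with a common constant, by [schwarz]. The bound [B] may depend on
    [T]. *)
Lemma equicts_dichotomy G x b (r : R) : 0 < r ->
  (forall T : R, exists B : R, forall p, G p ->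
     (forall y, cabs (y - x) <= r -> T < cabs (p.[y] - b)) \/
     (forall y, cabs (y - x) <= r -> cabs (p.[y] - b) <= B)) ->
  equicts G (Some x).
Proof.
move=> r0 H e e0; have [T T0 HT] := far_ball e0; have [d d0 Hd] := some_ball e0.
have [B HB] := H (T + cabs b).
pose B' := `|B| + cabs b.
have B'0 : 0 <= B' by rewrite addr_ge0.
apply/nbhs_someP; exists (Num.min (r / 2) (d * r / (2 * B' + 1))).
  by rewrite lt_min !divr_gt0 ?mulr_gt0// ltr_wpDl// mulr_ge0.
move=> y; rewrite lt_min => /andP[y1 y2] p /HB[far_p|bd].
  apply: HT => /=.
    by have := far_p x; rewrite subrr cabs0 (ltW r0) => /(_ isT); have := cabsD p.[x] (- b); rewrite cabsN; lra.
  by have := far_p y; have := cabsD p.[y] (- b); rewrite cabsN => h1 /(_ ltac:(lra)); lra.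
apply: Hd; have pB w : cabs (w - x) <= r -> cabs p.[w] <= B'.
  by move=> /bd; have := cabsB p.[w] b; have := ler_norm B; rewrite /B'; lra.
apply: le_lt_trans (schwarz r0 pB (ltW y1)) _.
rewrite ltr_pdivrMr//; move: y2; rewrite ltr_pdivlMr; last by rewrite ltr_wpDl// mulr_ge0.
by have := cabs_ge0 (y - x); clear - B'0; nra.
Qed.

Lemma Khat_orbit G x p : (forall p q, G p -> G q -> G (p \Po q)) ->
  Khat G x -> G p -> Khat G p.[x].
Proof.
move=> Gc /bounded_cabsP[M HM] Gp; apply/bounded_cabsP; exists M => _ [q Gq <-].
by apply: HM; exists (q \Po p); [exact: Gc|exact: horner_comp].
Qed.

(** Otherwise there are points tending to [x] and elements of [G] whose values at them exceed every
    bound, while the values at [x] stay bounded. A uniformly convergent subsequence forbids this.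
    Hence the boundary of the filled set lies in the Julia set. *)
Lemma fatou_Khat_interior G x : fatou G (Some x) -> Khat G x -> (Khat G)° x.
Proof.
move=> [U [oU Ux] nU] /bounded_cabsP[M HM].
apply: contrapT => /nbhs_cabsP nint.
have /choice[zg zgP] : forall n : nat, exists zg : C * {poly C},
    [/\ cabs (zg.1 - x) < n.+1%:R^-1, G zg.2 & n%:R < cabs zg.2.[zg.1]].
  move=> n; apply: contrapT => nex; apply: nint; exists n.+1%:R^-1.
    by rewrite invr_gt0 ltr0n.
  move=> y yx; apply/bounded_cabsP; exists n%:R => _ [p Gp <-].
  by rewrite leNgt; apply/negP => h; apply: nex; exists (y, p).
have [phi [l [hphi cvl]]] := nU (fun n => (zg n).2) (fun n => let: And3 _ h _ := zgP n in h).
have /nbhs_someP[r r0 rU] : nbhs (Some x : Chat) U by apply: open_nbhs_nbhs.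
pose A : set Chat := Some @` [set y | cabs (y - x) <= r / 2].
have cA : compactly_in U A.
  split; last by apply: compact_some; exact: disc_compact.
  by move=> _ [y /= yr <-]; apply: rU; lra.
have unif (e : R) : 0 < e -> \forall k \near \oo, forall z, A z ->
    ball (l z) e (polymap (zg (phi k)).2 z).
  move=> e0; move/fam_cvgP : cvl => /(_ _ cA) /(_ [set h | forall z, A z -> ball (l z) e (h z)]).
  apply; apply/uniform_nbhs; exists [set uv | ball uv.1 e uv.2].
  by split=> //; exact: (entourage_ball _ (PosNum e0)).
have [d d0 Hd] := @ball_some R M 1 ltr01.
have d5 : 0 < d / 5 by rewrite divr_gt0.
(* One fixed member of the sequence replaces the limit [l]: it is uniformly close to it and known to
   be continuous at [x]. *)
have [m um] : exists m, forall z, A z -> ball (l z) (d / 5) (polymap (zg (phi m)).2 z).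
  by have := unif _ d5 => /filter_ex[m ?]; exists m.
have [d1 d10 Hd1] := some_ball d5.
have [d2 d20 Hd2] := horner_continuous (zg (phi m)).2 x d10.
have le_phi k : (k <= phi k)%N by elim: k => // k IH; apply: leq_ltn_trans IH (hphi _ _ _).
pose e := Num.min d2 (r / 2).
have e0 : 0 < e by rewrite lt_min d20 divr_gt0.
have n1 : \forall k \near \oo, k.+1%:R^-1 < e by exact: near_infty_natSinv_lt (PosNum e0).
have n2 : \forall k \near \oo, M + 1 < k%:R by exact: nbhs_infty_gtr.
have [k [[uk k1] k2]] := filter_ex (filterI (filterI (unif _ d5) n1) n2).
have [zx Gg gz] := zgP (phi k).
have zxe : cabs ((zg (phi k)).1 - x) < e.
  apply: lt_trans k1; apply: lt_le_trans zx _.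
  by rewrite lef_pV2 ?posrE ?ltr0n// ler_nat ltnS.
move: zxe; rewrite lt_min => /andP[z1 z2].
have Ax : A (Some x) by exists x; rewrite //= subrr cabs0 divr_ge0// ltW.
have Az : A (Some (zg (phi k)).1) by exists (zg (phi k)).1 => //; exact: ltW.
have c1 := ball_triangle (ball_sym (uk _ Ax)) (um _ Ax).
have c2 := ball_triangle c1 (Hd1 _ _ (Hd2 _ z1)).
have c3 := ball_triangle (ball_triangle c2 (ball_sym (um _ Az))) (uk _ Az).
have gx : cabs (zg (phi k)).2.[x] <= M by apply: HM; exists (zg (phi k)).2.
have dE : d / 5 + d / 5 + d / 5 + d / 5 + d / 5 = d by field.
rewrite dE in c3; have [y [yE] yx] := Hd _ _ gx c3.
have := cabsB y (zg (phi k)).2.[x]; rewrite -yE in yx *.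
have : (k%:R : R) <= (phi k)%:R by rewrite ler_nat.
lra.
Qed.

End Normality.

(** * Escape to infinity and its consequences for the filled set and the Julia set *)

Section Escape.
Context {R : realType}.
Local Notation C := R[i].
Local Notation Chat := (sphere R).
Implicit Types (p q : {poly C}) (x y b : C) (G L : set {poly C}).

Definition escaping L b (W : R) : Prop :=
  forall p, L p -> forall y, W <= cabs (y - b) -> 2 * cabs (y - b) <= cabs (p.[y] - b).

Definition loc_bounded L b : Prop := forall t : R, exists M : R,
  forall p, L p -> forall y, cabs (y - b) <= t -> cabs (p.[y] - b) <= M.

Context (L : set {poly C}) (b : C) (W : R).
Context (W1 : 1 <= W) (esc : escaping L b W).

Lemma escape_word s y : letters L s -> W <= cabs (y - b) ->
  2 ^+ size s * cabs (y - b) <= cabs ((word s).[y] - b).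
Proof.
move=> + Wy; elim: s => [|p s IH]; first by rewrite /= expr0 mul1r hornerX.
move=> /letters_cons[Lp Ls]; rewrite horner_word_cons /= exprS -mulrA.
have {}IH := IH Ls; apply: le_trans (esc Lp _); first by rewrite ler_wpM2l.
apply: le_trans Wy _; apply: le_trans IH.
by rewrite ler_peMl// exprn_ege1// ler1n.
Qed.

Lemma Khat_word : L !=set0 -> forall y,
  Khat (semigroup_gen L) y <-> forall s, letters L s -> cabs ((word s).[y] - b) <= W.
Proof.
move=> [p Lp] y; split=> [/bounded_cabsP[M HM] s Ls|H]; last first.
  apply/bounded_cabsP; exists (W + cabs b) => _ [_ /semigroup_genP[s [_ Ls ->]] <-].
  by have := H s Ls; have := cabsB (word s).[y] b; lra.
rewrite leNgt; apply/negP => lt.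
pose k := (Num.truncn (`|M| + cabs b)).+1.
have Lk : letters L (nseq k p) by move=> q; rewrite mem_nseq => /andP[_ /eqP ->].
have := escape_word Lk (ltW lt); rewrite -horner_word_cat size_nseq.
have /HM : [set g.[y] | g in semigroup_gen L] (word (nseq k p ++ s)).[y].
  exists (word (nseq k p ++ s)) => //; apply: semigroup_gen_word => //.
  exact: letters_cat.
move=> h1 h2; have h3 := cabsD (word (nseq k p ++ s)).[y] (- b); rewrite cabsN in h3.
have h4 : (`|M| + cabs b) < k%:R by exact: truncnS_gt.
have h5 : (k%:R : R) <= 2 ^+ k by rewrite -natrX ler_nat ltnW// ltn_expl.
have h6 := ler_norm M; have h7 : 1 <= cabs ((word s).[y] - b) by exact: (ltW (le_lt_trans W1 lt)).
have : 2 ^+ k <= (2 : R) ^+ k * cabs ((word s).[y] - b) by rewrite ler_peMr// exprn_ge0.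
move: (2 ^+ k) h2 h5 => E h2 h5 h8; clear - h1 h2 h3 h4 h5 h6 h8; lra.
Qed.

Lemma Khat_le : L !=set0 -> forall y, Khat (semigroup_gen L) y -> cabs (y - b) <= W.
Proof.
by move=> L0 y /(Khat_word L0) /(_ [::]); rewrite /= hornerX => H; apply: H => p.
Qed.

Lemma Khat_closed : L !=set0 -> closed (Khat (semigroup_gen L)).
Proof.
move=> L0; apply/closed_cabsP => x H; apply/(Khat_word L0) => s Ls.
apply/ler_addgt0Pr => e e0.
have [d d0 Hd] := horner_continuous (word s) x e0.
have [y Ky yx] := H _ d0; have h1 := (Khat_word L0 y).1 Ky s Ls.
have h2 := Hd _ yx; rewrite cabsC in h2.
have h3 := cabs_dist (word s).[y] (word s).[x] b; clear - h1 h2 h3; lra.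
Qed.

Lemma Khat_invariant s y : letters L s -> Khat (semigroup_gen L) y ->
  Khat (semigroup_gen L) (word s).[y].
Proof.
have [->|s0] := eqVneq s [::]; first by rewrite /= hornerX.
move=> Ls Ky; apply: (Khat_orbit _ Ky); last exact: semigroup_gen_word.
by move=> ? ?; exact: semigroup_gen_comp.
Qed.

Context (bdd : loc_bounded L b).

Lemma words_bounded k (t : R) : exists M : R, forall s y, (size s <= k)%N ->
  letters L s -> cabs (y - b) <= t -> cabs ((word s).[y] - b) <= M.
Proof.
elim: k => [|k [M IH]].
  by exists t => -[|//] y _ _ yt; rewrite /= hornerX.
have [M' HM'] := bdd M; exists (Num.max t M') => -[|p s] y sk Ls yt.
  by rewrite /= hornerX le_max yt.
have /letters_cons[Lp Ls'] := Ls.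
by rewrite horner_word_cons le_max; apply/orP; right; apply: HM' => //; exact: IH.
Qed.

(** Long words of the second kind are far from [b] on the whole disc, short ones are uniformly
    bounded there: the dichotomy of [equicts_dichotomy]. The exponent [(size s).-1] lets the first
    map applied be spent on reaching the escape region. *)
Lemma escape_equicts x (r M0 : R) : 0 < r ->
  (forall p, semigroup_gen L p ->
     (forall y, cabs (y - x) <= r -> cabs (p.[y] - b) <= M0) \/
     exists s, [/\ letters L s, p = word s &
       forall y, cabs (y - x) <= r -> 2 ^+ (size s).-1 <= cabs (p.[y] - b)]) ->
  equicts (semigroup_gen L) (Some x).
Proof.
move=> r0 H; apply: (@equicts_dichotomy _ _ x b r) => // T.
pose k := (Num.truncn `|T|).+1.
have [M HM] := words_bounded k (cabs (x - b) + r).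
exists (Num.max M0 M) => p /H[bp|[s [Ls ps sp]]].
  by right=> y /bp h; rewrite le_max h.
have [sk|ks] := leqP (size s) k.
  right=> y yr; rewrite le_max ps HM ?orbT//.
  by have := cabs_dist x y b; lra.
left=> y /sp; apply: lt_le_trans.
apply: (@lt_le_trans _ _ (k%:R)); first exact: le_lt_trans (ler_norm T) (truncnS_gt _).
rewrite -natrX ler_nat; apply: (@leq_trans (size s).-1); last exact/ltnW/ltn_expl.
by rewrite -ltnS prednK// (leq_trans _ ks).
Qed.

Lemma fatou_Khat : L !=set0 -> (Khat (semigroup_gen L))° `<=` [set x | fatou (semigroup_gen L) (Some x)].
Proof.
move=> L0 x /nbhs_cabsP[e e0 eK]; have e3 : 0 < e / 3 by rewrite divr_gt0.
apply: (@fatou_finite _ _ _ (e / 3)) => // y yx.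
apply: (@escape_equicts _ (e / 3) W) => // p /semigroup_genP[s [_ Ls ->]]; left=> z zy.
apply: (Khat_word L0 z).1 => //; apply: eK.
by have := cabs_dist y z x; lra.
Qed.

Lemma fatou_outside x : 3 * W <= cabs (x - b) -> fatou (semigroup_gen L) (Some x).
Proof.
have W1' := W1; move=> xW; apply: (@fatou_finite _ _ _ W) => [|y yx]; first by lra.
apply: (@escape_equicts _ W 0) => [|p /semigroup_genP[s [_ Ls ->]]]; first by lra.
right; exists s; split=> // z zy.
have Wz : W <= cabs (z - b).
  have := cabs_dist y x b; rewrite (cabsC x y); have := cabs_dist z y b.
  by rewrite (cabsC y z); lra.
apply: (le_trans _ (escape_word Ls Wz)); apply: (@le_trans _ _ (2 ^+ size s)).
  by rewrite ler_weXn2l ?ler1n// leq_pred.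
by rewrite ler_peMr ?exprn_ge0//; lra.
Qed.

Lemma polymap_infty p : (0 < pdeg p)%N -> polymap p None = None.
Proof. by rewrite /=; case: (pdeg p). Qed.

Lemma fatou_infty : L `<=` poly_ge2 -> fatou (semigroup_gen L) None.
Proof.
have W1' := W1; move=> L2; apply: (@fatou_infinite _ _ b (2 * W)) => [y yW|e e0].
  apply: (@escape_equicts _ W 0) => [|p /semigroup_genP[s [_ Ls ->]]]; first by lra.
  right; exists s; split=> // z zy.
  have Wz : W <= cabs (z - b) by have := cabs_dist z y b; rewrite (cabsC y z); lra.
  apply: (le_trans _ (escape_word Ls Wz)); apply: (@le_trans _ _ (2 ^+ size s)).
    by rewrite ler_weXn2l ?ler1n// leq_pred.
  by rewrite ler_peMr ?exprn_ge0//; lra.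
have [M M0 HM] := inf_ball e0.
apply/nbhs_infP; exists (M + 2 * cabs b + W); first by have := cabs_ge0 b; lra.
move=> w fw p Gp; have p2 := semigroup_gen_ge2 L2 Gp.
have p0 : (0 < pdeg p)%N by exact: leq_trans p2.
rewrite polymap_infty//; case: w fw => [y|_]; last by rewrite polymap_infty//; exact: ballxx.
move=> /= fy; apply: HM => /=; move: Gp => /semigroup_genP[s [_ Ls ->]].
have Wy : W <= cabs (y - b) by have := cabsB y b; have := cabs_ge0 b; lra.
have h1 := escape_word Ls Wy.
have h2 : cabs (y - b) <= 2 ^+ size s * cabs (y - b).
  by rewrite ler_peMl// exprn_ege1// ler1n.
have h3 := le_trans h2 h1; have h4 := cabsD (word s).[y] (- b); rewrite cabsN in h4.
have h5 := cabsB y b; clear - h3 h4 h5 fy W1'; lra.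
Qed.

Lemma julia_bounded z : L `<=` poly_ge2 -> julia (semigroup_gen L) z ->
  exists2 x, z = Some x & cabs (x - b) < 3 * W.
Proof.
have W1' := W1; move=> L2 jz; case: z jz => [x jx|]; last by case; exact: fatou_infty.
by exists x => //; rewrite ltNge; apply/negP => /fatou_outside.
Qed.

End Escape.

Section Boundary.
Context {R : realType}.
Local Notation C := R[i].
Local Notation Chat := (sphere R).
Implicit Types (p q : {poly C}) (x y b : C) (G L : set {poly C}).

Lemma boundary_point (A : set C) x y : closed A -> A x -> ~ A y ->
  exists t : R, [/\ 0 <= t <= 1, A (x + t%:C * (y - x)) & ~ A° (x + t%:C * (y - x))].
Proof.
move=> cA Ax nAy; apply: contrapT => nex; apply: nAy.
have sub := @connected_clopen _ [set x + t%:C * (y - x) | t in `[0, 1]%classic] A x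
  (@csegment_connected _ x y) _ Ax.
apply: sub.
- by exists 0; rewrite ?mul0r ?addr0//= in_itv /= lexx ler01.
- move=> _ [t /= t01 <-] At; apply: contrapT => nint; apply: nex; exists t.
  split=> //.
  move=> /nbhs_cabsP[e e0 eA]; apply: nint; exists e => // w we _; exact: eA.
- move=> z _ nAz; apply: contrapT => nop; apply: nAz.
  move/closed_cabsP : cA; apply => e e0; apply: contrapT => nA; apply: nop.
  by exists e => // w we _ Aw; apply: nA; exists w.
- by exists 1; rewrite ?mul1r ?subrKC//= in_itv /= lexx ler01.
Qed.

Lemma connected_annulus (A : set Chat) b (s1 s2 : R) : s1 < s2 -> connected A ->
  (forall y, s1 < cabs (y - b) < s2 -> ~ A (Some y)) ->
  (exists y, A (Some y) /\ cabs (y - b) < s2) ->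
  A `<=` Some @` [set y : C | cabs (y - b) <= s1].
Proof.
move=> s12 cA nA [y0 [Ay0 y0s]].
have small y : A (Some y) -> cabs (y - b) < s2 -> cabs (y - b) <= s1.
  by move=> Ay ys; rewrite leNgt; apply/negP => lt; apply: (nA y) => //; rewrite lt.
suff <- : A `&` Some @` [set y : C | cabs (y - b) <= s1] = A by move=> z [].
apply: cA.
- by exists (Some y0); split => //; exists y0 => //; exact: small.
- exists (Some @` [set y : C | cabs (y - b) < s2]).
    apply: open_some; apply/open_cabsP => y /= ys; exists (s2 - cabs (y - b)).
      by rewrite subr_gt0.
    by move=> z zy; have := cabs_dist y z b; lra.
  rewrite eqEsubset; split=> u [Au [y /= ys yu]]; split=> //; exists y => //=.
    by apply: le_lt_trans s12.
  by apply: small => //; rewrite yu.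
- by exists (Some @` [set y : C | cabs (y - b) <= s1]) => //; exact: closed_some_disc.
Qed.

End Boundary.

(** * The perturbed semigroup *)

Section CriticalValues.
Context {R : realType}.
Local Notation C := R[i].
Local Notation Chat := (sphere R).
Implicit Types (p q : {poly C}) (x y b c : C) (G L : set {poly C}).

Lemma mup_gt1 p c : (0 < pdeg p)%N -> (1 < mup c (p - p.[c]%:P))%N = root p^`() c.
Proof.
move=> p0; pose q := p - p.[c]%:P.
have q0 : q != 0.
  apply/eqP => /eqP; rewrite subr_eq0 => /eqP pc; move: p0.
  by rewrite /pdeg pc; case: (size _) (size_polyC_leq1 p.[c]) => [|[]].
have /factor_theorem[r qr] : root q c by rewrite /root !hornerE subrr.
have r0 : r != 0 by apply: contra q0 => /eqP r0; rewrite qr r0 mul0r.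
have -> : p^`() = q^`() by rewrite derivB derivC subr0.
rewrite -/q qr mupM ?polyXsubC_eq0//.
have -> : mup c ('X - c%:P) = 1%N by have := mup_XsubCX 1 c c; rewrite expr1 eqxx.
rewrite addn1 ltnS -XsubC_dvd// -root_factor_theorem derivM derivXsubC mulr1.
by rewrite /root !hornerE subrr mulr0 add0r.
Qed.

Lemma critical_valuesP p y : (0 < pdeg p)%N ->
  critical_values p (Some y) <-> exists2 c, root p^`() c & y = p.[c].
Proof.
move=> p0; split=> [[[c|] /= Hc]|[c rc ->]]; last 1 first.
- by exists (Some c) => //=; rewrite mup_gt1.
- by case=> <-; exists c => //; rewrite -mup_gt1.
- by rewrite gtn_eqF.
Qed.

Lemma critical_values_comp p q x : (0 < pdeg p)%N -> (0 < pdeg q)%N ->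
  critical_values q (Some x) -> critical_values (p \Po q) (Some p.[x]).
Proof.
move=> p0 q0 /(critical_valuesP _ q0)[c rc ->].
apply/critical_valuesP; first by rewrite pdeg_comp muln_gt0 p0.
exists c; last by rewrite horner_comp.
by rewrite deriv_comp rootM rc orbT.
Qed.

Lemma critical_values_compI p q y : (0 < pdeg p)%N -> (0 < pdeg q)%N ->
  critical_values (p \Po q) (Some y) -> critical_values p (Some y) \/
    exists2 x, critical_values q (Some x) & y = p.[x].
Proof.
move=> p0 q0 /critical_valuesP[]; first by rewrite pdeg_comp muln_gt0 p0.
move=> c; rewrite deriv_comp rootM horner_comp => /orP[|] rc ->.
  left; apply/critical_valuesP => //; exists q.[c] => //.
  by rewrite -root_comp.
by right; exists q.[c] => //; apply/critical_valuesP => //; exists c.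
Qed.

(** The image under [q] of a critical value of [p] is a critical value of [q \Po p], so the orbit
    stays in the bounded postcritical set. *)
Lemma critical_orbit_Khat G p y : postcritically_bounded G -> G p ->
  critical_values p (Some y) -> Khat G y.
Proof.
move=> [[L [L0 L1 ->]] G2 /bounded_cabsP[M HM]] Gp cy.
apply/bounded_cabsP; exists M => _ [q Gq <-]; apply: HM.
apply: subset_closure; exists (q \Po p); first exact: semigroup_gen_comp.
by apply: critical_values_comp => //; apply: ltnW; [exact: (G2 _ Gq)|exact: (G2 _ Gp)].
Qed.

End CriticalValues.

(** * Filled set, separating annulus and minimal component of the perturbed semigroup *)

Section Perturbation.
Context {R : realType}.
Local Notation C := R[i].
Local Notation Chat := (sphere R).
Implicit Types (p q : {poly C}) (x y c : C).

Context (Gam V : set {poly C}) (b : C) (W s1 s2 r : R).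
Context (W1 : 1 <= W) (s12 : s1 < s2) (s2W : s2 <= W) (r0 : 0 < r) (s10 : 0 < s1).
Context (Gam0 : Gam !=set0) (Gam2 : Gam `<=` poly_ge2) (V2 : V `<=` poly_ge2).
Context (esc : escaping (Gam `|` V) b W) (bdd : loc_bounded (Gam `|` V) b).
Context (hG : forall p, Gam p -> forall y, s1 <= cabs (y - b) -> W <= cabs (p.[y] - b)).
Context (hV : forall p, V p -> forall y, cabs (y - b) <= s2 -> cabs (p.[y] - b) <= r).
Context (rK : forall y, cabs (y - b) <= 3 * r -> Khat (semigroup_gen Gam) y).
Context (Ks2 : forall y, Khat (semigroup_gen Gam) y -> cabs (y - b) <= s2).
Context (critV : forall p c, V p -> root p^`() c -> cabs (p.[c] - b) <= r).
Context (PG : postcritically_bounded (semigroup_gen Gam)).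

Local Notation G := (semigroup_gen Gam).
Local Notation H := (semigroup_gen (Gam `|` V)).
Local Notation K := (Khat G).

Let escG : escaping Gam b W. Proof. by move=> p Gp; apply: esc; left. Qed.
Let H0 : (Gam `|` V) !=set0. Proof. by case: Gam0 => p; exists p; left. Qed.
Let H2 : (Gam `|` V) `<=` poly_ge2. Proof. by move=> p [/Gam2|/V2]. Qed.
Let rK1 y : cabs (y - b) <= r -> K y.
Proof. by move=> h; apply: rK; have r0' := r0; lra. Qed.

Lemma Khat_letter p y : (Gam `|` V) p -> K y -> K p.[y].
Proof.
case=> [Gp Ky|Vp Ky]; last by apply/rK1/(hV Vp)/Ks2.
rewrite -(word1 p); apply: Khat_invariant => // q.
by rewrite inE => /eqP ->.
Qed.

Lemma Khat_word_invariant s y : letters (Gam `|` V) s -> K y -> K (word s).[y].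
Proof.
elim: s => [|p s IH]; first by rewrite /= hornerX.
move=> /letters_cons[Lp Ls] Ky; rewrite horner_word_cons.
by apply: Khat_letter => //; exact: IH.
Qed.

Lemma Khat_perturbation : Khat H = K.
Proof.
rewrite eqEsubset; split=> y.
  move=> /bounded_cabsP[M HM]; apply/bounded_cabsP; exists M => _ [p Gp <-].
  apply: HM; exists p => //; apply: semigroup_gen_sub Gp; exact: subsetUl.
move=> Ky; apply/(Khat_word W1 esc H0) => s Ls.
by apply: (Khat_le W1 escG Gam0); exact: Khat_word_invariant.
Qed.

Lemma letter_pdeg p : (Gam `|` V) p -> (0 < pdeg p)%N.
Proof. by move/H2 => h; exact: leq_trans h. Qed.

Lemma word_pdeg s : s != [::] -> letters (Gam `|` V) s -> (0 < pdeg (word s))%N.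
Proof. by move=> s0 Ls; have h := word_ge2 H2 s0 Ls; exact: leq_trans h. Qed.

Lemma Gam_critical p y : Gam p -> critical_values p (Some y) -> K y.
Proof. by move=> Gp; apply: (critical_orbit_Khat PG); exact: semigroup_gen_letter. Qed.

Lemma V_critical p y : V p -> critical_values p (Some y) -> cabs (y - b) <= r.
Proof.
move=> Vp /critical_valuesP[|c rc ->]; last exact: critV.
by apply: letter_pdeg; right.
Qed.

Lemma word_critical s y : s != [::] -> letters (Gam `|` V) s ->
  critical_values (word s) (Some y) -> K y.
Proof.
elim: s y => //= p s IH y _ /letters_cons[Lp Ls].
have pK z : critical_values p (Some z) -> K z.
  by case: Lp => [/Gam_critical|/V_critical h /h /rK1]; [exact|].
have [->|s0] := eqVneq s [::]; first by rewrite /= comp_polyXr; exact: pK.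
move=> /(critical_values_compI (letter_pdeg Lp) (word_pdeg s0 Ls))[/pK//|[x cx ->]].
by apply: Khat_letter => //; exact: IH cx.
Qed.

Lemma postcritical_Khat y : postcritical H (Some y) -> K y.
Proof.
move=> cl; apply: contrapT => nK.
have cK := Khat_closed W1 escG Gam0.
have oK : open (~` K) by exact: closed_openC.
have := cl _ (open_nbhs_nbhs (conj (open_some oK) (ex_intro2 _ _ y nK erefl))).
case=> w [[p /semigroup_genP[s [s0 Ls ->]] cp] [z nKz zw]]; rewrite -zw in cp.
by apply: nKz; exact: word_critical cp.
Qed.

Lemma postcritically_bounded_perturbation : postcritically_bounded H.
Proof.
split.
- exists (Gam `|` V); split=> // p /H2 h; exact: leq_trans h.
- exact: semigroup_gen_ge2.
- apply/bounded_cabsP; exists (W + cabs b) => y /postcritical_Khat Ky.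
  by have := Khat_le W1 escG Gam0 Ky; have := cabsB y b; lra.
Qed.

Lemma fatou_Khat_perturbation x : K° x -> fatou H (Some x).
Proof. by move=> Kx; apply: (fatou_Khat W1 esc bdd H0); rewrite Khat_perturbation. Qed.

Lemma fatou_annulus x : s1 < cabs (x - b) < s2 -> fatou H (Some x).
Proof.
have W1' := W1; move=> /andP[x1 x2]; pose e := Num.min (cabs (x - b) - s1) (s2 - cabs (x - b)) / 2.
have e0 : 0 < e by rewrite divr_gt0// lt_min !subr_gt0 x1.
have e1 : 2 * e <= cabs (x - b) - s1.
  by rewrite /e mulrC divfK// ge_min lexx.
have e2 : 2 * e <= s2 - cabs (x - b).
  by rewrite /e mulrC divfK// ge_min lexx orbT.
apply: (@fatou_finite _ _ _ e) => // y yx.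
apply: (escape_equicts bdd (r := e) (M0 := W)) => // _ /semigroup_genP[s [s0 Ls ->]].
have ann z : cabs (z - y) <= e -> s1 <= cabs (z - b) <= s2.
  move=> zy; have h1 := cabs_dist y z b; have h2 := cabs_dist x y b.
  have h3 := cabs_dist y x b; have h4 := cabs_dist z y b.
  rewrite (cabsC x y) in h3; rewrite (cabsC y z) in h4; apply/andP; split; lra.
(* The last letter of the list is the first map applied, and it decides: a letter of [Gam] sends the
   annulus beyond [W], a letter of [V] sends it into K. *)
case/lastP: s s0 Ls => // s p _ Ls.
have Lp : (Gam `|` V) p by apply: Ls; rewrite mem_rcons mem_head.
have Ls' : letters (Gam `|` V) s by move=> q qs; apply: Ls; rewrite mem_rcons inE qs orbT.
have wE z : (word (rcons s p)).[z] = (word s).[p.[z]].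
  by rewrite -cats1 horner_word_cat word1.
case: (Lp) => [Gp|Vp].
  right; exists (rcons s p); split=> // z /ann/andP[zs _].
  rewrite size_rcons /= wE.
  have Wz := hG Gp zs; apply: (le_trans _ (escape_word esc Ls' Wz)).
  by rewrite ler_peMr ?exprn_ge0//; lra.
left=> z /ann/andP[_ zs]; rewrite wE; apply: (Khat_le W1 escG Gam0).
by apply: Khat_word_invariant => //; apply/rK1/(hV Vp).
Qed.

Lemma Khat1_sub p : (Gam `|` V) p -> K `<=` Khat (semigroup_gen [set p]).
Proof.
move=> Lp; rewrite -Khat_perturbation => y /bounded_cabsP[M HM].
apply/bounded_cabsP; exists M => _ [q Gq <-]; apply: HM; exists q => //.
by apply: semigroup_gen_sub Gq => _ ->.
Qed.

Let esc1 p : (Gam `|` V) p -> escaping [set p] b W.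
Proof. by move=> Lp _ ->; exact: esc. Qed.

Let ne1 p : [set p] !=set0. Proof. by exists p. Qed.

Lemma julia1_sub p : (Gam `|` V) p -> julia (semigroup_gen [set p]) `<=` julia H.
Proof. by move=> Lp; apply: julia_sub; apply: semigroup_gen_sub => _ ->. Qed.

(** The filled set of [p] is closed, contains [b] and omits [b + 2W]; a boundary point on the
    segment between them is in the Julia set by [fatou_Khat_interior]. *)
Lemma julia1_point p : (Gam `|` V) p -> exists2 z, julia (semigroup_gen [set p]) (Some z) &
  Khat (semigroup_gen [set p]) z /\ ~ (Khat (semigroup_gen [set p]))° z.
Proof.
move=> Lp; have W1' := W1.
have cK := Khat_closed W1 (esc1 Lp) (ne1 p).
have Kb : Khat (semigroup_gen [set p]) b.
  by apply: (Khat1_sub Lp); apply: rK1; rewrite subrr cabs0 ltW.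
have nK : ~ Khat (semigroup_gen [set p]) (b + (2 * W)%:C).
  move=> /(Khat_le W1 (esc1 Lp) (ne1 p)).
  by rewrite addrC addKr cabs_real; lra.
have [t [_ Kz nKz]] := boundary_point cK Kb nK.
set z := b + _ in Kz nKz; exists z => // fz.
by apply: nKz; exact: fatou_Khat_interior.
Qed.

Lemma julia_inner p : Gam p -> exists2 z, julia (semigroup_gen [set p]) (Some z) & cabs (z - b) < s1.
Proof.
move=> Gp; have W1' := W1; have Lp : (Gam `|` V) p by left.
have [z jz [Kz _]] := julia1_point Lp; exists z => //.
rewrite ltNge; apply/negP => zs; have Wz := hG Gp zs.
(* Two applications of [p]: the first only guarantees distance at least [W], the second a distance
   strictly larger. *)
have L1 : letters [set p] [:: p; p] by move=> q; rewrite !inE orbb => /eqP.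
have := (Khat_word W1 (esc1 Lp) (ne1 p) z).1 Kz _ L1.
rewrite horner_word_cons word1; have := esc Lp Wz; lra.
Qed.

(** A point at distance less than [s2] from [b] has a neighbourhood that [p] maps into K, so it is
    interior to the filled set of [p]. *)
Lemma julia_outer p : V p -> exists2 z, julia (semigroup_gen [set p]) (Some z) & s2 <= cabs (z - b).
Proof.
move=> Vp; have W1' := W1; have Lp : (Gam `|` V) p by right.
have [z jz [_ nKz]] := julia1_point Lp; exists z => //.
rewrite leNgt; apply/negP => zs; apply: nKz; apply/nbhs_cabsP.
exists (s2 - cabs (z - b)); first by rewrite subr_gt0.
move=> y yz; have ys : cabs (y - b) <= s2 by have := cabs_dist z y b; lra.
apply/(Khat_word W1 (esc1 Lp) (ne1 p)) => s Ls.
case/lastP: s Ls => [|s q] Ls; first by rewrite /= hornerX; exact: le_trans s2W.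
have /= qp : [set p] q by apply: Ls; rewrite mem_rcons mem_head.
rewrite -cats1 horner_word_cat word1 qp; apply: (Khat_le W1 escG Gam0).
apply: Khat_word_invariant; last by apply/rK1/(hV Vp).
by move=> q' q's; have /= -> : [set p] q' by apply: Ls; rewrite mem_rcons inE q's orbT.
Qed.

Lemma julia_annulus y : s1 < cabs (y - b) < s2 -> ~ julia H (Some y).
Proof. by move=> /fatou_annulus fy; apply. Qed.

Context (V0 : V !=set0).

Lemma julia_disconnected : ~ connected (julia H).
Proof.
move=> conJ; have [p Vp] := V0; have [q Gq] := Gam0.
have [zo jo zos] := julia_outer Vp; have [zi ji zis] := julia_inner Gq.
have Jo : julia H (Some zo) by apply: (julia1_sub _ jo); right.
have Ji : julia H (Some zi) by apply: (julia1_sub _ ji); left.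
have := @connected_annulus _ _ b s1 s2 s12 conJ julia_annulus.
case/(_ _ (Some zo) Jo); first by exists zi; split=> //; exact: lt_trans s12.
by move=> z /= zs [zz]; rewrite zz in zs; have s12' := s12; lra.
Qed.

(** If J(p) lay in the minimal component for some [p] in [V], that component would reach beyond the
    annulus and hence avoid the disc of radius [s2]. It would then surround the component of J(H)
    through a point of J(q), [q] in [Gam], against minimality. *)
Lemma gen_min_sub : gen_min (Gam `|` V) `<=` Gam.
Proof.
have s12' := s12; move=> p [Lp jmin]; case: (Lp) => // Vp; exfalso.
have [q Gq] := Gam0.
have [zo jo zos] := julia_outer Vp; have [zi ji zis] := julia_inner Gq.
have Ji : julia H (Some zi) by apply: (julia1_sub _ ji); left.
set KM := julia_min H in jmin.
(* Were there no minimal component, [julia_min] would be the default [set0], which cannot contain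
   the point [zo]. *)
have [KMc KMm] : minimal_component H KM.
  rewrite /KM /julia_min; case: xgetP => [K' _ //|none].
  by have := jmin _ jo; rewrite /KM /julia_min; case: xgetP => // K' _ /none.
have [w Jw KMw] := KMc.
have KMconn : connected KM by rewrite KMw; exact: component_connected.
have KMJ : KM `<=` julia H by rewrite KMw; exact: connected_component_sub.
have KMout y : cabs (y - b) < s2 -> ~ KM (Some y).
  move=> ys KMy; have := @connected_annulus _ _ b s1 s2 s12 KMconn.
  case/(_ _ _ (Some zo) (jmin _ jo)).
  - by move=> z zs /KMJ; exact: julia_annulus.
  - by exists y.
  - by move=> z /= zs [zz]; rewrite zz in zs; lra.
pose K' := connected_component (julia H) (Some zi).
have K'in : K' `<=` Some @` [set y | cabs (y - b) <= s1].
  apply: (connected_annulus s12); first exact: component_connected.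
    by move=> y ys /connected_component_sub; exact: julia_annulus.
  by exists zi; split; [exact: connected_component_refl|exact: lt_trans s12].
pose D := connected_component (~` plane_part KM) b.
have bin (y : C) : cabs (y - b) < s2 -> D y.
  move=> ys; have sub : [set z | cabs (z - b) < s2] `<=` ~` plane_part KM.
    by move=> z /= zs; exact: KMout.
  have b0 : [set z | cabs (z - b) < s2] b by rewrite /= subrr cabs0 (lt_trans s10).
  exact: (connected_component_max b0 sub (@connected_disc _ b s2)).
have s20 : 0 < s2 by exact: lt_trans s12.
have Db : D b by apply: bin; rewrite subrr cabs0.
have KE : K' = KM.
  apply: KMm; first by exists (Some zi).
  right; exists D; split.
  - by exists b => //; apply: KMout; rewrite subrr cabs0.
  (* [D] is bounded because it lies in the filled set of [p]: no point of [D] is in J(p), so this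
     set is relatively open and closed in [D], and it contains [b]. *)
  - have cK := Khat_closed W1 (esc1 Lp) (ne1 p).
    suff DK : D `<=` Khat (semigroup_gen [set p]).
      apply/bounded_cabsP; exists (W + cabs b) => y /DK.
      move/(Khat_le W1 (esc1 Lp) (ne1 p)).
      by have := cabsB y b; lra.
    apply: (@connected_clopen _ D _ b) => //.
    + exact: component_connected.
    + by apply: (Khat1_sub Lp); apply: rK1; rewrite subrr cabs0 ltW.
    + move=> z Dz Kz; have /nbhs_cabsP[e e0 eK] : (Khat (semigroup_gen [set p]))° z.
        apply: fatou_Khat_interior => //; apply: contrapT => jz.
        by apply: (connected_component_sub Dz); exact: jmin.
      by exists e => // v ve _; exact: eK.
    + move=> z Dz nKz; have /open_cabsP oK := closed_openC cK.
      by have [e e0 eK] := oK z nKz; exists e => // v ve _; exact: eK.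
  - by move=> _ /K'in[y /= ys <-]; exists y => //; apply: bin; exact: le_lt_trans s12.
have : KM (Some zi) by rewrite -KE; exact: connected_component_refl.
by apply: KMout; exact: lt_trans s12.
Qed.

Lemma perturbation_conclusion :
  [/\ postcritically_bounded_dis H, Khat H = K & gen_min (Gam `|` V) `<=` Gam].
Proof.
split; [split|exact: Khat_perturbation|exact: gen_min_sub].
  exact: postcritically_bounded_perturbation.
exact: julia_disconnected.
Qed.

End Perturbation.

(** * Existence of the separating radii and of the compact neighbourhood *)

Section SeparationData.
Context {R : realType}.
Local Notation C := R[i].
Local Notation Chat := (sphere R).
Implicit Types (p q : {poly C}) (x y b c a : C) (Gam V : set {poly C}).

(** [W] is an escape radius for both families, [s1] and [s2] bound the annulus, and [V] maps the
    disc of radius [s2] into that of radius [r]. The factor 3 leaves a margin: orbits of points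
    within [2 * r] of [b] are studied, and their [r]-neighbourhoods must still lie in K. *)
Record separation Gam V b (W s1 s2 r : R) : Prop := Separation {
  sep_W1 : 1 <= W;
  sep_s12 : s1 < s2;
  sep_s2W : s2 <= W;
  sep_r0 : 0 < r;
  sep_s10 : 0 < s1;
  sep_V2 : V `<=` poly_ge2;
  sep_esc : escaping (Gam `|` V) b W;
  sep_bdd : loc_bounded (Gam `|` V) b;
  sep_hG : forall p, Gam p -> forall y, s1 <= cabs (y - b) -> W <= cabs (p.[y] - b);
  sep_hV : forall p, V p -> forall y, cabs (y - b) <= s2 -> cabs (p.[y] - b) <= r;
  sep_rK : forall y, cabs (y - b) <= 3 * r -> Khat (semigroup_gen Gam) y;
  sep_Ks2 : forall y, Khat (semigroup_gen Gam) y -> cabs (y - b) <= s2;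
  sep_critV : forall p c, V p -> root p^`() c -> cabs (p.[c] - b) <= r }.

Lemma separation_sub Gam V V' b W s1 s2 r : V' `<=` V ->
  separation Gam V b W s1 s2 r -> separation Gam V' b W s1 s2 r.
Proof.
move=> VV [W1 s12 s2W r0 s10 V2 esc bdd hG hV rK Ks2 critV]; split=> //.
- exact: subset_trans V2.
- by move=> p [Gp|/VV Vp]; apply: esc; [left|right].
- move=> t; have [M HM] := bdd t; exists M => p [Gp|/VV Vp]; apply: HM; [by left|by right].
- by move=> p /VV; exact: hV.
- by move=> p c /VV; exact: critV.
Qed.

Let g a b d : {poly C} := a *: ('X - b%:P) ^+ d + b%:P.

Lemma shift_model a b d : shiftp b (g a b d) = a *: 'X^d + b%:P.
Proof.
rewrite /shiftp /g comp_polyD comp_polyZ comp_polyC rmorphXn /= comp_polyB comp_polyX.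
by rewrite comp_polyC addrK.
Qed.

Lemma coef_shift_model a b d i : (0 < d)%N ->
  (a *: 'X^d + b%:P)`_i = a *+ (i == d) + b *+ (i == 0%N).
Proof.
by move=> d0; rewrite coefD coefZ coefXn coefC mulr_natr; case: (i == 0%N).
Qed.

(** The candidate for the compact neighbourhood of the model map; [e] will be a small multiple of
    |a|. *)
Let box a b d (e : R) := coef_box b d (a *: 'X^d + b%:P) e.

Section Box.
Context (a b : C) (d : nat) (e : R) (d2 : (2 <= d)%N).
Context (e0 : 0 < e) (ea : 4 * d.+1%:R * e <= cabs a).

Let d0 : (0 < d)%N. Proof. exact: ltnW d2. Qed.
Let ea' : 12 * e <= cabs a.
Proof.
apply: le_trans ea; rewrite ler_wpM2r ?(ltW e0)//.
have : (3 : R) <= d.+1%:R by rewrite ler_nat ltnS.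
lra.
Qed.

Lemma box_lead p : box a b d e p -> cabs a - e <= cabs (shiftp b p)`_d.
Proof.
move=> [_ /(_ d (leqnn d))]; rewrite coef_shift_model// eqxx gtn_eqF// mulr0n addr0.
by have := cabsB a (shiftp b p)`_d; rewrite (cabsC a); lra.
Qed.

Lemma box_lower_coef p i : box a b d e p -> (i < d)%N ->
  cabs (shiftp b (p - b%:P))`_i <= e.
Proof.
move=> [_ /(_ i)] H id; have := H (ltnW id); rewrite shiftpC coef_shift_model//.
by rewrite ltn_eqF// mulr0n add0r.
Qed.

Lemma box_coef p i : box a b d e p -> cabs (shiftp b (p - b%:P))`_i <= cabs a + e.
Proof.
move=> Bp; have [id|di|->] := ltngtP i d.
- by apply: le_trans (box_lower_coef Bp id) _; rewrite lerDr.
- rewrite nth_default ?cabs0 ?addr_ge0 ?(ltW e0)//.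
  rewrite size_shift (leq_trans (size_polyD _ _))// size_polyN geq_max.
  by rewrite (leq_trans (Bp.1))//= (leq_trans (size_polyC_leq1 _))// (leq_ltn_trans _ di).
- case: Bp => _ /(_ d (leqnn d)); rewrite shiftpC coef_shift_model// eqxx gtn_eqF// !mulr0n addr0 subr0.
  by have := cabsB (shiftp b p)`_d a; lra.
Qed.

Lemma box_size p : box a b d e p -> size p = d.+1.
Proof.
move=> Bp; apply/eqP; rewrite eqn_leq Bp.1 ltnNge; apply/negP => le.
have := box_lead Bp; rewrite nth_default ?cabs0 ?size_shift//.
by have := ea'; have := e0; lra.
Qed.

Lemma box_sizeB p : box a b d e p -> (size (shiftp b (p - b%:P)) <= d.+1)%N.
Proof.
move=> Bp; rewrite size_shift (leq_trans (size_polyD _ _))// size_polyN geq_max.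
by rewrite Bp.1 (leq_trans (size_polyC_leq1 _)).
Qed.

Lemma box_ge2 : box a b d e `<=` poly_ge2.
Proof. by move=> p /box_size sp; rewrite /poly_ge2 /= /pdeg sp. Qed.

Lemma box_nbhs : compact_nbhs_ge2 (g a b d) (box a b d e).
Proof.
have mB : box a b d e (g a b d).
  split; last by move=> i _; rewrite shift_model subrr cabs0 ltW.
  rewrite -(size_shift b) shift_model (leq_trans (size_polyD _ _))// geq_max.
  rewrite (leq_trans (size_scale_leq _ _)) ?size_polyXn//=.
  by rewrite (leq_trans (size_polyC_leq1 _)).
split; first exact: box_ge2.
  apply: coef_box_compact => //; rewrite coef_shift_model// eqxx gtn_eqF// mulr0n addr0.
  by have := ea'; have := e0; lra.
have sg : (2 <= size (g a b d))%N by rewrite (box_size mB).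
have [h h0 Hh] := polymap_near b sg e0.
apply/nbhs_polyunifP; exists h => // p /Hh[sp cp] _; split; first by rewrite sp (box_size mB).
by move=> i _; rewrite -shift_model.
Qed.

Lemma box_lower p y : box a b d e p -> 1 <= cabs (y - b) ->
  3 / 8 * cabs a * cabs (y - b) ^+ d <= cabs (p.[y] - b).
Proof.
move=> Bp y1; have -> : p.[y] - b = (shiftp b (p - b%:P)).[y - b].
  by rewrite horner_shift subrK !hornerE.
have e0' := e0; have ea1 := ea'.
apply: (@le_trans _ _ ((cabs a - e) / 2 * cabs (y - b) ^+ d)).
  by rewrite ler_wpM2r ?exprn_ge0//; lra.
apply: (horner_lower (B := e)) => //.
- exact: box_sizeB.
- lra.
- exact: ltW.
- by move=> i; exact: box_lower_coef.
- by rewrite shiftpC gtn_eqF// mulr0n subr0; exact: box_lead.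
- have h1 := ea; apply: (@le_trans _ _ ((cabs a - e) * 1)); last by rewrite ler_wpM2l//; lra.
  by move: h1; rewrite -natr1; have : 0 <= (d%:R : R) by []; nra.
Qed.

Lemma box_upper p y (t : R) : box a b d e p -> 1 <= t -> cabs (y - b) <= t ->
  cabs (p.[y] - b) <= d.+1%:R * (5 / 4 * cabs a) * t ^+ d.
Proof.
move=> Bp t1 yt; have -> : p.[y] - b = (shiftp b (p - b%:P)).[y - b].
  by rewrite horner_shift subrK !hornerE.
apply: horner_upper => // [|i]; first exact: box_sizeB.
by apply: le_trans (box_coef i Bp) _; have := ea'; have := e0; lra.
Qed.

(** The model has [b] as its only finite critical point. In the box the leading coefficient of the
    derivative, about d a, outweighs the others, of size at most d e, as soon as |c - b| >= 1. *)
Lemma box_critical p c : box a b d e p -> root p^`() c -> cabs (c - b) < 1.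
Proof.
move=> Bp rc; rewrite ltNge; apply/negP => c1.
pose q := (shiftp b (p - b%:P))^`().
have qc : q.[c - b] = 0.
  rewrite /q /shiftp deriv_comp derivB derivC subr0 derivD derivX derivC addr0 mulr1.
  by rewrite horner_comp hornerD hornerX hornerC subrK; exact/eqP.
have e0' := e0; have ea1 := ea'.
have dp : (0 : R) < d%:R by rewrite ltr0n.
have : d%:R * (cabs a - e) / 2 * cabs (c - b) ^+ d.-1 <= cabs q.[c - b].
  apply: (horner_lower (B := d%:R * e)) => //.
  - rewrite prednK// /q; have := lt_size_deriv (p := shiftp b (p - b%:P)).
    have [->|n0 /(_ isT)] := eqVneq (shiftp b (p - b%:P)) 0; first by rewrite deriv0 size_poly0.
    by move=> lt; rewrite -ltnS (leq_trans lt)// box_sizeB.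
  - by rewrite mulr_ge0//; lra.
  - by rewrite mulr_ge0// ltW.
  - move=> i id; rewrite coef_deriv -[X in cabs X]mulr_natl cabsM cabs_nat ler_pM//.
      by rewrite ler_nat (leq_trans id)// leq_pred.
    by apply: box_lower_coef => //; rewrite -[d]prednK.
  - rewrite coef_deriv prednK// -[X in _ <= cabs X]mulr_natl cabsM cabs_nat ler_wpM2l//.
    by rewrite shiftpC gtn_eqF// mulr0n subr0; exact: box_lead.
  - have h1 := ea; rewrite -natr1 in h1.
    have h2 : (d.-1%:R : R) * e <= d%:R * e by rewrite ler_wpM2r ?(ltW e0)// ler_nat leq_pred.
    have h3 : 0 <= (d%:R : R) * e by rewrite mulr_ge0// ltW.
    have -> : 2 * d.-1%:R * (d%:R * e) = d%:R * (2 * (d.-1%:R * e)) by ring.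
    rewrite -mulrA ler_wpM2l//; apply: (@le_trans _ _ ((cabs a - e) * 1)).
      by rewrite mulr1; lra.
    by rewrite ler_wpM2l//; lra.
rewrite qc cabs0; apply/negP; rewrite -ltNge !mulr_gt0// ?invr_gt0 ?exprn_gt0//; lra.
Qed.

End Box.
End SeparationData.

Section SeparationExists.
Context {R : realType}.
Local Notation C := R[i].
Implicit Types (p q : {poly C}) (x y b c a : C) (Gam V : set {poly C}).

Lemma nth_root_exists n (x : R) : (0 < n)%N -> 0 < x -> exists2 t : R, 0 < t & t ^+ n = x.
Proof.
move=> n0 x0; exists (x `^ n%:R^-1); first exact: powR_gt0.
by rewrite -powR_mulrn ?powR_ge0// -powRrM mulVf ?powRr1 ?ltW// pnatr_eq0 -lt0n.
Qed.

(* With [tau ^ (d (d - 1)) = 1 / |a|], the filled Julia set of the perturbation has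
   radius of order [tau ^ d], its preimage under a generator of degree at least [n] has
   radius of order [tau ^ (d / n)], and the perturbation maps the disc of radius
   [sig * tau ^ (d - 1)] into the small disc; [(d - 1) n > d] separates the last two. *)
Lemma separation_exists Gam b d :
  Gam !=set0 -> Gam `<=` poly_ge2 -> poly_compact Gam ->
  (Khat (semigroup_gen Gam))° b -> (2 <= d)%N ->
  (forall h, Gam h -> (d, pdeg h) <> (2%N, 2%N)) ->
  exists2 c : R, 0 < c & forall a, 0 < cabs a < c ->
    exists W s1 s2 r, exists2 V,
      compact_nbhs_ge2 (a *: ('X - b%:P) ^+ d + b%:P) V & separation Gam V b W s1 s2 r.
Proof.
move=> G0 G2 cG /nbhs_cabsP[e0 e00 eK] d2 Gd.
(* A lower bound for the degrees in [Gam]. Excluding [(2, 2)] allows 3 when [d = 2], as [dn]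
   requires. *)
pose n := if d == 2%N then 3%N else 2%N.
have n2 : (2 <= n)%N by rewrite /n; case: ifP.
have n3 : (n <= 3)%N by rewrite /n; case: ifP.
have dn : (d.+1 <= d.-1 * n)%N.
  by rewrite /n; case: eqP => [->//|]; case: d d2 {Gd n n2 n3} => [|[|[|k]]]//= _ _; rewrite muln2 !doubleS !ltnS -addnn leq_addr.
have Gn h : Gam h -> (n < size h)%N.
  move=> Gh; have := G2 _ Gh; have := Gd _ Gh; rewrite /poly_ge2 /= /pdeg /n.
  by case: eqP => [->|_] h1; case: (size h) h1 => [|[|[|[|k]]]].
have Gs h : Gam h -> (2 <= size h)%N by move=> /Gn; apply: leq_ltn_trans; exact: ltnW.
have [M [M1 HM]] := compact_growth b cG (ltnW n2) Gn.
have M0 : 0 < M by exact: lt_le_trans M1.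
have growth2 h y : Gam h -> 2 * M <= cabs (y - b) -> 2 * cabs (y - b) <= cabs (h.[y] - b).
  move=> Gh yM; have y1 : 1 <= cabs (y - b) by lra.
  apply: (le_trans _ (HM _ Gh y _)); last by lra.
  rewrite [leRHS]mulrC ler_pdivlMr//; apply: (@le_trans _ _ (cabs (y - b) ^+ 2)).
    by rewrite expr2 -mulrA mulrCA ler_wpM2l.
  by rewrite ler_weXn2l.
have escG : escaping Gam b (2 * M) by move=> h Gh y; exact: growth2.
pose r := e0 / 6; have r0 : 0 < r by rewrite divr_gt0.
(* Chosen so that the upper bound [d.+1%:R * (5 / 4) * sig] for the image of the disc of radius [s2]
   is at most [r]. *)
pose sig := Num.min 1 (r / (2 * d.+1%:R)).
have dp : (0 : R) < d.+1%:R by rewrite ltr0n.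
have sig0 : 0 < sig by rewrite lt_min ltr01 divr_gt0// mulr_gt0.
have sig1 : sig <= 1 by rewrite ge_min lexx.
have sigr : sig * (2 * d.+1%:R) <= r by rewrite -ler_pdivlMr ?mulr_gt0// ge_min lexx orbT.
(* The summand [2 * M / sig] makes [s2] at least [2 * M], so that the disc of radius [s2] contains
   K. The last one makes [M^-1 * s1 ^+ n] at least [W]; the exponent 3 serves both values of [n],
   since [sig / 2 <= 1]. *)
pose T := 1 + 2 * M / sig + 8 * M * (2 / sig) ^+ 3.
have T1 : 1 <= 1 + 2 * M / sig by rewrite lerDl divr_ge0// ?mulr_ge0// ltW.
have q0 : 0 <= 8 * M * (2 / sig) ^+ 3.
  by rewrite mulr_ge0 ?exprn_ge0 ?divr_ge0 ?mulr_ge0// ltW.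
have T2 : 1 <= T by apply: le_trans T1 _; rewrite lerDl.
have T3 : 2 * M / sig <= T by rewrite /T addrAC lerDr addr_ge0.
have T4 : 8 * M * (2 / sig) ^+ 3 <= T by rewrite lerDr (le_trans _ T1).
have Tp : 0 < T by exact: lt_le_trans T2.
pose N := (d.-1 * d)%N.
have d1 : (0 < d.-1)%N by rewrite -ltnS prednK// ltnW.
have N0 : (0 < N)%N by rewrite muln_gt0 d1 ltnW.
exists (T ^+ N)^-1; first by rewrite invr_gt0 exprn_gt0.
move=> a /andP[a0 aT]; set al := cabs a in a0 aT.
have [tau tau0 tauN] := nth_root_exists N0 (ltac:(by rewrite invr_gt0) : 0 < al^-1).
have Ttau : T <= tau.
  rewrite -(ler_pXn2r N0) ?nnegrE ?(ltW Tp) ?(ltW tau0)// tauN.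
  by rewrite -[leLHS]invrK lef_pV2 ?posrE ?invr_gt0 ?exprn_gt0// ltW.
have tau1 : 1 <= tau by exact: le_trans Ttau.
(* Since [al * tau ^+ N = 1], this [s2] satisfies [al * s2 ^+ d = sig ^+ d], and the factor 8 in [W]
   gives the perturbation an expansion of at least [3 / 8 * 8 ^+ d.-1 >= 3] beyond [W], where 2 is
   required. *)
pose s2 := sig * tau ^+ d.-1; pose s1 := s2 / 2; pose W := 8 * tau ^+ d.
have tau_le : tau <= tau ^+ d.-1 by rewrite -[leLHS]expr1 ler_weXn2l.
have s2M : 2 * M <= s2.
  apply: (@le_trans _ _ (sig * tau)); last by rewrite ler_wpM2l// ltW.
  by rewrite -ler_pdivrMl// [leLHS]mulrC; exact: le_trans T3 Ttau.
have s20 : 0 < s2 by rewrite mulr_gt0// exprn_gt0.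
have s21 : 1 <= s2 by lra.
have tdW : tau ^+ d.-1 <= tau ^+ d by rewrite ler_weXn2l// leq_pred.
have td1 : 1 <= tau ^+ d by rewrite exprn_ege1.
have s2W : s2 <= W.
  apply: (@le_trans _ _ (1 * tau ^+ d)); last by rewrite mul1r /W; move: (tau ^+ d) td1 => E; lra.
  by rewrite ler_pM// ?exprn_ge0// ltW.
have W1 : 1 <= W by exact: le_trans s2W.
pose e := al / (4 * d.+1%:R).
have e_gt0 : 0 < e by rewrite divr_gt0// mulr_gt0.
have ea : 4 * d.+1%:R * e <= cabs a by rewrite /e mulrC divfK// gt_eqF// mulr_gt0.
have tauE : tau ^+ d.-1 ^+ d = al^-1 by rewrite -exprM.
have s2d : al * s2 ^+ d <= sig.
  rewrite /s2 exprMn tauE mulrCA mulfV ?gt_eqF// mulr1.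
  by rewrite -[leRHS]expr1 ler_wiXn2l// ?ltW// ltnW.
have hV p y : coef_box b d (a *: 'X^d + b%:P) e p -> cabs (y - b) <= s2 ->
    cabs (p.[y] - b) <= r.
  move=> Vp ys; apply: le_trans (box_upper d2 e_gt0 ea Vp s21 ys) _; rewrite -/al.
  have -> : d.+1%:R * (5 / 4 * al) * s2 ^+ d = d.+1%:R * (5 / 4) * (al * s2 ^+ d) by ring.
  apply: (@le_trans _ _ (d.+1%:R * (5 / 4) * sig)).
    by rewrite ler_wpM2l// mulr_ge0// ltW.
  by apply: le_trans sigr; have : 0 <= d.+1%:R * sig by [rewrite mulr_ge0// ltW|]; nra.
have WM : 2 * M <= W by exact: le_trans s2W.
exists W, s1, s2, r, (coef_box b d (a *: 'X^d + b%:P) e).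
  exact: (box_nbhs b d2 e_gt0 ea).
split=> //.
- by rewrite /s1; lra.
- by rewrite divr_gt0.
- exact: box_ge2 d2 e_gt0 ea.
- move=> p [Gp|Vp] y yW; first by apply: growth2 => //; exact: le_trans yW.
  have y1 : 1 <= cabs (y - b) by exact: le_trans yW.
  apply: (le_trans _ (box_lower d2 e_gt0 ea Vp y1)); rewrite -/al.
  have yd : cabs (y - b) ^+ d = cabs (y - b) * cabs (y - b) ^+ d.-1.
    by rewrite -exprS prednK// ltnW.
  rewrite yd [leRHS]mulrCA [leLHS]mulrC ler_wpM2l//.
  apply: (@le_trans _ _ (3 / 8 * al * W ^+ d.-1)); last first.
    by rewrite ler_wpM2l ?mulr_ge0 ?divr_ge0 ?(ltW a0)// lerXn2r ?nnegrE// ltW// (lt_le_trans _ W1).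
  rewrite /W exprMn -exprM mulnC tauN.
  have -> : 3 / 8 * al * (8 ^+ d.-1 * al^-1) = 3 / 8 * 8 ^+ d.-1 :> R.
    by rewrite mulrACA divff ?gt_eqF// mulr1.
  have : (8 : R) <= 8 ^+ d.-1 by rewrite -[leLHS]expr1 ler_weXn2l// ler1n.
  by move: (8 ^+ d.-1 : R) => E; lra.
- move=> t; have [M1' [M10 H1]] := compact_bounded_on_disc b t cG Gs.
  exists (Num.max (M1' + cabs b) (d.+1%:R * (5 / 4 * al) * (Num.max 1 t) ^+ d)).
  move=> p [Gp|Vp] y yt; rewrite le_max.
    apply/orP; left; have := H1 _ Gp _ yt; have := cabsD p.[y] (- b); rewrite cabsN; lra.
  apply/orP; right; apply: (box_upper d2 e_gt0 ea Vp); first by rewrite le_max lexx.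
  by rewrite le_max yt orbT.
- move=> p Gp y ys.
  have s1M : M <= s1 by rewrite /s1; lra.
  apply: (le_trans _ (HM _ Gp y (le_trans s1M ys))).
  apply: (@le_trans _ _ (M^-1 * s1 ^+ n)); last first.
    rewrite ler_wpM2l ?invr_ge0 ?(ltW M0)// lerXn2r ?nnegrE// (le_trans _ s1M)//.
    exact: ltW.
  rewrite [leRHS]mulrC ler_pdivlMr// /s1 /s2 /W.
  have -> : sig * tau ^+ d.-1 / 2 = (sig / 2) * tau ^+ d.-1 by rewrite mulrAC.
  rewrite exprMn -exprM.
  apply: (@le_trans _ _ ((sig / 2) ^+ 3 * tau ^+ d.+1)); last first.
    apply: ler_pM; rewrite ?exprn_ge0 ?divr_ge0 ?(ltW sig0) ?(ltW tau0)//.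
      by rewrite ler_wiXn2l ?divr_ge0 ?(ltW sig0)//; lra.
    by rewrite ler_weXn2l.
  rewrite [tau ^+ d.+1]exprS [leRHS]mulrA [leLHS]mulrAC ler_wpM2r ?exprn_ge0 ?(ltW tau0)//.
  have s3 : 0 < (sig / 2) ^+ 3 by rewrite exprn_gt0// divr_gt0.
  rewrite -ler_pdivrMl// -exprVn invf_div [leLHS]mulrC.
  exact: le_trans T4 Ttau.
- by move=> p Vp y; exact: hV.
- by move=> y yr; apply: eK; move: yr; rewrite /r; lra.
- by move=> y Ky; apply: le_trans s2M; apply: (Khat_le _ escG G0 Ky); lra.
- move=> p c Vp /(box_critical d2 e_gt0 ea Vp) c1; apply: (hV _ _ Vp).
  by apply: le_trans s21; exact: ltW.
Qed.

End SeparationExists.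

(** * Valence on components of preimages *)

(** The valence of [p] over [y] on [U] is [nrt (p - y%:P) U], since [roots_of] repeats roots
    according to multiplicity. *)
Definition nrt {R : realType} (p : {poly R[i]}) (U : set R[i]) : nat :=
  count (fun z => `[< U z >]) (roots_of p).

Section RootCount.
Context {R : realType}.
Local Notation C := R[i].
Local Notation Chat := (sphere R).
Implicit Types (p q : {poly C}) (x y w : C) (U Z : set C).

Lemma roots_of_perm p k (s : seq C) : k != 0 ->
  p = k *: \prod_(z <- s) ('X - z%:P) -> perm_eq (roots_of p) s.
Proof.
move=> k0 pE; have p0 : p != 0.
  by rewrite pE scaler_eq0 (negbTE k0) /= monic_neq0// monic_prod_XsubC.
have muE (c : C) (t : seq C) z : c != 0 ->
    mup z (c *: \prod_(x <- t) ('X - x%:P)) = count_mem z t.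
  move=> c0; rewrite -mul_polyC mupMr ?mu_prod_XsubC//.
  by rewrite /root hornerC.
apply/allP => z _ /=; apply/eqP.
by rewrite -(muE k s)// -pE [in RHS](roots_ofE p) muE// lead_coef_eq0.
Qed.

Lemma mup_roots_of p z : p != 0 -> mup z p = count_mem z (roots_of p).
Proof.
move=> p0; rewrite [in LHS](roots_ofE p) -mul_polyC mupMr ?mu_prod_XsubC//.
by rewrite /root hornerC lead_coef_eq0.
Qed.

Lemma nrt_sub p U Z : U `<=` Z -> (nrt p U <= nrt p Z)%N.
Proof. by move=> UZ; apply: sub_count => z /asboolP Uz; exact/asboolP/UZ. Qed.

Lemma nrt_mul p q U : p != 0 -> q != 0 -> nrt (p * q) U = (nrt p U + nrt q U)%N.
Proof.
move=> p0 q0; rewrite /nrt.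
have /permP -> : perm_eq (roots_of (p * q)) (roots_of p ++ roots_of q).
  apply: (@roots_of_perm _ (lead_coef p * lead_coef q)).
    by rewrite mulf_neq0 ?lead_coef_eq0.
  by rewrite big_cat /= [in LHS](roots_ofE p) [in LHS](roots_ofE q) -scalerAl -scalerAr scalerA.
exact: count_cat.
Qed.

Lemma nrt_prod (s : seq C) (F : C -> {poly C}) U : (forall z, F z != 0) ->
  nrt (\prod_(z <- s) F z) U = (\sum_(z <- s) nrt (F z) U)%N.
Proof.
move=> F0; elim: s => [|z s IH]; last first.
  by rewrite !big_cons nrt_mul ?IH//; elim/big_ind : _ => // *; rewrite ?oner_neq0// mulf_neq0.
rewrite !big_nil /nrt; have := size_roots_of (oner_neq0 {poly C}).
by rewrite size_poly1 /= => /size0nil ->.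
Qed.

Lemma nrt_scale (k : C) p U : k != 0 -> p != 0 -> nrt (k *: p) U = nrt p U.
Proof.
move=> k0 p0; rewrite /nrt.
have /permP -> // : perm_eq (roots_of (k *: p)) (roots_of p).
apply: (@roots_of_perm _ (k * lead_coef p)); first by rewrite mulf_neq0 ?lead_coef_eq0.
by rewrite [in LHS](roots_ofE p) scalerA.
Qed.

Lemma polyB_neq0 p y : (0 < pdeg p)%N -> p - y%:P != 0.
Proof.
move=> p0; rewrite subr_eq0; apply: contraTN p0 => /eqP ->.
by rewrite /pdeg; case: (size _) (size_polyC_leq1 y) => [|[]].
Qed.

Lemma pdegB p y : (0 < pdeg p)%N -> pdeg (p - y%:P) = pdeg p.
Proof.
move=> p0; rewrite /pdeg size_polyDl// size_polyN (leq_ltn_trans (size_polyC_leq1 _))//.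
by move: p0; rewrite /pdeg; case: (size p) => [|[]].
Qed.

(** Translates the sum in [covering_degree] into a root count: the local degree at [z] is the
    multiplicity of [z] as a root of [p - y%:P], and infinity, fixed by a nonconstant polynomial,
    does not lie over [Some y]. *)
Lemma local_degree_sum p (V : set Chat) y : (0 < pdeg p)%N ->
  \big[addn/0%N]_(z \in V `&` polymap p @^-1` [set Some y]) local_degree p z =
  nrt (p - y%:P) (plane_part V).
Proof.
move=> p0; pose rs := roots_of (p - y%:P); have q0 := polyB_neq0 y p0.
have rE z : (z \in rs) = (p.[z] == y).
  by rewrite /rs mem_roots_of// /root !hornerE subr_eq0.
pose t := [seq z <- rs | `[< plane_part V z >]].
rewrite (@fsbigE _ _ _ _ _ (map Some (undup t))); last 3 first.
- by rewrite map_inj_uniq ?undup_uniq// => ? ? [].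
- move=> z /= /mapP[x]; rewrite mem_undup mem_filter rE => /andP[/asboolP Vx /eqP xy] ->.
  by split => //=; rewrite xy.
- move=> [z|] [Vz /= pz]; last by move: pz; case: (pdeg p) p0.
  case: pz => pz /negP[]; apply/mapP; exists z => //.
  by rewrite mem_undup mem_filter rE pz eqxx andbT; exact/asboolP.
rewrite big_map big_seq_cond (eq_bigl (fun z => z \in undup t)); last first.
  move=> z; rewrite mem_undup; case: (boolP (z \in t)) => //=.
  rewrite mem_filter rE => /andP[/asboolP Vz /eqP pz]; apply/mem_set; split => //=.
  by rewrite pz.
rewrite -big_seq /nrt -/rs -size_filter -/t -sum1_size -(big_undup_iterop_count addn t xpredT (fun=> 1%N)) /=.
rewrite big_seq [RHS]big_seq; apply: eq_bigr => z; rewrite mem_undup mem_filter rE.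
move=> /andP[/asboolP Vz /eqP pz]; rewrite /local_degree pz mup_roots_of// -/rs.
have -> : count_mem z t = count_mem z rs.
  rewrite count_filter; apply: eq_count => x /=; case: eqP => //= ->.
  by apply/asboolP.
by case: (count_mem z rs) => [//|n]; rewrite iteropS; elim: n => //= n <-.
Qed.

Lemma roots_bounded p y0 : (0 < pdeg p)%N -> exists2 r : R, 0 < r &
  forall y, cabs (y - y0) <= 1 -> forall x, p.[x] = y -> cabs (x - 0) <= r.
Proof.
move=> p0; have sp : (2 <= size p)%N by move: p0; rewrite /pdeg; case: (size p) => [|[]].
have [r r1 H] := growth_single 0 (cabs y0 + 2) sp.
exists r => [|y yy x px]; first exact: lt_le_trans r1.
rewrite leNgt; apply/negP => /ltW/H; rewrite px.
by have := cabsB y y0; lra.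
Qed.

Lemma poly_eq_horner p q : (forall x, p.[x] = q.[x]) -> p = q.
Proof.
move=> H; apply/eqP; rewrite -subr_eq0; apply: contraT => d0.
pose s := [seq (k%:R : C) | k <- iota 0 (size (p - q))].
have : (size s < size (p - q)%R)%N.
  apply: max_poly_roots => //; first by apply/allP => x _; rewrite /root !hornerE H subrr.
  by rewrite map_inj_uniq ?iota_uniq// => i j /eqP; rewrite eqr_nat => /eqP.
by rewrite size_map size_iota ltnn.
Qed.

Lemma sub_in_count (T : eqType) (a1 a2 : pred T) (s : seq T) :
  (forall x : T, x \in s -> a1 x -> a2 x) -> (count a1 s <= count a2 s)%N.
Proof.
elim: s => //= z s IH H; apply: leq_add.
  by case: (a1 z) (H z (mem_head _ _)) => // ->.
by apply: IH => y ys; apply: H; rewrite inE ys orbT.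
Qed.

(* Otherwise the roots of [p - y_k], for some [y_k --> y0], converge along an
   ultrafilter to an enumeration of the roots of [p - y0]. *)
Lemma nrt_usc p y0 Z : (0 < pdeg p)%N ->
  (forall x, p.[x] = y0 -> ~ Z x -> exists2 e : R, 0 < e &
     forall x', cabs (x' - x) < e -> ~ Z x') ->
  exists2 e : R, 0 < e & forall y, cabs (y - y0) < e ->
    (nrt (p - y%:P) Z <= nrt (p - y0%:P) Z)%N.
Proof.
move=> p0 HZ; apply: contrapT => nex.
have /choice[yk ykP] : forall k : nat, exists y, cabs (y - y0) < k.+1%:R^-1 /\
    (nrt (p - y0%:P) Z < nrt (p - y%:P) Z)%N.
  move=> k; apply: contrapT => nk; apply: nex; exists k.+1%:R^-1.
    by rewrite invr_gt0 ltr0n.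
  by move=> y yk; rewrite leqNgt; apply/negP => lt; apply: nk; exists y.
have [F [FU oF]] := @ultraFilterLemma nat \oo eventually_filter.
have FP : ProperFilter F by exact: ultra_proper.
have [r r0 Hr] := roots_bounded y0 p0.
pose n := pdeg p.
have srs y : size (roots_of (p - y%:P)) = n.
  by rewrite size_roots_of ?polyB_neq0// -/(pdeg (p - y%:P)) pdegB.
pose rt i k := nth 0 (roots_of (p - (yk k)%:P)) i.
have rtr i k : (i < n)%N -> p.[rt i k] = yk k.
  move=> i_n; have := mem_nth 0 (s := roots_of (p - (yk k)%:P)) (n := i).
  rewrite srs i_n => /(_ isT); rewrite mem_roots_of ?polyB_neq0// /root !hornerE subr_eq0.
  by move/eqP.
have y1 k : cabs (yk k - y0) <= 1.
  by apply: le_trans (ltW (ykP k).1) _; rewrite invf_le1 ?ltr0n// ler1n.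
have /choice[zeta cvz] : forall i : nat, exists z : C, (i < n)%N ->
    forall e : R, 0 < e -> F [set k | cabs (rt i k - z) < e].
  move=> i; have [i_n|_] := ltnP i n; last by exists 0.
  have := @disc_compact R 0 r; rewrite compact_ultra => /(_ _ (ultra_fmap (rt i) FU)).
  case.
    change (F [set k | cabs (rt i k - 0) <= r]); apply: (@filterS _ F _ setT); last exact: filterT.
    by move=> k _; exact: (Hr _ (y1 k) _ (rtr i k i_n)).
  by move=> z [_ cz]; exists z => _ e e0; exact: (cz _ (near_cabs z e0)).
pose zs := [seq zeta i | i <- iota 0 n].
have cvy (e : R) : 0 < e -> F [set k | cabs (yk k - y0) < e].
  move=> e0; apply: oF; have nk : \forall k \near \oo, k.+1%:R^-1 < e.
    exact: near_infty_natSinv_lt (PosNum e0).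
  by apply: filterS nk => k; apply: lt_trans (ykP k).1.
have pE : p - y0%:P = lead_coef p *: \prod_(z <- zs) ('X - z%:P).
  apply: poly_eq_horner => x; rewrite hornerZ horner_prod.
  pose f k := \prod_(i <- iota 0 n) (x - rt i k).
  have cvf (s : seq nat) (e : R) : {subset s <= iota 0 n} -> 0 < e ->
      F [set k | cabs (\prod_(i <- s) (x - rt i k) - \prod_(i <- s) (x - zeta i)) < e].
    elim: s e => [|i s IH] e sub e0.
      by apply: filterS filterT => k _ /=; rewrite !big_nil subrr cabs0.
    set P := \prod_(j <- s) (x - zeta j); pose a := x - zeta i.
    have i_n : (i < n)%N by have := sub i (mem_head _ _); rewrite mem_iota.
    pose d := Num.min 1 (e / (1 + cabs a + cabs P + 1)).
    have k0 : 0 < 1 + cabs a + cabs P + 1 by have := cabs_ge0 a; have := cabs_ge0 P; lra.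
    have d0 : 0 < d by rewrite lt_min ltr01 divr_gt0.
    have d1 : d <= 1 by rewrite ge_min lexx.
    have de : d * (1 + cabs a + cabs P + 1) <= e by rewrite -ler_pdivlMr// ge_min lexx orbT.
    have sub' : {subset s <= iota 0 n} by move=> j js; apply: sub; rewrite inE js orbT.
    have h1 := IH d sub' d0; have h2 := cvz i i_n d d0.
    apply: filterS (filterI h1 h2) => k [/= k1 k2]; rewrite !big_cons -/P -/a.
    set Q := \prod_(j <- s) (x - rt j k) in k1 *.
    have -> : (x - rt i k) * Q - a * P =
        a * (Q - P) - (rt i k - zeta i) * P - (rt i k - zeta i) * (Q - P).
      by rewrite /a; ring.
    apply: le_lt_trans (cabsD _ _) _; rewrite cabsN; apply: le_lt_trans (lerD (cabsD _ _) (lexx _)) _.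
    rewrite cabsN !cabsM; have := cabs_ge0 a; have := cabs_ge0 P.
    have := cabs_ge0 (Q - P); have := cabs_ge0 (rt i k - zeta i).
    move: (cabs a) (cabs P) (cabs (Q - P)) (cabs (rt i k - zeta i)) k1 k2 de => A B u v.
    by move=> ud vd de v0 u0 B0 A0; clear - ud vd de v0 u0 B0 A0 d1 d0; nra.
  have lE k : p.[x] - yk k = lead_coef p * f k.
    have -> : p.[x] - yk k = (p - (yk k)%:P).[x] by rewrite !hornerE.
    have -> : lead_coef p = lead_coef (p - (yk k)%:P).
      rewrite lead_coefDl// size_polyN (leq_ltn_trans (size_polyC_leq1 _))//.
      by move: p0; rewrite /pdeg; case: (size p) => [|[]].
    rewrite horner_roots (big_nth 0) srs /f /rt; congr (_ * _).
    by rewrite /index_iota subn0.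
  have -> : \prod_(z <- zs) ('X - z%:P).[x] = \prod_(i <- iota 0 n) (x - zeta i).
    by rewrite /zs big_map; apply: eq_bigr => i _; rewrite !hornerE.
  set P := \prod_(i <- iota 0 n) (x - zeta i).
  rewrite !hornerE; apply/eqP; rewrite -subr_eq0 -cabs_eq0 eq_le cabs_ge0 andbT.
  apply/ler_addgt0Pr => e e0; rewrite add0r.
  have e2 : 0 < e / 2 by rewrite divr_gt0.
  pose L := cabs (lead_coef p) + 1; have L0 : 0 < L by rewrite ltr_wpDl.
  have h1 := cvf _ (e / 2 / L) (fun i h => h) (divr_gt0 e2 L0); have h2 := cvy _ e2.
  have [k [/= k1 k2]] := filter_ex (filterI h1 h2).
  have -> : p.[x] - y0 - lead_coef p * P = (yk k - y0) + lead_coef p * (f k - P).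
    by rewrite mulrBr -lE; ring.
  apply: le_trans (cabsD _ _) _; rewrite cabsM.
  have : cabs (lead_coef p) * cabs (f k - P) <= e / 2.
    apply: (@le_trans _ _ (L * (e / 2 / L))); last by rewrite mulrC divfK// gt_eqF.
    by apply: ler_pM => //; [rewrite lerDl|exact: ltW].
  by move: k2; lra.
have lc0 : lead_coef p != 0.
  by rewrite lead_coef_eq0 -size_poly_eq0; move: p0; rewrite /pdeg; case: (size p).
have /permP pz := roots_of_perm lc0 pE.
have zr i : (i < n)%N -> p.[zeta i] = y0.
  move=> i_n; have : root (p - y0%:P) (zeta i).
    rewrite pE rootZ// root_prod_XsubC; apply/mapP; exists i => //.
    by rewrite mem_iota.
  by rewrite /root !hornerE subr_eq0 => /eqP.
(* Where a limit root lies outside [Z], the approximating roots do so for almost all [k] along [F];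
   hence the count cannot drop at the limit. *)
have near_out (s : seq nat) : {subset s <= iota 0 n} ->
    F [set k | forall i, i \in s -> ~ Z (zeta i) -> ~ Z (rt i k)].
  elim: s => [|i s IH] sub; first by apply: filterS filterT.
  have i_n : (i < n)%N by have := sub i (mem_head _ _); rewrite mem_iota.
  have sub' : {subset s <= iota 0 n} by move=> j js; apply: sub; rewrite inE js orbT.
  have h : F [set k | ~ Z (zeta i) -> ~ Z (rt i k)].
    have [Zi|nZi] := pselect (Z (zeta i)); first by apply: filterS filterT => k _ /(_ Zi).
    have [e e0 He] := HZ _ (zr _ i_n) nZi.
    by apply: filterS (cvz i i_n e e0) => k /= ke _; exact: He.
  by apply: filterS (filterI h (IH sub')) => k [/= k1 k2] j; rewrite inE => /orP[/eqP ->//|]; exact: k2.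
have [k Hk] := filter_ex (near_out (iota 0 n) (fun i h => h)).
have := (ykP k).2; apply/negP; rewrite -leqNgt /nrt pz.
have -> : roots_of (p - (yk k)%:P) = [seq rt i k | i <- iota 0 n].
  by rewrite -(srs (yk k)) -[LHS](mkseq_nth 0).
rewrite /zs !count_map; apply: sub_in_count => i i_n /= /asboolP Zr; apply/asboolP.
by apply: contrapT => /(Hk i i_n).
Qed.

Lemma horner_component_open p (B : set C) : open B -> open [set x | B p.[x]].
Proof.
move=> /open_cabsP oB; apply/open_cabsP => x /= /oB[e e0 eB].
by have [d d0 Hd] := horner_continuous p x e0; exists d => // y /Hd; exact: eB.
Qed.

(** A component is relatively open and closed in the preimage, so [nrt_usc] applies to it and to its
    complement there. The two counts add up to the degree, so both are locally constant, and [B] is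
    connected. *)
Lemma nrt_component p (B : set C) x : (0 < pdeg p)%N -> open B -> connected B ->
  forall y y', B y -> B y' ->
  nrt (p - y%:P) (connected_component [set x | B p.[x]] x) =
  nrt (p - y'%:P) (connected_component [set x | B p.[x]] x).
Proof.
move=> p0 oB cB; set A := [set x | B p.[x]]; set U := connected_component A x.
have oA : open A by exact: horner_component_open.
have UA : U `<=` A by exact: connected_component_sub.
have tot y : B y -> (nrt (p - y%:P) U + nrt (p - y%:P) (A `\` U) = pdeg p)%N.
  move=> By; rewrite -(pdegB y p0) /pdeg -size_roots_of ?polyB_neq0//.
  rewrite -(count_predC (fun z => `[< U z >])); congr (_ + _)%N.
  apply: eq_in_count => z; rewrite mem_roots_of ?polyB_neq0// /root !hornerE subr_eq0 => /eqP zy.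
  apply/asboolP/idP => [[_ nU]|/asboolP nU]; first exact/asboolP.
  by split=> //; rewrite /A /= zy.
have loc y : B y -> exists2 e : R, 0 < e & forall y', cabs (y' - y) < e -> B y' ->
    nrt (p - y'%:P) U = nrt (p - y%:P) U.
  move=> By.
  have [x1 px nUx|e1 e10 H1] := @nrt_usc p y U p0.
    apply: contrapT => nex; apply: nUx; apply: component_relclosed => //.
      by rewrite /A /= px.
    move=> e e0; apply: contrapT => nA; apply: nex; exists e => // x' xx' Ux'.
    by apply: nA; exists x'.
  have [x1 px nUx|e2 e20 H2] := @nrt_usc p y (A `\` U) p0.
    have Ux : U x1 by apply: contrapT => nU; apply: nUx; split=> //; rewrite /A /= px.
    have /open_cabsP/(_ _ Ux)[e e0 eU] := @component_open _ A x oA.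
    by exists e => // x' /eU Ux' [].
  exists (Num.min e1 e2); first by rewrite lt_min e10.
  move=> y'; rewrite lt_min => /andP[/H1 h1 /H2 h2] By'.
  apply/eqP; rewrite eqn_leq h1 /=; have := tot _ By'; rewrite -(tot _ By) => h3.
  by rewrite -(leq_add2r (nrt (p - y'%:P) (A `\` U))) h3 leq_add2l.
move=> y y' By By'; apply/esym.
apply: (@connected_clopen _ B [set y' | nrt (p - y'%:P) U = nrt (p - y%:P) U] y) => //.
  move=> z Bz /= zy; have [e e0 H] := loc _ Bz; exists e => // v vz Bv.
  by rewrite /= (H v).
move=> z Bz /= zy; have [e e0 H] := loc _ Bz; exists e => // v vz Bv.
by rewrite /= (H v).
Qed.

End RootCount.

(** * Inverse branches over discs without critical values *)

Section LocalInverse.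
Context {R : realType}.
Local Notation C := R[i].
Implicit Types (p q : {poly C}) (x y z w : C).

(** Quantitative openness: |p(x) - w| is the modulus of the leading coefficient times the product of
    the distances from [x] to the roots of [p - w], which cannot all be at least [rho]. *)
Lemma root_near p x w (rho : R) : (0 < pdeg p)%N -> 0 < rho ->
  cabs (w - p.[x]) < cabs (lead_coef p) * rho ^+ pdeg p ->
  exists2 z, p.[z] = w & cabs (z - x) < rho.
Proof.
move=> p0 rho0 lt; apply: contrapT => nex; move: lt; apply/negP; rewrite -leNgt.
have q0 := polyB_neq0 w p0.
have lE : lead_coef p = lead_coef (p - w%:P).
  rewrite lead_coefDl// size_polyN (leq_ltn_trans (size_polyC_leq1 _))//.
  by move: p0; rewrite /pdeg; case: (size p) => [|[]].
have -> : cabs (w - p.[x]) = cabs (p - w%:P).[x] by rewrite !hornerE cabsC.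
rewrite horner_roots cabsM -lE ler_wpM2l// cabs_prod -(pdegB w p0) /pdeg -size_roots_of//.
have := @prod_ler_mul _ _ (roots_of (p - w%:P)) (fun z => cabs (x - z)) (fun=> 1) rho (ltW rho0).
rewrite big1 ?mulr1//; apply => z; rewrite mem_roots_of// /root !hornerE subr_eq0 => /eqP pz.
split=> //=; rewrite ?mulr1 leNgt; apply/negP => lt; apply: nex; exists z => //.
by rewrite cabsC.
Qed.

Lemma shift_coef1 p x : (shiftp x p)`_1 = p^`().[x].
Proof.
have <- : (shiftp x p)^`()`_0 = (shiftp x p)`_1 by rewrite coef_deriv mulr1n.
rewrite -horner_coef0 /shiftp deriv_comp derivD derivX derivC addr0 mulr1 horner_comp.
by rewrite !hornerE.
Qed.

(** With u = y - x, Taylor's formula reads p(y) - p(x) = u (p'(x) + u S), and Cauchy's estimate on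
    unit circles bounds [S] uniformly for [x] in [Q]. *)
Lemma injective_near p (Q : set C) (T m : R) : 0 < m ->
  (forall x, Q x -> cabs x <= T) -> (forall x, Q x -> m <= cabs p^`().[x]) ->
  exists2 rho : R, 0 < rho & forall x y, Q x -> cabs (y - x) < rho ->
    m / 2 * cabs (y - x) <= cabs (p.[y] - p.[x]).
Proof.
move=> m0 QT Qm; have [B B0 pB] := coef_bound (shiftp 0 p).
pose t := Num.max 1 (T + 1).
have t1 : 1 <= t by rewrite le_max lexx.
pose M := (size p).+1%:R * B * t ^+ size p.
have M0 : 0 <= M by rewrite !mulr_ge0// exprn_ge0// (le_trans _ t1).
have pM y : cabs y <= t -> cabs p.[y] <= M.
  move=> yt; rewrite (horner_shiftE 0) subr0; apply: horner_upper => //.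
  by rewrite size_shift.
pose n := size p; have n0 : 0 <= (n%:R : R) * M by rewrite mulr_ge0.
exists (Num.min 1 (m / (2 * (n%:R * M) + 1))).
  by rewrite lt_min ltr01 divr_gt0// ltr_wpDl// mulr_ge0.
move=> x y Qx; rewrite lt_min => /andP[u1 u2]; set u := y - x in u1 u2 *.
pose q := shiftp x p.
have qM k : cabs q`_k <= M.
  rewrite -[leLHS]mulr1 -[X in _ * X](expr1n _ k); apply: cauchy_coef => // z z1.
  rewrite horner_shift; apply: pM; apply: le_trans (cabsD _ _) _.
  by rewrite z1 le_max addrC lerD2r QT ?orbT.
pose S := \sum_(i < n) q`_i.+2 * u ^+ i.
have SE : p.[y] - p.[x] = u * (p^`().[x] + u * S).
  rewrite -shift_coef1 -/q (horner_shiftE x p y) (horner_shiftE x p x) subrr -/u -/q.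
  rewrite !(@horner_coef_wide _ n.+2); try by rewrite size_shift leqW.
  rewrite !big_ord_recl /= !expr0 !mulr1 /bump /= !add1n.
  rewrite [X in _ - (_ + (_ + X))]big1; last by move=> i _; rewrite exprS mul0r mulr0.
  have -> : \sum_(i < n) q`_(1 + (1 + i)) * u ^+ (1 + (1 + i)) = u * (u * S).
    by rewrite /S !mulr_sumr; apply: eq_bigr => i _; rewrite !add1n !exprS; ring.
  by rewrite !expr1; ring.
have SM : cabs S <= n%:R * M.
  apply: le_trans (cabs_sum _ _ _) _.
  rewrite -[leRHS](_ : \sum_(i < n) M = _); last by rewrite sumr_const card_ord -[LHS]mulr_natl.
  apply: ler_sum => i _; rewrite cabsM cabsX -[leRHS]mulr1; apply: ler_pM => //.
    exact: exprn_ge0.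
  by rewrite exprn_ile1// ltW.
rewrite SE cabsM mulrC ler_wpM2l//.
have h1 := Qm _ Qx; have h2 := cabsDl p^`().[x] (u * S); rewrite cabsM in h2.
have h3 : cabs u * cabs S <= m / 2.
  move: u2; rewrite ltr_pdivlMr; last by rewrite ltr_wpDl// mulr_ge0.
  have := cabs_ge0 u; have := cabs_ge0 S; move: (cabs u) (cabs S) SM n0 => a s.
  move: (n%:R * M) => N sN N0 s0 a0 h; nra.
lra.
Qed.

Section Sections.
Context (p : {poly C}) (p0 : (0 < pdeg p)%N) (y0 z0 : C) (pz0 : p.[z0] = y0).

Definition inverse_branch (s : R) (phi : C -> C) : Prop :=
  phi y0 = z0 /\ forall w, cabs (w - y0) < s -> p.[phi w] = w /\
    forall e : R, 0 < e -> exists2 d : R, 0 < d & forall w',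
      cabs (w' - y0) < s -> cabs (w' - w) < d -> cabs (phi w' - phi w) < e.

Lemma preimage_closed (r : R) : closed [set x | cabs (p.[x] - y0) <= r].
Proof.
apply/closed_cabsP => x H; apply/ler_addgt0Pr => e e0.
have [d d0 Hd] := horner_continuous p x e0.
have [y /= yr yx] := H _ d0; have := Hd _ yx; have := cabs_dist p.[y] p.[x] y0.
by rewrite (cabsC p.[x] p.[y]); lra.
Qed.

Lemma preimage_bounded (r : R) : exists T : R, forall x, cabs (p.[x] - y0) <= r -> cabs x <= T.
Proof.
have sp : (2 <= size p)%N by move: p0; rewrite /pdeg; case: (size p) => [|[]].
have [t t1 H] := growth_single 0 (cabs y0 + r + 1) sp.
exists t => x xr; rewrite leNgt; apply/negP => /ltW tx.
have := H x; rewrite subr0 => /(_ tx); have := cabsB p.[x] y0; lra.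
Qed.

(** The preimage of the closed disc is compact and free of critical points, so |p'| has a positive
    minimum on it. *)
Lemma injective_on_preimage (r : R) : 0 <= r ->
  (forall c, root p^`() c -> r < cabs (p.[c] - y0)) ->
  exists rho mu : R, [/\ 0 < rho, 0 < mu & forall x y, cabs (p.[x] - y0) <= r ->
    cabs (y - x) < rho -> mu * cabs (y - x) <= cabs (p.[y] - p.[x])].
Proof.
move=> r0 nc; have [T HT] := preimage_bounded r.
pose Q := [set x | cabs (p.[x] - y0) <= r].
have cQ : compact Q.
  by apply: (@closed_bounded_compact _ _ 0 T (@preimage_closed r)) => x; rewrite subr0; exact: HT.
have Q0 : Q !=set0 by exists z0; rewrite /Q /= pz0 subrr cabs0.
have cont : {within Q, continuous (fun x => cabs p^`().[x])}.
  by apply: continuous_subspaceT; exact: cabs_horner_continuous.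
have [c cQ' Hc] := compact_EVT_min Q0 cQ cont.
have m0 : 0 < cabs p^`().[c].
  rewrite cabs_gt0; apply/negP => rc; have := nc c rc.
  by move/set_mem : cQ'; rewrite /Q /= => h; rewrite ltNge h.
have [rho rho0 H] := @injective_near p Q T _ m0 HT (fun x Qx => Hc x (mem_set Qx)).
exists rho, (cabs p^`().[c] / 2); split=> //; first by rewrite divr_gt0.
Qed.

(** Continuation in radial steps of length [eta], within which [root_near] finds a root closer than
    [rho / 4]. A branch over one disc yields one over a larger disc: its value at [w] is a root near
    the old branch at a contracted point, and local injectivity makes it continuous. *)
Lemma inverse_branch_exists (r : R) : 0 < r ->
  (forall c, root p^`() c -> r < cabs (p.[c] - y0)) -> exists phi, inverse_branch r phi.
Proof.
move=> r0 nc; have [rho [mu [rho0 mu0 inj]]] := injective_on_preimage (ltW r0) nc.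
have rho4 : 0 < rho / 4 by rewrite divr_gt0.
pose eta := cabs (lead_coef p) * (rho / 4) ^+ pdeg p.
have eta0 : 0 < eta.
  rewrite mulr_gt0 ?exprn_gt0// cabs_gt0 lead_coef_eq0 -size_poly_eq0.
  by move: p0; rewrite /pdeg; case: (size p).
(* The centre is added by hand: the induction starts at radius 0, where the open disc is empty. *)
pose dom s w := w = y0 \/ cabs (w - y0) < s.
pose branch (s : R) (phi : C -> C) := phi y0 = z0 /\ forall w, dom s w -> p.[phi w] = w /\
    forall e : R, 0 < e -> exists2 d : R, 0 < d & forall w',
      dom s w' -> cabs (w' - w) < d -> cabs (phi w' - phi w) < e.
pose s_ (k : nat) := Num.min (k%:R * eta) r.
have ex k : exists phi, branch (s_ k) phi.
  elim: k => [|k [phi [phi0 bphi]]].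
    exists (fun=> z0); split=> // w dw; have -> : w = y0.
      case: dw => // /lt_le_trans /(_ (_ : s_ 0%N <= 0)); rewrite /s_ ge_min mul0r lexx => /(_ isT).
      by move=> h; have := cabs_ge0 (w - y0); rewrite leNgt h.
    by split=> // e e0; exists 1 => // w' _ _; rewrite subrr cabs0.
  pose s := s_ k; pose s' := s_ k.+1.
  have s0 : 0 <= s by rewrite le_min mulr_ge0 ?(ltW eta0)//= ltW.
  have s'0 : 0 < s' by rewrite lt_min mulr_gt0.
  have ss' : s <= s' by rewrite le_min !ge_min lexx orbT andbT ler_wpM2r ?(ltW eta0)// ler_nat leqnSn.
  have s's : s' - s <= eta.
    rewrite lerBlDr /s /s_ addr_minr le_min; apply/andP; split.
      by rewrite ge_min -natr1 mulrDl mul1r addrC lexx.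
    by rewrite ge_min lerDr (ltW eta0) orbT.
  have s'r : s' <= r by rewrite ge_min lexx orbT.
  pose kap := s / s'.
  have kap0 : 0 <= kap by rewrite divr_ge0// ltW.
  have kap1 : kap <= 1 by rewrite ler_pdivrMr// mul1r.
  (* Radial contraction of the disc of radius [s'] to that of radius [s]; it moves points by less
     than [eta]. *)
  pose bar w := y0 + kap%:C * (w - y0).
  have bar0 : bar y0 = y0 by rewrite /bar subrr mulr0 addr0.
  have barD w : cabs (bar w - y0) = kap * cabs (w - y0).
    by rewrite /bar addrAC subrr add0r cabs_realM.
  have dbar w : dom s' w -> dom s (bar w).
    case=> [->|ws]; first by left; rewrite bar0.
    have [sz|sp] := eqVneq s 0.
      by left; rewrite /bar /kap sz mul0r rmorph0 mul0r addr0.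
    have sp' : 0 < s by rewrite lt_def sp.
    right; rewrite barD /kap -[ltRHS](divfK (lt0r_neq0 s'0)) ltr_pM2l// divr_gt0//.
  have cbar w : dom s' w -> cabs (w - bar w) < eta.
    case=> [->|ws]; first by rewrite bar0 subrr cabs0.
    have -> : w - bar w = (1 - kap)%:C * (w - y0) by rewrite /bar rmorphB rmorph1; ring.
    rewrite cabs_realM ?subr_ge0//; apply: (@lt_le_trans _ _ eta); last exact: lexx.
    have [k1|kn] := eqVneq kap 1; first by rewrite k1 subrr mul0r.
    have kp : 0 < 1 - kap by rewrite subr_gt0 lt_neqAle kn.
    apply: (@lt_le_trans _ _ ((1 - kap) * s')); first by rewrite ltr_pM2l.
    by rewrite mulrBl mul1r /kap divfK// gt_eqF.
  have /choice[psi psiP] : forall w, exists z, dom s' w -> p.[z] = w /\ cabs (z - phi (bar w)) < rho / 4.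
    move=> w; have [dw|nd] := pselect (dom s' w); last by exists 0.
    have [pb _] := bphi _ (dbar _ dw).
    have [|z pz zb] := @root_near p (phi (bar w)) w _ p0 rho4; first by rewrite pb; exact: cbar.
    by exists z.
  have dr w : dom s' w -> cabs (w - y0) <= r.
    by case=> [->|/ltW h]; [rewrite subrr cabs0 ltW|exact: le_trans s'r].
  exists psi; split.
    have [py0 yy] := psiP y0 (or_introl erefl); rewrite bar0 phi0 in yy.
    have := inj z0 (psi y0); rewrite pz0 py0 subrr cabs0 => /(_ (ltW r0)).
    have lt : cabs (psi y0 - z0) < rho by lra.
    move=> /(_ lt) le; apply/eqP; rewrite -subr_eq0 -cabs_eq0 eq_le cabs_ge0 andbT.
    by rewrite -(ler_pM2l mu0) mulr0.
  move=> w dw; have [pw wb] := psiP w dw; split=> // e e0.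
  have [_ cphi] := bphi _ (dbar _ dw); have [d d0 Hd] := cphi _ rho4.
  exists (Num.min d (mu * e)); first by rewrite lt_min d0 mulr_gt0.
  move=> w' dw'; rewrite lt_min => /andP[wd we].
  have [pw' wb'] := psiP w' dw'.
  have bb : cabs (phi (bar w') - phi (bar w)) < rho / 4.
    apply: Hd; first exact: dbar.
    have -> : bar w' - bar w = kap%:C * (w' - w) by rewrite /bar; ring.
    by rewrite cabs_realM//; apply: le_lt_trans wd; rewrite ler_piMl.
  have near : cabs (psi w' - psi w) < rho.
    have := cabs_dist (phi (bar w')) (psi w') (psi w).
    have := cabs_dist (phi (bar w)) (phi (bar w')) (psi w).
    rewrite (cabsC (phi (bar w)) (psi w)); lra.
  have := inj (psi w) (psi w'); rewrite pw pw' => /(_ (dr _ dw) near) le.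
  by rewrite -(ltr_pM2l mu0); exact: le_lt_trans we.
have [k kr] : exists k : nat, r <= k%:R * eta.
  exists (Num.truncn (r / eta)).+1; rewrite -ler_pdivrMr//; exact/ltW/truncnS_gt.
have [phi [phi0 bphi]] := ex k; have sk : s_ k = r by rewrite /s_; apply/min_idPr.
rewrite sk in bphi; exists phi; split=> // w wr.
have [pw cw] := bphi w (or_intror wr); split=> // e e0.
by have [d d0 Hd] := cw _ e0; exists d => // w' w'r; apply: Hd; right.
Qed.

(** The branches agree on a relatively open and closed set: near a point of agreement their values
    are preimages of one point within the radius of injectivity. *)
Lemma inverse_branch_unique (r s1 s2 : R) phi1 phi2 : 0 < r ->
  (forall c, root p^`() c -> r < cabs (p.[c] - y0)) -> r <= s1 -> r <= s2 ->
  inverse_branch s1 phi1 -> inverse_branch s2 phi2 ->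
  forall w, cabs (w - y0) < r -> phi1 w = phi2 w.
Proof.
move=> r0 nc rs1 rs2 [phi10 b1] [phi20 b2].
have [rho [mu [rho0 mu0 inj]]] := injective_on_preimage (ltW r0) nc.
have rho2 : 0 < rho / 2 by rewrite divr_gt0.
apply: (@connected_clopen _ [set w | cabs (w - y0) < r] [set w | phi1 w = phi2 w] y0).
- exact: connected_disc.
- by rewrite /= subrr cabs0.
- by rewrite /= phi10 phi20.
- move=> w /= wr eqw.
  have [_ c1] := b1 w (lt_le_trans wr rs1); have [_ c2] := b2 w (lt_le_trans wr rs2).
  have [d1 d10 H1] := c1 _ rho2; have [d2 d20 H2] := c2 _ rho2.
  exists (Num.min d1 d2); first by rewrite lt_min d10.
  move=> v; rewrite lt_min => /andP[vd1 vd2] vr.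
  have k1 := H1 _ (lt_le_trans vr rs1) vd1; have k2 := H2 _ (lt_le_trans vr rs2) vd2.
  have [pv1 _] := b1 v (lt_le_trans vr rs1); have [pv2 _] := b2 v (lt_le_trans vr rs2).
  have near : cabs (phi1 v - phi2 v) < rho.
    by have := cabs_dist (phi1 w) (phi1 v) (phi2 v); rewrite {2}eqw (cabsC (phi2 w)); lra.
  have := inj (phi2 v) (phi1 v); rewrite pv1 pv2 subrr cabs0 => /(_ (ltW vr) near) le.
  by apply/eqP; rewrite -subr_eq0 -cabs_eq0 eq_le cabs_ge0 andbT -(ler_pM2l mu0) mulr0.
- move=> w /= wr neq.
  have [_ c1] := b1 w (lt_le_trans wr rs1); have [_ c2] := b2 w (lt_le_trans wr rs2).
  have e0 : 0 < cabs (phi1 w - phi2 w) / 2.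
    by rewrite divr_gt0// cabs_gt0 subr_eq0; exact/eqP.
  have [d1 d10 H1] := c1 _ e0; have [d2 d20 H2] := c2 _ e0.
  exists (Num.min d1 d2); first by rewrite lt_min d10.
  move=> v; rewrite lt_min => /andP[vd1 vd2] vr eqv.
  have k1 := H1 _ (lt_le_trans vr rs1) vd1; have k2 := H2 _ (lt_le_trans vr rs2) vd2.
  have := cabs_dist (phi1 v) (phi1 w) (phi2 w).
  by rewrite {2}eqv (cabsC (phi1 w) (phi1 v)); lra.
Qed.

End Sections.

(* The inverse branches from the centre identify a component of the preimage of a
   disc without critical values with the disc itself. *)
Lemma component_injective p y0 (r : R) x : (0 < pdeg p)%N ->
  (forall c, root p^`() c -> r <= cabs (p.[c] - y0)) ->
  let U := connected_component [set z | cabs (p.[z] - y0) < r] x in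
  forall z1 z2, U z1 -> U z2 -> p.[z1] = p.[z2] -> z1 = z2.
Proof.
move=> p0 nc; set A := [set z | cabs (p.[z] - y0) < r]; move=> U.
pose B := [set y : C | cabs (y - y0) < r].
have oB : open B.
  apply/open_cabsP => y /= yr; exists (r - cabs (y - y0)); first by rewrite subr_gt0.
  by move=> v vy; have := cabs_dist y v y0; rewrite /B /=; lra.
have AE : A = [set z | B p.[z]] by [].
have oA : open A by rewrite AE; exact: horner_component_open.
have UA : U `<=` A by exact: connected_component_sub.
have [/eqP U0|/set0P[x1 Ux1]] := boolP (U == set0); first by move=> z1 z2; rewrite U0.
have Bx1 : B p.[x1] by exact: UA.
have r0 : 0 < r by exact: le_lt_trans Bx1.
have By0 : B y0 by rewrite /B /= subrr cabs0.
have cnt y : B y -> nrt (p - y%:P) U = nrt (p - y0%:P) U.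
  by move=> By; exact: (@nrt_component _ p B x p0 oB (@connected_disc _ y0 r) y y0 By By0).
have has_root y : (0 < nrt (p - y%:P) U)%N <-> exists2 z, U z & p.[z] = y.
  rewrite -has_count; split=> [/hasP[z]|[z Uz pz]].
    by rewrite mem_roots_of ?polyB_neq0// /root !hornerE subr_eq0 => /eqP pz /asboolP Uz; exists z.
  apply/hasP; exists z; last exact/asboolP.
  by rewrite mem_roots_of ?polyB_neq0// /root !hornerE subr_eq0 pz.
(* The component contains a preimage of the centre because its valence is constant over the disc and
   positive over [p.[x1]]. *)
have [z0 Uz0 pz0] : exists2 z, U z & p.[z] = y0.
  by apply/has_root; rewrite -(cnt _ Bx1); apply/has_root; exists x1.
have ncs s : s < r -> forall c, root p^`() c -> s < cabs (p.[c] - y0).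
  by move=> sr c /nc; exact: lt_le_trans.
(* The radius varies with [z]: critical values may lie at distance exactly [r], so branches are
   taken over strictly smaller discs. *)
pose P z := exists s phi, [/\ cabs (p.[z] - y0) < s, s < r, inverse_branch p y0 z0 s phi &
  phi p.[z] = z].
have uniq z s1 s2 phi1 phi2 : cabs (p.[z] - y0) < s1 -> cabs (p.[z] - y0) < s2 -> s1 < r ->
    inverse_branch p y0 z0 s1 phi1 -> inverse_branch p y0 z0 s2 phi2 -> phi1 p.[z] = phi2 p.[z].
  move=> z1 z2 s1r b1 b2; pose s := Num.min s1 s2.
  have zs : cabs (p.[z] - y0) < s by rewrite lt_min z1.
  have s0 : 0 < s by exact: le_lt_trans zs.
  have ss1 : s <= s1 by rewrite ge_min lexx.
  have ss2 : s <= s2 by rewrite ge_min lexx orbT.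
  exact: (inverse_branch_unique p0 pz0 s0 (ncs _ (le_lt_trans ss1 s1r)) ss1 ss2 b1 b2).
have exb z : A z -> exists s phi, [/\ cabs (p.[z] - y0) < s, s < r & inverse_branch p y0 z0 s phi].
  move=> Az; pose s := (cabs (p.[z] - y0) + r) / 2.
  have zs : cabs (p.[z] - y0) < s by rewrite /s; move: Az; rewrite /A /=; lra.
  have sr : s < r by rewrite /s; move: Az; rewrite /A /=; lra.
  have s0 : 0 < s by exact: le_lt_trans zs.
  have [phi bphi] := inverse_branch_exists p0 pz0 s0 (ncs _ sr).
  by exists s, phi.
have UP : U `<=` P.
  apply: (@connected_clopen _ U P z0) => //.
  - exact: component_connected.
  - have Az0 : A z0 by exact: UA.
    have [s [phi [zs sr bphi]]] := exb _ Az0; exists s, phi; split=> //.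
    by rewrite pz0; case: bphi.
  - move=> z Uz [s [phi [zs sr bphi phiz]]].
    have s0 : 0 < s by exact: le_lt_trans zs.
    have [rho [mu [rho0 mu0 inj]]] := injective_on_preimage p0 pz0 (ltW s0) (ncs _ sr).
    have rho2 : 0 < rho / 2 by rewrite divr_gt0.
    have [_ /(_ _ zs)[_ /(_ _ rho2)[d d0 Hd]]] := bphi.
    have e0 : 0 < Num.min d (s - cabs (p.[z] - y0)) by rewrite lt_min d0 subr_gt0.
    have [d1 d10 Hd1] := horner_continuous p z e0.
    exists (Num.min d1 (rho / 2)); first by rewrite lt_min d10.
    move=> v; rewrite lt_min => /andP[/Hd1 + vz] Uv; rewrite lt_min => /andP[pv1 pv2].
    have vs : cabs (p.[v] - y0) < s by have := cabs_dist p.[z] p.[v] y0; lra.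
    exists s, phi; split=> //; have k := Hd _ vs pv1; rewrite phiz in k.
    have [_ /(_ _ vs)[pphi _]] := bphi.
    have near : cabs (phi p.[v] - v) < rho.
      by have := cabs_dist z (phi p.[v]) v; rewrite (cabsC z v); lra.
    have := inj v (phi p.[v]); rewrite pphi subrr cabs0 => /(_ (ltW vs) near) le.
    by apply/eqP; rewrite -subr_eq0 -cabs_eq0 eq_le cabs_ge0 andbT -(ler_pM2l mu0) mulr0.
  - move=> z Uz nP; have [s [phi [zs sr bphi]]] := exb _ (UA _ Uz).
    have ne : phi p.[z] != z by apply/eqP => phiz; apply: nP; exists s, phi.
    have e0 : 0 < cabs (phi p.[z] - z) / 2 by rewrite divr_gt0// cabs_gt0 subr_eq0.
    have [_ /(_ _ zs)[_ /(_ _ e0)[d d0 Hd]]] := bphi.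
    have e1 : 0 < Num.min d (s - cabs (p.[z] - y0)) by rewrite lt_min d0 subr_gt0.
    have [d1 d10 Hd1] := horner_continuous p z e1.
    exists (Num.min d1 (cabs (phi p.[z] - z) / 2)); first by rewrite lt_min d10.
    move=> v; rewrite lt_min => /andP[/Hd1 + vz] Uv; rewrite lt_min => /andP[pv1 pv2].
    have vs : cabs (p.[v] - y0) < s by have := cabs_dist p.[z] p.[v] y0; lra.
    move=> [s' [phi' [vs' s'r bphi' phiv]]].
    have E := uniq v s s' phi phi' vs vs' sr bphi bphi'; rewrite phiv in E.
    have k := Hd _ vs pv1; rewrite E in k.
    by have := cabs_dist v (phi p.[z]) z; rewrite (cabsC (phi p.[z]) v); lra.
move=> z1 z2 /UP[s1 [phi1 [zs1 s1r b1 e1]]] /UP[s2 [phi2 [zs2 s2r b2 e2]]] pE.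
rewrite -e1 -e2 -pE; apply: uniq b1 b2 => //.
by rewrite pE.
Qed.

(** Injectivity leaves at most one root in the component, and it is simple because the disc contains
    no critical value. *)
Lemma nrt_component_le1 p y0 (r : R) x y : (0 < pdeg p)%N ->
  (forall c, root p^`() c -> r <= cabs (p.[c] - y0)) -> cabs (y - y0) < r ->
  (nrt (p - y%:P) (connected_component [set z | (cabs (p.[z] - y0) < r)%R] x) <= 1)%N.
Proof.
move=> p0 nc yr; set U := connected_component _ x.
have inj := component_injective p0 nc (x := x).
have q0 := polyB_neq0 y p0.
have rE z : (z \in roots_of (p - y%:P)) = (p.[z] == y).
  by rewrite mem_roots_of// /root !hornerE subr_eq0.
have sub z : z \in roots_of (p - y%:P) -> `[< U z >] -> (count_mem z (roots_of (p - y%:P)) <= 1)%N.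
  rewrite rE => /eqP pz _; rewrite -mup_roots_of// leqNgt -pz mup_gt1//.
  by apply/negP => /nc; rewrite pz leNgt yr.
rewrite /nrt; case: (boolP (has (fun z => `[< U z >]) (roots_of (p - y%:P)))) => [/hasP[z zr Uz]|]; last first.
  by rewrite has_count -eqn0Ngt => /eqP ->.
apply: leq_trans (sub _ zr Uz); apply: sub_in_count => v vr Uv /=.
apply/eqP; apply: inj; [exact/asboolP|exact/asboolP|].
by move: zr vr; rewrite !rE => /eqP -> /eqP ->.
Qed.

End LocalInverse.

(** * Minimum modulus and the size of components of preimages *)

Section Distortion.
Context {R : realType}.
Local Notation C := R[i].
Implicit Types (p q : {poly C}) (x y z w b : C) (U : set C).

(** The minimum over the closure is attained. At an interior point [c] it would be beaten, since
    [root_near] gives a nearby point with value [(1 - t) * p.[c]]. *)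
Lemma min_modulus p U b (r m : R) : open U -> (forall z, U z -> cabs (z - b) <= r) ->
  (forall z, U z -> ~~ root p z) -> (forall z, closure U z -> ~ U z -> m <= cabs p.[z]) ->
  forall z, U z -> m <= cabs p.[z].
Proof.
move=> oU Ur nr bd z Uz; have cU : closed (closure U) by exact: closed_closure.
have clr y : closure U y -> cabs (y - b) <= r.
  move=> /closure_cabsP cy; apply/ler_addgt0Pr => e e0.
  have [v Uv vy] := cy _ e0; have := Ur _ Uv; have := cabs_dist v y b.
  by rewrite (cabsC y v); lra.
have cpt : compact (closure U) by apply: closed_bounded_compact cU clr.
have sub : U `<=` closure U by exact: subset_closure.
have cont : {within closure U, continuous (fun x => cabs p.[x])}.
  by apply: continuous_subspaceT; exact: cabs_horner_continuous.
have [c cU' Hc] := compact_EVT_min (ex_intro _ z (sub _ Uz)) cpt cont.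
have minc v : U v -> cabs p.[c] <= cabs p.[v] by move=> /sub/mem_set; exact: Hc.
have [Uc|nUc] := pselect (U c); last first.
  by apply: le_trans (minc _ Uz); apply: bd => //; exact: set_mem.
(* A constant polynomial is not open; its value is read off at a boundary point, which exists
   because [U] is bounded. *)
have [p0|p0] := posnP (pdeg p).
  have pc v : p.[v] = p.[z].
    have : (size p <= 1)%N by move: p0; rewrite /pdeg; case: (size p) => [|[]].
    by move=> /size1_polyC ->; rewrite !hornerC.
  have nout : ~ closure U (b + (`|r| + 1)%:C).
    move=> /clr; rewrite addrC addKr cabs_real ?addr_ge0//.
    by have := ler_norm r; lra.
  have [t [_ cx nx]] := boundary_point cU (sub _ Uz) nout.
  move: cx nx; set v := z + _ => cx nx; clearbody v; suff nUv : ~ U v by rewrite -(pc v); exact: bd.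
  move=> Ux; apply: nx.
  have /open_cabsP/(_ _ Ux)[e e0 eU] := oU.
  apply/nbhs_cabsP; exists e; first exact: e0.
  by move=> w we; apply: sub; apply: eU; exact: we.
exfalso; have pc0 : 0 < cabs p.[c] by rewrite cabs_gt0; exact: nr.
have /open_cabsP/(_ _ Uc)[e e0 eU] := oU.
pose k := cabs (lead_coef p) * e ^+ pdeg p.
have k0 : 0 < k.
  rewrite mulr_gt0 ?exprn_gt0// cabs_gt0 lead_coef_eq0 -size_poly_eq0.
  by move: p0; rewrite /pdeg; case: (size p).
pose t := Num.min (1 / 2) (k / (2 * cabs p.[c])).
have t0 : 0 < t by rewrite lt_min !divr_gt0// mulr_gt0.
have t1 : t <= 1 / 2 by rewrite ge_min lexx.
have t2 : t * (2 * cabs p.[c]) <= k by rewrite -ler_pdivlMr ?mulr_gt0// ge_min lexx orbT.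
have [|v pv ve] := @root_near _ p c ((1 - t)%:C * p.[c]) e p0 e0.
  have -> : (1 - t)%:C * p.[c] - p.[c] = - (t%:C * p.[c]) by rewrite rmorphB rmorph1; ring.
  rewrite cabsN cabs_realM ?(ltW t0)//; apply: lt_le_trans t2.
  by rewrite ltr_pM2l//; lra.
have := minc _ (eU _ ve); rewrite pv cabs_realM; last by lra.
by rewrite leNgt gtr_pMl//; lra.
Qed.

(** Write p - y = F P, with P the product over the roots in [U]. On the boundary of [U], |p - y| >=
    d / 2 and |P| <= (2r)^N, so [min_modulus] bounds the zero-free factor F from below. Thus a point
    of [U] with value close to [y] is close to a root in [U]. *)
Lemma distortion p y0 y (d : R) x b (r : R) N : (0 < pdeg p)%N -> 0 < d ->
  let U := connected_component [set z | cabs (p.[z] - y0) < d] x in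
  (forall z, U z -> cabs (z - b) <= r) -> 1 <= 2 * r ->
  cabs (y - y0) <= d / 2 -> (nrt (p - y%:P) U <= N)%N ->
  forall z, U z ->
    d / 2 / (2 * r) ^+ N *
      \prod_(zeta <- roots_of (p - y%:P) | `[< U zeta >]) cabs (z - zeta) <= cabs (p.[z] - y).
Proof.
move=> p0 d0 U Ur r1 yd Nrt z Uz; set rs := roots_of (p - y%:P).
have q0 := polyB_neq0 y p0.
pose F := lead_coef (p - y%:P) *: \prod_(v <- rs | ~~ `[< U v >]) ('X - v%:P).
pose P v := \prod_(zeta <- rs | `[< U zeta >]) (v - zeta).
have FP v : p.[v] - y = F.[v] * P v.
  have -> : p.[v] - y = (p - y%:P).[v] by rewrite !hornerE.
  rewrite horner_roots -/rs hornerZ horner_prod -mulrA; congr (_ * _).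
  rewrite (bigID (fun zeta => `[< U zeta >])) /= mulrC; congr (_ * _).
  by apply: eq_bigr => w _; rewrite hornerXsubC.
pose A := [set z | cabs (p.[z] - y0) < d].
have oA : open A.
  apply: (@horner_component_open _ p [set w | cabs (w - y0) < d]).
  apply/open_cabsP => w /= wr; exists (d - cabs (w - y0)); first by rewrite subr_gt0.
  by move=> v vw; have := cabs_dist w v y0; lra.
have oU : open U by exact: component_open.
have clr v : closure U v -> cabs (v - b) <= r.
  move=> /closure_cabsP cv; apply/ler_addgt0Pr => e e0.
  have [w Uw wv] := cv _ e0; have := Ur _ Uw; have := cabs_dist w v b.
  by rewrite (cabsC v w); lra.
have R0 : 0 < (2 * r) ^+ N by rewrite exprn_gt0//; lra.
have Pr v : closure U v -> cabs (P v) <= (2 * r) ^+ N.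
  move=> /clr vr; rewrite cabs_prod.
  apply: (@le_trans _ _ (\prod_(zeta <- rs | `[< U zeta >]) (2 * r))).
    apply: ler_prod => w /asboolP Uw; rewrite cabs_ge0 /=.
    by have := Ur _ Uw; have := cabs_dist b v w; rewrite (cabsC b w); lra.
  rewrite big_const_seq iter_mulr_1; apply: ler_weXn2l => //.
have Fm : d / 2 / (2 * r) ^+ N <= cabs F.[z].
  apply: (@min_modulus F U b r _ oU Ur) => // [v Uv|v cv nUv].
    rewrite rootZ ?lead_coef_eq0// -big_filter root_prod_XsubC mem_filter negb_and negbK.
    by apply/orP; left; exact/asboolP.
  have nA : ~ A v.
    move=> Av; apply: nUv; apply: component_relclosed => // e e0.
    by have /closure_cabsP/(_ _ e0) := cv.
  have h1 : d <= cabs (p.[v] - y0) by rewrite leNgt; apply/negP.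
  have h2 : d / 2 <= cabs (p.[v] - y) by have := cabs_dist y p.[v] y0; lra.
  rewrite ler_pdivrMr//; apply: le_trans h2 _; rewrite FP cabsM.
  by rewrite ler_wpM2l// Pr.
have P0 : 0 <= cabs (P z) by [].
by rewrite FP cabsM -[X in _ * X]cabs_prod -/(P z) ler_wpM2r.
Qed.

(* Among [N + 1] concentric circles one avoids the [N] small discs. *)
Lemma small_component U x0 (zs : seq C) N (r e : R) : connected U -> U x0 -> 0 < r ->
  (size zs <= N)%N -> 2 * e * N.+1%:R <= r ->
  (forall x, U x -> exists2 z, z \in zs & cabs (x - z) < e) ->
  forall x, U x -> cabs (x - x0) < r.
Proof.
move=> cU Ux0 r0 zsN er cov.
have N0 : (0 : R) < N.+1%:R by rewrite ltr0n.
pose t (i : 'I_N.+1) : R := (val i).+1%:R * (r / N.+1%:R).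
have [i Hi] : exists i, forall x, U x -> cabs (x - x0) != t i.
  apply: contrapT => nex.
  have /choice[f fP] : forall i : 'I_N.+1, exists j : 'I_(size zs),
      `|cabs (nth 0 zs j - x0) - t i| < e.
    move=> i; have [x Ux /eqP xt] : exists2 x, U x & cabs (x - x0) == t i.
      apply: contrapT => nx; apply: nex; exists i => x Ux; apply/negP => xt.
      by apply: nx; exists x.
    have [z zz xz] := cov _ Ux; have iz : (index z zs < size zs)%N by rewrite index_mem.
    exists (Ordinal iz); rewrite /= nth_index// -xt.
    apply: le_lt_trans xz; rewrite ler_norml; apply/andP; split.
      by have := cabs_dist z x x0; lra.
    by have := cabs_dist x z x0; rewrite (cabsC z x); lra.
  have finj : injective f.
    move=> i j fij; have h1 := fP i; have h2 := fP j; rewrite fij in h1.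
    have [//|ne] := eqVneq i j.
    have h3 : `|t i - t j| < 2 * e.
      by move: h1 h2; rewrite !ltr_norml => /andP[? ?] /andP[? ?]; apply/andP; split; lra.
    have h4 : r / N.+1%:R <= `|t i - t j|.
      rewrite /t -mulrBl normrM (gtr0_norm (divr_gt0 r0 N0)) ler_peMl ?divr_ge0 ?(ltW r0)//.
      have [lt|lt|/val_inj eq] := ltngtP (val i) (val j); last by move: ne; rewrite eq eqxx.
        rewrite distrC -natrB ?ltnS ?(ltnW lt)// subSS normr_nat ler1n subn_gt0//.
      by rewrite -natrB ?ltnS ?(ltnW lt)// subSS normr_nat ler1n subn_gt0.
    have : r / N.+1%:R < 2 * e by exact: le_lt_trans h3.
    by rewrite ltr_pdivrMr// ltNge er.
  by have := leq_card f finj; rewrite !card_ord leqNgt ltnS zsN.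
have ti0 : 0 < t i by rewrite mulr_gt0 ?ltr0n// divr_gt0.
have tir : t i <= r by rewrite /t mulrA ler_pdivrMr// mulrC ler_wpM2l ?(ltW r0)// ler_nat ltn_ord.
move=> x Ux; apply: (@lt_le_trans _ _ (t i)) => //; move: x Ux.
apply: (@connected_clopen _ U [set x | cabs (x - x0) < t i] x0) => //=.
- by rewrite subrr cabs0.
- move=> z Uz zt; exists (t i - cabs (z - x0)); first by rewrite subr_gt0.
  by move=> w wz _; have := cabs_dist z w x0; lra.
- move=> z Uz /negP; rewrite -leNgt => zt.
  have zt' : t i < cabs (z - x0) by rewrite lt_neqAle zt eq_sym Hi.
  exists (cabs (z - x0) - t i); first by rewrite subr_gt0.
  by move=> w wz _; have := cabs_dist w z x0; rewrite (cabsC z w); lra.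
Qed.

End Distortion.

(** * Hyperbolicity and semi-hyperbolicity *)

Section Valence.
Context {R : realType}.
Local Notation C := R[i].
Local Notation Chat := (sphere R).
Implicit Types (p q : {poly C}) (x y w b c : C) (s t : seq {poly C}) (Gam V : set {poly C}).

Lemma component_mono (T : topologicalType) (A A' : set T) (x : T) : A `<=` A' ->
  connected_component A x `<=` connected_component A' x.
Proof.
move=> AA; have [Ax|nAx] := pselect (A x); last by rewrite connected_component_out.
apply: connected_component_max; first exact: connected_component_refl.
  exact: subset_trans (@connected_component_sub _ _ _) AA.
exact: component_connected.
Qed.

Lemma nrt_set0 p : nrt p set0 = 0%N.
Proof. by apply/eqP; rewrite eqn0Ngt -has_count; apply/hasPn => z _; apply/asboolP. Qed.

Lemma nrt_gt0 p y (U : set C) : (0 < pdeg p)%N -> (0 < nrt (p - y%:P) U)%N ->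
  exists2 z, U z & p.[z] = y.
Proof.
move=> p0; rewrite -has_count => /hasP[z]; rewrite mem_roots_of ?polyB_neq0//.
by rewrite /root !hornerE subr_eq0 => /eqP pz /asboolP Uz; exists z.
Qed.

Lemma letters_pdeg L s : L `<=` poly_ge2 -> letters L s -> (0 < pdeg (word s))%N.
Proof.
move=> L2 Ls; have [->|s0] := eqVneq s [::]; first by rewrite /pdeg size_polyX.
exact: leq_trans (word_ge2 L2 s0 Ls).
Qed.

Lemma horner_image_connected p (A : set C) : connected A -> connected [set p.[x] | x in A].
Proof.
move=> cA; apply: connected_continuous_connected => //; apply: continuous_subspaceT => x B.
move=> /nbhs_cabsP[e e0 eB]; have [d d0 Hd] := horner_continuous p x e0.
by apply/nbhs_cabsP; exists d => // y /Hd /eB.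
Qed.

(** For sets avoiding infinity, components in the sphere and in the plane agree, as [Some] and its
    inverse [odflt 0] are continuous there. *)
Lemma component_plane (A : set Chat) x : A `<=` range Some -> A (Some x) ->
  plane_part (connected_component A (Some x)) = connected_component (plane_part A) x.
Proof.
move=> AS Ax; rewrite eqEsubset; split=> [y Ay|y Ay].
  pose D := connected_component A (Some x).
  have cD : connected [set odflt 0 z | z in D].
    apply: connected_continuous_connected; first exact: component_connected.
    apply: continuous_in_subspaceT => z /set_mem/connected_component_sub/AS[v _ <-] B.
    move=> /nbhs_cabsP[e e0 eB]; apply/nbhs_someP; exists e => // u ue; exact: (eB u ue).
  apply: (@connected_component_max _ _ [set odflt 0 z | z in D]) => //.
  - by exists (Some x) => //; exact: connected_component_refl.
  - move=> _ [z /connected_component_sub Az <-].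
    by have [v _ vz] := AS _ Az; rewrite /plane_part /= -vz /= vz.
  - by exists (Some y).
have : (Some @` connected_component (plane_part A) x) (Some y) by exists y.
apply: (@connected_component_max _ A) => //.
- by exists x => //; exact: connected_component_refl.
- by move=> _ [v /connected_component_sub + <-].
- apply: connected_continuous_connected; first exact: component_connected.
  by apply: continuous_subspaceT; exact: some_continuous.
Qed.

(* The empty word, i.e. the identity map, is included. *)
Definition bounded_valence Gam (d : R) (N : nat) : Prop :=
  forall s, letters Gam s -> forall y0, Khat (semigroup_gen Gam) y0 ->
  ~ (Khat (semigroup_gen Gam))° y0 -> forall x y, cabs (y - y0) < d ->
  (nrt (word s - y%:P)
     (connected_component [set z | (cabs ((word s).[z] - y0) < d)%R] x) <= N)%N.

Lemma bounded_valence_intro Gam (d : R) (N : nat) : Gam `<=` poly_ge2 -> (0 < N)%N ->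
  (forall p, semigroup_gen Gam p -> forall y0, Khat (semigroup_gen Gam) y0 ->
     ~ (Khat (semigroup_gen Gam))° y0 -> forall x y, cabs (y - y0) < d ->
     (nrt (p - y%:P) (connected_component [set z | (cabs (p.[z] - y0) < d)%R] x) <= N)%N) ->
  bounded_valence Gam d N.
Proof.
move=> G2 N0 H s Gs y0 Ky nKy x y yd; have [->|s0] := eqVneq s [::]; last first.
  by apply: H => //; exact: semigroup_gen_word.
apply: leq_trans N0; apply: leq_trans (count_size _ _) _.
rewrite size_roots_of ?polyB_neq0 ?/pdeg ?size_polyX//.
by rewrite -/(pdeg ('X - y%:P)) pdegB /pdeg size_polyX.
Qed.

(** The boundary of K lies in J(G). A Euclidean disc of uniform radius lies in the spherical ball,
    so its preimage components lie in those of the ball, where the degree bounds the number of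
    roots. *)
Lemma semi_hyperbolic_valence Gam : Gam `<=` poly_ge2 -> semi_hyperbolic (semigroup_gen Gam) ->
  exists d : R, exists N, [/\ 0 < d, (0 < N)%N & bounded_valence Gam d N].
Proof.
move=> G2 [d0 [N [d00 SH]]]; have [d dp Hd] := some_ball d00.
exists d, (maxn N 1); split=> //; first by rewrite leq_max orbT.
apply: bounded_valence_intro => // [|p Gp y0 Ky nKy x y yd]; first by rewrite leq_max orbT.
have p2 := semigroup_gen_ge2 G2 Gp; have p0 : (0 < pdeg p)%N by exact: leq_trans p2.
set A := [set z | cabs (p.[z] - y0) < d].
have [Ax|nAx] := pselect (A x); last first.
  by rewrite connected_component_out// nrt_set0.
have jy : julia (semigroup_gen Gam) (Some y0).
  by move=> fy; apply: nKy; exact: fatou_Khat_interior.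
pose Bs := polymap p @^-1` ball (Some y0 : Chat) d0.
have sub : Some @` A `<=` Bs by move=> _ [z Az <-]; exact: Hd.
pose Vc := connected_component Bs (Some x).
have [|n cn nN] := SH (Some y0) p Vc jy Gp; first by exists (Some x) => //; apply: sub; exists x.
have := cn (Some y) (Hd _ _ yd); rewrite local_degree_sum// => nE.
rewrite leq_max; apply/orP; left; apply: leq_trans nN; rewrite -nE; apply: nrt_sub => z Uz.
have : (Some @` connected_component A x) (Some z) by exists z.
apply: (@connected_component_max _ Bs) => //.
- by exists x => //; exact: connected_component_refl.
- by move=> _ [v /connected_component_sub Av <-]; apply: sub; exists v.
- apply: connected_continuous_connected; first exact: component_connected.
  by apply: continuous_subspaceT; exact: some_continuous.
Qed.

(** The boundary of K is compact and disjoint from the closed postcritical set. Discs of a uniform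
    radius [d] centred on it thus contain no critical values, and the valence is at most 1. *)
Lemma hyperbolic_valence Gam b (W : R) : Gam !=set0 -> Gam `<=` poly_ge2 ->
  1 <= W -> escaping Gam b W -> hyperbolic (semigroup_gen Gam) ->
  exists d : R, exists N, [/\ 0 < d, (0 < N)%N & bounded_valence Gam d N].
Proof.
move=> G0 G2 W1 esc hyp; pose K := Khat (semigroup_gen Gam).
have cK : closed K := Khat_closed W1 esc G0.
have cB : compact (K `&` ~` K°).
  apply: compact_closedI; last by apply: open_closedC; exact: open_interior.
  by apply: (closed_bounded_compact cK (c := b)) => z; exact: (Khat_le W1 esc G0).
pose P (M : R) y0 := forall y, cabs (y - y0) < M^-1 -> ~ postcritical (semigroup_gen Gam) (Some y).
have nM : \forall M \near +oo%R, (K `&` ~` K°) `<=` P M.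
  move/compact_near_coveringP : cB; apply => y0 [Ky nKy].
  have npc : ~ postcritical (semigroup_gen Gam) (Some y0).
    by move=> /hyp fy; apply: nKy; exact: fatou_Khat_interior.
  have oP : open (~` postcritical (semigroup_gen Gam)).
    by apply: closed_openC; exact: closed_closure.
  have /nbhs_someP[e e0 eP] := open_nbhs_nbhs (conj oP npc).
  exists ([set y | cabs (y - y0) < e / 2], [set M | 2 / e <= M]) => /=.
    split; first by apply: near_cabs; rewrite divr_gt0.
    exact: nbhs_pinfty_ge (num_real _).
  case=> y1 M [/= y1e Me] y yM; apply: eP.
  have M0 : 0 < M by apply: lt_le_trans Me; rewrite divr_gt0.
  have : M^-1 <= e / 2 by rewrite -[leRHS]invrK lef_pV2 ?posrE ?invr_gt0 ?divr_gt0// invf_div.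
  by have := cabs_dist y1 y y0; lra.
near (pinfty_nbhs R) => M.
have M0 : 0 < M by near: M; exact: nbhs_pinfty_gt.
have HM : (K `&` ~` K°) `<=` P M by exact: (near nM M).
exists M^-1, 1%N; split=> //; first by rewrite invr_gt0.
apply: bounded_valence_intro => // p Gp y0 Ky nKy x y yd.
have p2 := semigroup_gen_ge2 G2 Gp; have p0 : (0 < pdeg p)%N by exact: leq_trans p2.
apply: nrt_component_le1 => // c rc; rewrite leNgt; apply/negP => lt.
apply: (HM y0 (conj Ky nKy) _ lt); apply: subset_closure; exists p => //.
by apply/critical_valuesP => //; exists c.
Unshelve. all: by end_near. Qed.

End Valence.

(** * Inheritance of hyperbolicity and semi-hyperbolicity by the perturbed semigroup *)

Section Inheritance.
Context {R : realType}.
Local Notation C := R[i].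
Local Notation Chat := (sphere R).
Implicit Types (p q : {poly C}) (x y c : C) (s t w : seq {poly C}).

Context (Gam V : set {poly C}) (b : C) (W s1 s2 r : R) (S : separation Gam V b W s1 s2 r).
Context (Gam0 : Gam !=set0) (Gam2 : Gam `<=` poly_ge2).
Context (PG : postcritically_bounded (semigroup_gen Gam)).
Context (d : R) (N : nat) (d0 : 0 < d) (N0 : (0 < N)%N) (BV : bounded_valence Gam d N).

Local Notation G := (semigroup_gen Gam).
Local Notation H := (semigroup_gen (Gam `|` V)).
Local Notation K := (Khat G).

Let W1 := sep_W1 S.
Let r0 := sep_r0 S.
Let V2 := sep_V2 S.
Let esc := sep_esc S.
Let bdd := sep_bdd S.
Let hV := sep_hV S.
Let rK := sep_rK S.
Let Ks2 := sep_Ks2 S.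
Let escG : escaping Gam b W. Proof. by move=> p Gp; apply: esc; left. Qed.
Let L2 : (Gam `|` V) `<=` poly_ge2. Proof. by move=> p [/Gam2|/V2]. Qed.
Let cK : closed K. Proof. exact: Khat_closed W1 escG Gam0. Qed.
Let Kinv s y : letters (Gam `|` V) s -> K y -> K (word s).[y].
Proof. exact: (Khat_word_invariant r0 hV rK Ks2). Qed.
Let GL s : letters Gam s -> letters (Gam `|` V) s.
Proof. by apply: letters_sub; exact: subsetUl. Qed.

Let R1 := W + d.
Let R1_ge1 : 1 <= 2 * R1.
Proof. by have h1 := W1; have h2 := d0; rewrite /R1; lra. Qed.

(** Outside the escape radius [W] words of [Gam] do not decrease the distance to [b], and [y0] is
    within [W] of [b]. *)
Lemma component_bounded s y0 z : letters Gam s -> K y0 ->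
  cabs ((word s).[z] - y0) < d -> cabs (z - b) <= R1.
Proof.
move=> Gs Ky zd; have h1 := W1; have h2 := d0.
have yW := Khat_le W1 escG Gam0 Ky; rewrite /R1.
have [zW|/ltW Wz] := leP (cabs (z - b)) W; first by lra.
have h3 := escape_word escG Gs Wz; have h4 := cabs_dist y0 (word s).[z] b.
have : cabs (z - b) <= 2 ^+ size s * cabs (z - b) by rewrite ler_peMl// exprn_ege1// ler1n.
by move=> /le_trans /(_ h3); lra.
Qed.

Lemma nearby_boundary x y : K x -> ~ K° y -> exists2 y0, K y0 /\ ~ K° y0 &
  cabs (y0 - y) <= cabs (x - y) /\ cabs (y0 - x) <= cabs (x - y).
Proof.
move=> Kx nKy; have [Ky|nK] := pselect (K y).
  by exists y; rewrite // subrr cabs0; split=> //; rewrite cabsC.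
have [t [/andP[t0 t1] Kt nKt]] := boundary_point cK Kx nK.
exists (x + t%:C * (y - x)) => //; split.
  have -> : x + t%:C * (y - x) - y = (1 - t)%:C * (x - y) by rewrite rmorphB rmorph1; ring.
  by rewrite cabs_realM ?subr_ge0// ler_piMl//; lra.
by rewrite addrAC subrr add0r cabs_realM// (cabsC x y) ler_piMl.
Qed.

Lemma prod_ge_expr (zs : seq C) (P : pred C) (F : C -> R) (e : R) n :
  0 <= e <= 1 -> (count P zs <= n)%N -> (forall z, z \in zs -> P z -> e <= F z) ->
  e ^+ n <= \prod_(z <- zs | P z) F z.
Proof.
move=> /andP[e0 e1] Pn FP; rewrite -big_filter.
apply: (@le_trans _ _ (e ^+ size ([seq z <- zs | P z]))).
  by rewrite ler_wiXn2l// size_filter.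
have := @prod_ler_mul _ _ ([seq z <- zs | P z]) F (fun=> 1) e e0; rewrite big1 ?mulr1//; apply => z.
by rewrite mem_filter => /andP[Pz zz]; split=> //; rewrite /= ?mulr1; exact: FP.
Qed.

(** Let u be the word and [y] a point outside K near u(z). Some boundary point [y0] of K lies
    between them, and the preimages of [y] under u are outside K, hence at distance at least [r]
    from [z]. On the component around [z] over the disc of radius [d] at [y0], [distortion] then
    keeps u(z) at distance at least [eta] from [y]. *)
Lemma orbit_interior : exists2 eta : R, 0 < eta & forall s z, letters Gam s ->
  cabs (z - b) <= 2 * r -> forall y, cabs (y - (word s).[z]) < eta -> K y.
Proof.
have r0' := r0; have d0' := d0.
pose e := Num.min 1 r; have e0 : 0 < e by rewrite lt_min ltr01.
pose eta := Num.min (d / 2) (d / 2 / (2 * R1) ^+ N * e ^+ N).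
have R10 : 0 < (2 * R1) ^+ N by rewrite exprn_gt0//; have := R1_ge1; lra.
have eta0 : 0 < eta by rewrite lt_min divr_gt0//= mulr_gt0 ?exprn_gt0// divr_gt0// divr_gt0.
exists eta => // s z Gs zr y; rewrite lt_min => /andP[y1 y2]; apply: contrapT => nKy.
have Kz : K z by apply: rK; lra.
have nKy' : ~ K° y by move=> /interior_subset.
have [y0 [Ky0 nKy0] [hy hz]] := nearby_boundary (Kinv (GL Gs) Kz) nKy'.
rewrite (cabsC (word s).[z] y) in hy hz.
pose A := [set z | cabs ((word s).[z] - y0) < d].
have Az : A z by rewrite /A /= cabsC; lra.
have p0 := letters_pdeg Gam2 Gs.
have Uz := connected_component_refl Az.
have yd : cabs (y - y0) <= d / 2 by rewrite cabsC; lra.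
have Nrt : (nrt (word s - y%:P) (connected_component A z) <= N)%N.
  by apply: BV => //; lra.
have UR v : connected_component A z v -> cabs (v - b) <= R1.
  by move=> /connected_component_sub; exact: component_bounded.
have := distortion p0 d0 UR R1_ge1 yd Nrt Uz.
apply/negP; rewrite -ltNge cabsC; apply: lt_le_trans y2 _.
rewrite ler_wpM2l//; first by rewrite divr_ge0 ?ltW// divr_gt0.
apply: prod_ge_expr => //; first by rewrite ltW//= ge_min lexx.
move=> v; rewrite mem_roots_of ?polyB_neq0// /root !hornerE subr_eq0 => /eqP vy _.
apply: (@le_trans _ _ r); first by rewrite ge_min lexx orbT.
rewrite leNgt; apply/negP => zv; apply: nKy; rewrite -vy; apply: Kinv; first exact: GL.
by apply: rK; have := cabs_dist z v b; rewrite (cabsC v z); lra.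
Qed.

Lemma word_critical_point s c : letters (Gam `|` V) s -> root (word s)^`() c -> K (word s).[c].
Proof.
move=> Ls rc; have [s_0|s0] := eqVneq s [::].
  by move: rc; rewrite s_0 /= derivX /root hornerC oner_eq0.
apply: (word_critical r0 Gam2 V2 hV rK Ks2 (sep_critV S) PG s0 Ls).
by apply/critical_valuesP; [exact: word_pdeg Ls|exists c].
Qed.

(** A critical value comes either from [p], and is near [b] by assumption, or from the rest of the
    word; then it is the image under [p] of a point of K. *)
Lemma V_word_critical p s c : V p -> letters (Gam `|` V) s -> root (word (p :: s))^`() c ->
  cabs ((word (p :: s)).[c] - b) <= r.
Proof.
move=> Vp Ls; rewrite horner_word_cons /= deriv_comp rootM => /orP[|rc].
  by rewrite root_comp => rc; exact: (sep_critV S Vp).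
by apply: (hV Vp); apply: Ks2; exact: word_critical_point.
Qed.

(** [s] is the longest prefix with letters in [Gam], made of the maps applied last; [t] is empty or
    starts with a letter of [V]. *)
Lemma word_split w : letters (Gam `|` V) w -> exists s t, [/\ w = s ++ t, letters Gam s,
  letters (Gam `|` V) t &
  t = [::] \/ forall c, root (word t)^`() c -> cabs ((word t).[c] - b) <= r].
Proof.
elim: w => [_|p w IH /letters_cons[[Gp|Vp] Lw]]; first by exists [::], [::]; split=> //; left.
- have [s [t [-> Gs Lt Ht]]] := IH Lw; exists (p :: s), t; split=> //.
  exact/letters_cons.
- exists [::], (p :: w); split=> //; first by apply/letters_cons; split=> //; right.
  by right=> c; exact: V_word_critical.
Qed.

(** Let [y] be postcritical and not interior to K, and [x] a nearby critical value of a word. If it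
    came from the inner part [t], it would be the image under [s] of a point near [b], and
    [orbit_interior] would make [y] interior. So it comes from [s]; hence [y] is postcritical for G,
    thus in F(G), and interior after all. *)
Lemma hyperbolic_inherited : hyperbolic G -> hyperbolic H.
Proof.
move=> hyp [y|] py; last exact: (fatou_infty W1 esc bdd L2).
have Ky : K y by exact: (postcritical_Khat W1 r0 Gam0 Gam2 V2 esc hV rK Ks2 (sep_critV S) PG py).
apply: (fatou_Khat_perturbation W1 r0 Gam0 esc bdd hV rK Ks2).
have [eta eta0 Heta] := orbit_interior.
apply: contrapT => nKy; apply: (nKy); apply: fatou_Khat_interior => //; apply: hyp.
move=> B /nbhs_someP[e e0 eB].
pose e' := Num.min e eta; have e'0 : 0 < e' by rewrite lt_min e0.
have nB : nbhs (Some y : Chat) (Some @` [set x | cabs (x - y) < e']).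
  by apply/nbhs_someP; exists e' => // x xe; exists x.
have [v [[p /semigroup_genP[w [w0 Lw ->]] cp] [x /= xe xv]]] := py _ nB; rewrite -xv in cp.
move: xe; rewrite lt_min => /andP[xe xeta].
exists (Some x); split; last exact: eB.
have /critical_valuesP[|c rc xc] := cp; first exact: word_pdeg Lw.
have [s [t [wE Gs Lt [t0|Ht]]]] := word_split Lw.
  by exists (word w) => //; apply: semigroup_gen_word => //; rewrite wE t0 cats0.
have stc : x = (word s).[(word t).[c]] by rewrite xc wE horner_word_cat.
have [rt|nrt] := boolP (root (word t)^`() c).
  exfalso; apply: nKy; apply/nbhs_cabsP; exists (eta - cabs (x - y)); first by rewrite subr_gt0.
  move=> v' v'y; have r0' := r0; apply: (Heta s (word t).[c]) => //.
    by have := Ht _ rt; lra.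
  by rewrite -stc; have := cabs_dist y v' x; rewrite (cabsC y x); lra.
have Gs0 : s != [::].
  by apply: contraNN nrt => /eqP s_0; move: rc; rewrite wE s_0.
move: rc; rewrite wE word_cat deriv_comp rootM (negbTE nrt) orbF root_comp => rs.
exists (word s); first exact: semigroup_gen_word.
apply/critical_valuesP; first exact: (letters_pdeg Gam2 Gs).
by exists (word t).[c].
Qed.

(** Three cases: the disc around [y1] misses K; the word has letters in [Gam] only; or it is [u]
    after [q], with the finite critical values of [q] near [b]. The last two compare with a boundary
    point [y0] of K near [y1]. *)
Lemma word_valence : exists2 d1 : R, 0 < d1 & forall w, letters (Gam `|` V) w ->
  forall y1, julia H (Some y1) -> forall x y, cabs (y - y1) < d1 ->
  (nrt (word w - y%:P)
     (connected_component [set z | (cabs ((word w).[z] - y1) < d1)%R] x) <= N)%N.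
Proof.
have [eta eta0 Heta] := orbit_interior.
have r0' := r0; have d0' := d0.
pose e := Num.min 1 (r / (2 * N.+1%:R)).
have n0 : (0 : R) < N.+1%:R by rewrite ltr0n.
have e0 : 0 < e by rewrite lt_min ltr01 divr_gt0// mulr_gt0.
have e1 : e <= 1 by rewrite ge_min lexx.
have er : 2 * e * N.+1%:R <= r.
  by rewrite mulrAC -ler_pdivlMl ?mulr_gt0// mulrC ge_min lexx orbT.
have R10 : 0 < (2 * R1) ^+ N by rewrite exprn_gt0//; have := R1_ge1; lra.
pose k := d / 2 / (2 * R1) ^+ N; have k0 : 0 < k by rewrite !divr_gt0.
have ke0 : 0 < k * e ^+ N by rewrite mulr_gt0// exprn_gt0.
(* Discs around [y1] are compared with discs of twice the radius around [y0], so [2 * d1] must not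
   exceed [d / 2], nor the lower bound of [distortion] at distance [e] from all roots; [eta / 2]
   serves [x0b]. *)
pose d1 := Num.min (d / 4) (Num.min (eta / 2) (k * e ^+ N / 2)).
have d10 : 0 < d1 by rewrite !lt_min !divr_gt0.
have d1d : 2 * d1 <= d / 2.
  have : d1 <= d / 4 by rewrite ge_min lexx.
  lra.
have d1eta : d1 <= eta / 2 by rewrite !ge_min lexx orbT.
have d1k : 2 * d1 <= k * e ^+ N.
  have : d1 <= k * e ^+ N / 2 by rewrite !ge_min lexx !orbT.
  by move: (k * e ^+ N) => E; lra.
exists d1 => // w Lw y1 jy x y yd1.
have nKy1 : ~ K° y1.
  by move=> Ky; apply: jy; exact: (fatou_Khat_perturbation W1 r0 Gam0 esc bdd hV rK Ks2).
have pw := letters_pdeg L2 Lw.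
set A1 := [set z | _]; have [A1x|nA1x] := pselect (A1 x); last first.
  by rewrite connected_component_out// nrt_set0.
(* Finite critical values of words lie in K, so a disc missing K contains none. *)
have [[z Kz zy1]|far_] := pselect (exists2 z, K z & cabs (z - y1) < d1); last first.
  apply: leq_trans N0; apply: nrt_component_le1 => // c rc; rewrite leNgt; apply/negP => lt.
  by apply: far_; exists (word w).[c] => //; exact: word_critical_point.
have [y0 [Ky0 nKy0] [y01 _]] := nearby_boundary Kz nKy1.
have yy0 v : cabs (v - y1) < d1 -> cabs (v - y0) < 2 * d1.
  by move=> vd; have := cabs_dist y1 v y0; rewrite (cabsC y1 y0); lra.
have [s [t [wE Gs Lt [t0|Ht]]]] := word_split Lw.
  have ws : w = s by rewrite wE t0 cats0.
  have /(_ s Gs y0 Ky0 nKy0 x y) := BV; rewrite -ws.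
  move=> /(_ ltac:(have := yy0 _ yd1; lra)); apply: leq_trans; apply: nrt_sub.
  by apply: component_mono => v /= /yy0; lra.
pose u := word s; pose q := word t; have uq : word w = u \Po q by rewrite wE word_cat.
have u0 : (0 < pdeg u)%N := letters_pdeg Gam2 Gs.
have q0 : (0 < pdeg q)%N := letters_pdeg L2 Lt.
pose x0 := q.[x]; pose B := [set z | cabs (u.[z] - y1) < d1].
pose U := connected_component B x0.
have ux0 : B x0 by move: A1x; rewrite /A1 /B /= uq horner_comp.
pose A0 := [set z | cabs (u.[z] - y0) < d].
have BA0 : B `<=` A0 by move=> v /= /yy0; rewrite /A0 /=; lra.
have UU0 : U `<=` connected_component A0 x0 by exact: component_mono.
(* By [distortion] every point of [U] is within [e] of one of at most [N] roots of [u - y0%:P], so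
   [small_component] confines the connected set [U]. *)
have Usmall v : U v -> cabs (v - x0) < r.
  apply: (@small_component _ U x0
    [seq z <- roots_of (u - y0%:P) | `[< connected_component A0 x0 z >]] N r e) => //.
  - exact: component_connected.
  - exact: connected_component_refl.
  - rewrite size_filter; apply: (BV Gs Ky0 nKy0 x0).
    by rewrite subrr cabs0.
  - move=> v' Uv'; apply: contrapT => nz.
    have UR v'' : connected_component A0 x0 v'' -> cabs (v'' - b) <= R1.
      by move=> /connected_component_sub; exact: component_bounded.
    have yd : cabs (y0 - y0) <= d / 2 by rewrite subrr cabs0; lra.
    have Nr : (nrt (u - y0%:P) (connected_component A0 x0) <= N)%N.
      by apply: (BV Gs Ky0 nKy0 x0); rewrite subrr cabs0.
    have := distortion u0 d0 UR R1_ge1 yd Nr (UU0 _ Uv').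
    have uv' : cabs (u.[v'] - y0) < 2 * d1 by apply: yy0; exact: (connected_component_sub Uv').
    apply/negP; rewrite -ltNge; apply: (lt_le_trans uv'); apply: (le_trans d1k).
    rewrite ler_wpM2l//; first exact: ltW.
    apply: prod_ge_expr => //; first by rewrite ltW.
    move=> z' z'r /asboolP Uz'; rewrite leNgt; apply/negP => lt; apply: nz; exists z' => //.
    by rewrite mem_filter z'r andbT; exact/asboolP.
(* Otherwise [orbit_interior] would put a disc around [y1] inside K. *)
have x0b : 2 * r < cabs (x0 - b).
  rewrite ltNge; apply/negP => x0r; apply: nKy1; apply/nbhs_cabsP; exists (eta / 2).
    by rewrite divr_gt0.
  move=> v vy; apply: (Heta s x0 Gs x0r); have := cabs_dist y1 v u.[x0].
  by move: ux0; rewrite /B /= -/u (cabsC u.[x0] y1); lra.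
have nc c : root q^`() c -> r <= cabs (q.[c] - x0).
  move=> /Ht; rewrite -/q => cr; have := cabs_dist q.[c] x0 b.
  by rewrite (cabsC x0 q.[c]); lra.
pose V' := connected_component A1 x.
have qU z' : V' z' -> U q.[z'].
  move=> V'z'; apply: (@connected_component_max _ B [set q.[v] | v in V']).
  - by exists x => //; exact: connected_component_refl.
  - move=> _ [v /connected_component_sub A1v <-]; move: A1v.
    by rewrite /A1 /B /= uq horner_comp.
  - by apply: horner_image_connected; exact: component_connected.
  - by exists z'.
have V'sub : V' `<=` connected_component [set z | cabs (q.[z] - x0) < r] x.
  apply: connected_component_max; last exact: component_connected.
    exact: connected_component_refl.
  by move=> v /qU; exact: Usmall.
have one zeta : (nrt (q - zeta%:P) V' <= `[< U zeta >])%N.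
  have [->//|] := posnP (nrt (q - zeta%:P) V').
  move=> /(nrt_gt0 q0)[v V'v qv]; have Uz : U zeta by rewrite -qv; exact: qU.
  rewrite (asboolT Uz); apply: leq_trans (nrt_sub _ V'sub) _.
  by apply: nrt_component_le1 => //; exact: Usmall.
have uy0 := polyB_neq0 y u0.
(* The valence of [u \Po q] over [y] is the sum, over the roots [zeta] of [u - y%:P], of the valence
   of [q] over [zeta]; by [one] each summand is at most 1, and 0 unless [zeta] is in [U]. *)
have -> : word w - y%:P = lead_coef (u - y%:P) *: \prod_(zeta <- roots_of (u - y%:P)) (q - zeta%:P).
  rewrite uq -[in LHS](comp_polyC y q) -comp_polyB [in LHS](roots_ofE (u - y%:P)).
  rewrite comp_polyZ; congr (_ *: _); rewrite rmorph_prod; apply: eq_bigr => zeta _ /=.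
  by rewrite comp_polyB comp_polyX comp_polyC.
rewrite nrt_scale ?lead_coef_eq0//; last first.
  by elim/big_ind : _ => [|p1 p2 ? ?|zeta _]; rewrite ?oner_neq0// ?mulf_neq0// polyB_neq0.
rewrite nrt_prod; last by move=> zeta; exact: polyB_neq0.
apply: (@leq_trans (nrt (u - y%:P) U)).
  rewrite /nrt -sum1_count [leqRHS]big_mkcond /=; apply: leq_sum => zeta _.
  by apply: leq_trans (one zeta) _; case: `[< _ >].
apply: leq_trans (nrt_sub _ UU0) _; apply: (BV Gs Ky0 nKy0).
by have := yy0 _ yd1; lra.
Qed.

(** Clearing denominators, membership in the cap reads [0 < f] with [f] quadratic. The coefficient
    [a3 - k] of its square terms is at most 0 because infinity lies outside the cap, so [f] is
    concave: this is [fE]. The ball is then connected in the plane. *)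
Lemma ball_plane_convex (y : C) (e : R) : 0 <= e <= pi -> ~ ball (Some y : Chat) e None ->
  convex_set_C [set x | ball (Some y : Chat) e (Some x)].
Proof.
move=> epi nN x x' /(ball_cosP _ _ epi) hx /(ball_cosP _ _ epi) hx' t t01.
apply/(ball_cosP _ _ epi); have : ~~ (cos e < dot3 (stereo (Some y)) (stereo None)).
  by apply/negP => h; apply: nN; exact/(ball_cosP _ _ epi).
rewrite -leNgt; move: hx hx'; move: (stereo _) => [[a1 a2] a3].
case: x => p q; case: x' => p' q' /=; rewrite /dot3 /= !mulr0 !add0r mulr1.
move: (cos e) => k; set S0 := _ + 1; set S1 := _ + 1; set S2 := _ + 1.
have pos (v v' : R) : 0 < v ^+ 2 + v' ^+ 2 + 1 by rewrite ltr_wpDl// addr_ge0// sqr_ge0.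
have E (v v' : R) : a1 * (2 * v / (v ^+ 2 + v' ^+ 2 + 1)) + a2 * (2 * v' / (v ^+ 2 + v' ^+ 2 + 1)) +
    a3 * ((v ^+ 2 + v' ^+ 2 - 1) / (v ^+ 2 + v' ^+ 2 + 1)) =
    (2 * a1 * v + 2 * a2 * v' + a3 * (v ^+ 2 + v' ^+ 2 - 1)) / (v ^+ 2 + v' ^+ 2 + 1).
  by have := pos v v'; set T := _ + 1 => /lt0r_neq0 T0; field.
rewrite /S0 /S1 /S2 !E !ltr_pdivlMr// => h1 h2 h3; case/andP: t01 => t0 t1.
rewrite !mul0r !subr0 !addr0.
have h4 : 0 <= (k - a3) * (t * (1 - t) * ((p - p') ^+ 2 + (q - q') ^+ 2)).
  rewrite mulr_ge0 ?subr_ge0//; rewrite mulr_ge0 ?addr_ge0 ?sqr_ge0//.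
  by rewrite mulr_ge0// subr_ge0.
pose f (v v' : R) := 2 * a1 * v + 2 * a2 * v' + a3 * (v ^+ 2 + v' ^+ 2 - 1) -
  k * (v ^+ 2 + v' ^+ 2 + 1).
have fE : f (p + t * (p' - p)) (q + t * (q' - q)) =
    (1 - t) * f p q + t * f p' q' + (k - a3) * (t * (1 - t) * ((p - p') ^+ 2 + (q - q') ^+ 2)).
  by rewrite /f; ring.
have f1 : 0 < f p q by rewrite subr_gt0.
have f2 : 0 < f p' q' by rewrite subr_gt0.
rewrite -subr_gt0 -/(f _ _) fE.
have [->|tn] := eqVneq t 0.
  by rewrite subr0 mul1r !mul0r !mulr0 !addr0.
have tp : 0 < t by rewrite lt_def tn.
apply: ltr_wpDr => //; apply: ltr_wpDl; last exact: mulr_gt0.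
by rewrite mulr_ge0 ?subr_ge0// ltW.
Qed.

(** J(H) is bounded, so one spherical radius fits into all Euclidean discs of radius [d1] centred on
    it. The root count over such a ball is constant by [nrt_component], which makes it the degree of
    a covering. *)
Lemma semi_hyperbolic_inherited : semi_hyperbolic H.
Proof.
have [d1 d10 Hd1] := word_valence; have W1' := W1.
have [d2 d20 Hd2] := @ball_some R (3 * W + cabs b) d1 d10.
(* Capped at [pi], up to which [cos] describes balls. *)
pose dH := Num.min d2 pi; have dH0 : 0 < dH by rewrite lt_min d20 pi_gt0.
have dHpi : 0 <= dH <= pi by rewrite (ltW dH0) ge_min lexx orbT.
exists dH, N; split=> // y _ D jy /semigroup_genP[w [w0 Lw ->]] [v0 Bv0 DE].
have [y1 yE y1W] := julia_bounded W1 esc bdd L2 jy; rewrite {}yE in jy Bv0 DE *.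
have pw : (0 < pdeg (word w))%N := word_pdeg Gam2 V2 w0 Lw.
have bsmall z : ball (Some y1 : Chat) dH z -> exists2 y', z = Some y' & cabs (y' - y1) < d1.
  move=> bz; apply: Hd2; first by have := cabsB y1 b; lra.
  by apply: le_ball bz; rewrite ge_min lexx.
have nN : ~ ball (Some y1 : Chat) dH None by move=> /bsmall[].
pose B := [set x | ball (Some y1 : Chat) dH (Some x)].
have oB : open B.
  rewrite openE => x Bx; apply: (some_continuous (x := x)).
  have : open (ball (Some y1 : Chat) dH).
    rewrite openE => z; rewrite ball_sphE => zd; apply/nbhs_ballP.
    exists (dH - sph_dist (Some y1) z); first by rewrite /= subr_gt0.
    move=> z'; rewrite !ball_sphE => zz'.
    by have := sph_dist_triangle z (Some y1) z'; lra.
  by rewrite openE; exact.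
have cB : connected B by apply: convex_connected; exact: ball_plane_convex.
have By1 : B y1 by exact: ballxx.
set A := polymap (word w) @^-1` ball (Some y1 : Chat) dH in Bv0 DE.
have AS : A `<=` range Some.
  move=> [z|]; first by exists z.
  move=> h; have : ball (Some y1 : Chat) dH (polymap (word w) None) := h.
  by rewrite polymap_infty// => /nN.
have [x _ xv0] := AS _ Bv0; rewrite -xv0 in Bv0 DE.
have DP : plane_part D = connected_component [set z | B (word w).[z]] x.
  by rewrite DE component_plane.
exists (nrt (word w - y1%:P) (plane_part D)).
  move=> z /[dup] bz /bsmall[y' zE _]; rewrite zE in bz *.
  by rewrite local_degree_sum// DP; exact: (@nrt_component _ (word w) B x pw oB cB y' y1 bz By1).
apply: leq_trans (Hd1 w Lw y1 jy x y1 _); last by rewrite subrr cabs0.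
apply: nrt_sub; rewrite DP; apply: component_mono => z /= Bz.
by have [y' [->]] := bsmall _ Bz.
Qed.

End Inheritance.

Theorem proposition2p40 (R : realType) (G Gamma : set {poly R[i]}) (b : R[i])
    (d : nat) :
  Gamma !=set0 -> Gamma `<=` poly_ge2 -> poly_compact Gamma ->
  G = semigroup_gen Gamma ->
  postcritically_bounded G ->
  (Khat G)° b ->
  (2 <= d)%N ->
  (forall h, Gamma h -> (d, pdeg h) <> (2%N, 2%N)) ->
  let g (a : R[i]) : {poly R[i]} := a *: ('X - b%:P) ^+ d + b%:P in
  let H (V' : set {poly R[i]}) := semigroup_gen (Gamma `|` V') in
  let conclusion (V' : set {poly R[i]}) :=
    [/\ postcritically_bounded_dis (H V'), Khat (H V') = Khat G
      & gen_min (Gamma `|` V') `<=` Gamma] in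
  [/\ exists2 c : R, 0 < c & forall a : R[i], 0 < `|a| < c%:C ->
        exists2 V, compact_nbhs_ge2 (g a) V &
          forall V', V' !=set0 -> V' `<=` V -> conclusion V',
      semi_hyperbolic G ->
      exists2 c : R, 0 < c & forall a : R[i], 0 < `|a| < c%:C ->
        exists2 V, compact_nbhs_ge2 (g a) V &
          forall V', V' !=set0 -> V' `<=` V ->
            conclusion V' /\ semi_hyperbolic (H V')
    & hyperbolic G ->
      exists2 c : R, 0 < c & forall a : R[i], 0 < `|a| < c%:C ->
        exists2 V, compact_nbhs_ge2 (g a) V &
          forall V', V' !=set0 -> V' `<=` V ->
            conclusion V' /\ hyperbolic (H V')].
Proof.
move=> G0 G2 cG -> PG Kb d2 Gd g H conclusion.
have [c c0 sep] := separation_exists G0 G2 cG Kb d2 Gd.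
have {}sep a : 0 < `|a| < c%:C -> exists W s1 s2 r, exists2 V,
    compact_nbhs_ge2 (g a) V & separation Gamma V b W s1 s2 r.
  by rewrite normr_cabs !ltcR => /sep.
have conc V b' W s1 s2 r : separation Gamma V b' W s1 s2 r -> V !=set0 -> conclusion V.
  case=> W1 s12 s2W r0 s10 V2 esc bdd hG hV rK Ks2 critV V0.
  exact: (perturbation_conclusion W1 s12 s2W r0 s10 G0 G2 V2 esc bdd hG hV rK Ks2 critV PG V0).
(* The same [c] and [V] serve all three claims: the separation data do not involve the valence
   constants, which enter only afterwards. *)
split=> [|sh|hyp]; exists c => // a /sep[W [s1 [s2 [r [V nV S]]]]]; exists V => // V' V0 VV.
- exact: conc (separation_sub VV S) V0.
- have S' := separation_sub VV S; split; first exact: conc S' V0.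
  have [e [N [e0 N0 BV]]] := semi_hyperbolic_valence G2 sh.
  exact: (semi_hyperbolic_inherited S' G0 G2 PG e0 N0 BV).
- have S' := separation_sub VV S; split; first exact: conc S' V0.
  have escG : escaping Gamma b W by move=> p Gp; apply: (sep_esc S); left.
  have [e [N [e0 N0 BV]]] := hyperbolic_valence G0 G2 (sep_W1 S) escG hyp.
  exact: (hyperbolic_inherited S' G0 G2 PG e0 BV hyp).
Qed.
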